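(* Let $k\ge1$ and $d\ge1$. Then $J^{\star,(\alpha)}_{(k)}(\mathbf r^{\mathbf p})=k!\,\mathrm{Ko}^{(\alpha)}_{(k)}(\mathbf r^{\mathbf p})$, and, as a function of $\alpha$ and of $\mathbf p=(p_1,\dots,p_d),\mathbf r=(r_1,\dots,r_d)\in\mathbb Z_{\ge0}^d$, this quantity is given by a polynomial in $\mathbb Q[\alpha,p_1,\dots,p_d,r_1,\dots,r_d]$ whose expansion in the $\alpha$-falling factorial basis has only non-negative rational coefficients.
   Context: $\alpha$ is a parameter (an indeterminate). An $\alpha$-shifted symmetric function is a sequence $F=(F_N)_{N\ge1}$ with $F_N\in\mathbb Q(\alpha)[x_1,\dots,x_N]$ symmetric in the variables $x_1-1/\alpha,\dots,x_N-N/\alpha$, such that $F_{N+1}(x_1,\dots,x_N,0)=F_N(x_1,\dots,x_N)$ and $\sup_N\deg F_N<\infty$. For a Young diagram $\lambda$ with $\ell$ rows, $F(\lambda)=F_\ell(\lambda_1,\dots,\lambda_\ell)$. Multirectangular coordinates: for $\mathbf p,\mathbf r$ with non-negative integer entries, $\mathbf r^{\mathbf p}$ is the Young diagram which, for $s=1,\dots,d$ from top to bottom, has $p_s$ rows of length $r_s+\dots+r_d$. $(x)_a=x(x-1)\cdots(x-a+1)$. The $\alpha$-falling factorial basis of $\mathbb Q[\alpha,p_1,\dots,p_d,r_1,\dots,r_d]$ consists of $\alpha^c(p_1)_{a_1}\cdots(p_d)_{a_d}(r_1)_{b_1}\cdots(r_d)_{b_d}$, $c,a_i,b_i\ge0$.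 $J^{(\alpha)}_\lambda$ denotes the Jack symmetric function in Macdonald's $J$-normalization, and $\widehat K^{\lambda,(\alpha)}_\tau$ its coefficients in the monomial basis: $J^{(\alpha)}_\lambda=\sum_{\tau\vdash|\lambda|}\widehat K^{\lambda,(\alpha)}_\tau M_\tau$. For $\mu\vdash k$ and $|\lambda|=n$: $\mathrm{Ko}^{(\alpha)}_\mu(\lambda)=\widehat K^{\lambda,(\alpha)}_{\mu1^{n-k}}/(n-k)!$ if $n\ge k$, and $0$ otherwise ($\mu1^{n-k}$ is $\mu$ with $n-k$ parts $1$ appended). For a box $s$ of $\lambda$, $a_\lambda(s)$ (arm) is the number of boxes of $\lambda$ strictly to the right of $s$ in its row and $l_\lambda(s)$ (leg) the number strictly below it in its column; $H^{(\alpha)}_\lambda=\prod_{s\in\lambda}(\alpha a_\lambda(s)+l_\lambda(s)+1)$ and $H'^{(\alpha)}_\lambda=\prod_{s\in\lambda}(\alpha a_\lambda(s)+l_\lambda(s)+\alpha)$. The shifted Jack polynomial $J^{\star,(\alpha)}_\mu$ is the unique $\alpha$-shifted symmetric function of degree at most $|\mu|$ such that for every partition $\lambda$ with $|\lambda|\le|\mu|$, $J^{\star,(\alpha)}_\mu(\lambda)=H^{(\alpha)}_\lambda H'^{(\alpha)}_\lambda/\alpha^{|\mu|}$ if $\lambda=\mu$ and $0$ otherwise. *)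

(* Defs.v *)
From HB Require Import structures.
From mathcomp Require Import all_boot all_order all_algebra all_fingroup.
Set Implicit Arguments. Unset Strict Implicit. Unset Printing Implicit Defensive.
Import Order.TTheory GRing.Theory Num.Theory.
Local Open Scope ring_scope.

Definition Qa : fieldType := {fraction {poly rat}}.
Definition alpha : Qa := tofrac ('X : {poly rat}).

Definition is_part (la : seq nat) : bool :=
  sorted geq la && all (fun x => 0 < x)%N la.

Definition dominated (tau la : seq nat) : bool :=
  (sumn tau == sumn la) &&
  all (fun i => sumn (take i tau) <= sumn (take i la))%N (iota 0 (size tau).+1).

(* arm and leg of the box in row i, column j (0-indexed) *)
Definition arm (la : seq nat) (i j : nat) : nat := (nth 0 la i - j - 1)%N.
Definition leg (la : seq nat) (i j : nat) : nat :=
  (count (fun x => j < x)%N la - i - 1)%N.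

Definition hookH (la : seq nat) : Qa :=
  \prod_(i < size la) \prod_(j < nth 0%N la i)
    (alpha * (arm la i j)%:R + (leg la i j)%:R + 1).
Definition hookH' (la : seq nat) : Qa :=
  \prod_(i < size la) \prod_(j < nth 0%N la i)
    (alpha * (arm la i j)%:R + (leg la i j)%:R + alpha).

(* A homogeneous symmetric function is given by a finite list of pairs
   (c, rho) standing for sum c * p_rho (power-sum basis). *)
Definition psum_expr := seq (Qa * seq nat).

(* coefficient of m_tau in p_rho: number of maps f from the parts of rho to
   the rows of tau such that the parts sent to row i sum to tau_i *)
Definition pm_coef (rho tau : seq nat) : nat :=
  #|[set f : {ffun 'I_(size rho) -> 'I_(size tau)} |
      [forall i : 'I_(size tau),
         (\sum_(j | f j == i) nth 0 rho j)%N == nth 0 tau i]]|.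

Definition mcoef (A : psum_expr) (tau : seq nat) : Qa :=
  \sum_(x <- A) x.1 * (pm_coef x.2 tau)%:R.

Definition zee (rho : seq nat) : nat :=
  \prod_(1 <= i < (sumn rho).+1) (i ^ count_mem i rho * (count_mem i rho)`!)%N.

Definition jack_ip (A B : psum_expr) : Qa :=
  \sum_(x <- A) \sum_(y <- B)
     x.1 * y.1 * (if x.2 == y.2 then (zee x.2)%:R * alpha ^+ size x.2 else 0).

(* J : family of symmetric functions indexed by partitions which is the family
   of Jack symmetric functions in Macdonald's J-normalization:
   J_la = H_la * P_la, P_la = m_la + lower terms (dominance), P's orthogonal. *)
Definition is_Jack_J_family (J : seq nat -> psum_expr) : Prop :=
  forall la, is_part la ->
    [/\ all (fun x => is_part x.2 && (sumn x.2 == sumn la)) (J la),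
        (forall tau, is_part tau -> mcoef (J la) tau != 0 -> dominated tau la),
        mcoef (J la) la = hookH la &
        (forall mu, is_part mu -> mu != la -> jack_ip (J la) (J mu) = 0)].

Definition Ko_row (J : seq nat -> psum_expr) (k : nat) (la : seq nat) : Qa :=
  let n := sumn la in
  if (k <= n)%N then mcoef (J la) (k :: nseq (n - k) 1%N) / ((n - k)`!)%:R
  else 0.

(* F : seq Qa -> Qa; its restriction to lists of size N is F_N. *)
Definition poly_fun_deg (N D : nat) (F : seq Qa -> Qa) : Prop :=
  exists s : seq (Qa * seq nat),
    all (fun m => (size m.2 == N) && (sumn m.2 <= D)%N) s /\
    forall x : seq Qa, size x = N ->
      F x = \sum_(m <- s) m.1 * \prod_(i < N) (nth 0 x i) ^+ (nth 0%N m.2 i).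

(* F_N symmetric in x_1 - 1/alpha, ..., x_N - N/alpha *)
Definition shifted_sym (F : seq Qa -> Qa) : Prop :=
  forall (x : seq Qa) (s : 'S_(size x)),
    F [seq nth 0 x (s i) - (s i).+1%:R / alpha + (i.+1)%:R / alpha
       | i <- enum 'I_(size x)] = F x.

Definition stable (F : seq Qa -> Qa) : Prop :=
  forall x : seq Qa, F (rcons x 0) = F x.

Definition evalF (F : seq Qa -> Qa) (la : seq nat) : Qa :=
  F [seq (n%:R : Qa) | n <- la].

Definition is_shifted_Jack (mu : seq nat) (F : seq Qa -> Qa) : Prop :=
  [/\ forall N, poly_fun_deg N (sumn mu) F,
      shifted_sym F,
      stable F &
      forall la, is_part la -> (sumn la <= sumn mu)%N ->
        evalF F la = if la == mu then hookH la * hookH' la / alpha ^+ sumn mu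
                     else 0].

Definition multirect (d : nat) (p r : 'I_d -> nat) : seq nat :=
  filter (fun x => 0 < x)%N
    (flatten [seq nseq (p s) (\sum_(t : 'I_d | s <= t) r t)%N | s <- enum 'I_d]).

(* a term (c, e, a, b) stands for c * alpha^e * prod_i (p_i)_{a_i} (r_i)_{b_i} *)
Definition ff_term (d : nat) := (rat * nat * ('I_d -> nat) * ('I_d -> nat))%type.

Definition ff_eval (d : nat) (P : seq (ff_term d)) (p r : 'I_d -> nat) : Qa :=
  \sum_(t <- P) (ratr t.1.1.1 * alpha ^+ t.1.1.2 *
     \prod_(i < d) (((p i) ^_ (t.1.2 i))%N%:R * ((r i) ^_ (t.2 i))%N%:R)).

Definition ff_nonneg (d : nat) (P : seq (ff_term d)) : bool :=
  all (fun t => 0 <= t.1.1.1) P.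

(* Main.v *)
(* Both sides equal k! times an explicit function [rowJ k].

   For the Jack side, the coefficients u_la(tau) of J_la are eigenfunctions of the
   powers of the Nazarov-Sklyanin Lax operator: it is self-adjoint for the Jack scalar
   product and triangular on monomials. Reading the eigenvalue equations at
   (mu, 1^(n - |mu|)) and dividing by (n - |mu|)! gives relations that do not depend on
   n: an eigenvalue times Ko_mu(la) is a universal combination of the Ko_nu(la). The
   eigenvalues generate the symmetric functions of the alpha-contents
   alpha la_i - i, so every shifted symmetric function F of degree at most k satisfies
   F(la) Ko_0(la) = sum over |nu| <= k of f_nu Ko_nu(la). If F vanishes on all |la| <= k
   except (k), only the term nu = (k) survives, whence F is proportional to
   Ko_(k) / Ko_0. Removing the first row of la, again with the eigenvalue equations,
   gives Ko_0 = 1.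

   On the explicit side, [rowJ k] is shifted symmetric by Vandermonde's identity and
   vanishes when la_1 < k. Summing it over blocks of equal rows gives products of
   p (p + alpha) (p + 2 alpha) ... and falling factorials (R - c)(R - c - 1) ... with R
   the row length, and these expand positively. *)
Require Import Defs.
From HB Require Import structures.
From mathcomp Require Import all_boot all_order all_algebra all_fingroup.
From mathcomp Require Import ring lra zify mpoly.
Import Order.TTheory GRing.Theory Num.Theory.
Local Open Scope ring_scope.

(** The constant k! comes from a single row: H'_(k) = alpha^k k!, so the value prescribed for the
    shifted Jack polynomial at (k) is k! H_(k), while Ko_(k) and [rowJ k] both equal H_(k) there.
    The obstacle is Ko_0 = 1: the definition of J_la fixes only its dominant coefficient, at the
    opposite end from that of 1^n. Two evaluations of Ko_(r) at la = (r, mu) settle it. Extracting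
    the row r gives (H_la / H_mu) Ko_0(mu); the vanishing argument gives [rowJ r] at la times
    Ko_0(la). Both factors are the product of the hooks of the first row. The vanishing argument by
    itself leaves the unknown factor Ko_0((k)), so single rows need their own induction. Extracting
    a row needs an eigenvalue that tells partitions apart. The one with m = 3 is the first to see
    more than |la|; it is alpha^2 times the sum of the la_i^2 plus an integer multiple of alpha, so
    it separates partitions with different sums of squares. The same statistic orders the triangular
    expansions, which keeps a single order throughout. *)

(* The only property of the indeterminate [alpha] that is used. *)
Lemma alpha_lin_eq0 (a b : int) :
  a%:~R + b%:~R * alpha = 0 -> a = 0 /\ b = 0.
Proof.
have E (z : int) : z%:~R = tofrac (z%:~R)%:P :> Qa by rewrite !rmorph_int.
rewrite /alpha !E -tofracM -tofracD => /eqP; rewrite tofrac_eq0 => /eqP H.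
have H0 := congr1 (fun p : {poly rat} => p`_0) H.
have H1 := congr1 (fun p : {poly rat} => p`_1) H.
move: H0 H1; rewrite !coefD !coefCM !coefC !coefX /= mulr0 mulr1 addr0 add0r.
by move=> /eqP; rewrite intr_eq0 => /eqP -> /eqP; rewrite intr_eq0 => /eqP ->.
Qed.

Lemma perm_adjacent (T : eqType) (R : Type) (f : seq T -> R) :
  (forall s1 a b s2, f (s1 ++ a :: b :: s2) = f (s1 ++ b :: a :: s2)) ->
  forall s t, perm_eq s t -> f s = f t.
Proof.
move=> f_adj s; elim: s f f_adj => [|a s IH] f f_adj t.
  by move/perm_size/eqP; rewrite eq_sym => /nilP ->.
move=> st; have a_t : a \in t by rewrite -(perm_mem st) mem_head.
case/splitPr: a_t st => t1 t2.
rewrite -[a :: t2]cat1s perm_sym perm_catCA perm_sym /= perm_cons => st.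
have -> : f (a :: s) = f (a :: t1 ++ t2).
  by apply: (IH (f \o cons a)) => // s1 x y s2; apply: (f_adj (a :: s1)).
elim/last_ind: t1 t2 {st} => //= t1 x IHt t2.
by rewrite !cat_rcons IHt f_adj.
Qed.

(** * The row function: shifted symmetry, vanishing and top value *)

Section RowFunction.

Variables (K : fieldType) (al : K).
Hypothesis al_lin : forall a b : int, a%:~R + b%:~R * al = 0 -> a = 0 /\ b = 0.

Lemma al_natr_eq0 n : (n%:R == 0 :> K) = (n == 0)%N.
Proof.
apply/eqP/eqP => [H|->//].
have [|[]//] := al_lin n%:Z 0.
by rewrite mulr0z mul0r addr0 -pmulrn.
Qed.

Lemma al_fact_neq0 n : n`!%:R != 0 :> K.
Proof. by rewrite al_natr_eq0 -lt0n fact_gt0. Qed.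

Lemma al_neq0 : al != 0.
Proof.
by apply/eqP => H; have [] := al_lin 0 1; rewrite ?H ?mulr0 ?addr0 ?mulr0z.
Qed.

Lemma al_nat_neq0 (m n : nat) : (0 < m)%N -> m%:R + n%:R * al != 0.
Proof.
move=> m0; apply/eqP => H; have [] := al_lin m n; first by rewrite -!pmulrn.
by case: m m0 {H}.
Qed.

Lemma al_natr_inj : injective (fun n => n%:R : K).
Proof.
move=> m n /= H; have [|] := al_lin (m%:Z - n%:Z) 0; last by lia.
by rewrite mulr0z mul0r addr0 rmorphB /= -!pmulrn H subrr.
Qed.

(** Step [al] gives the row weights and step -1 the falling factorials; a common definition lets one
    Vandermonde identity serve both. *)
Definition rise (c x : K) (m : nat) : K := \prod_(t < m) (x + t%:R * c).

Lemma rise0 c x : rise c x 0 = 1. Proof. by rewrite /rise big_ord0. Qed.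

Lemma riseSr c x m : rise c x m.+1 = rise c x m * (x + m%:R * c).
Proof. by rewrite /rise big_ord_recr. Qed.

Lemma riseSl c x m : rise c x m.+1 = x * rise c (x + c) m.
Proof.
rewrite /rise big_ord_recl mul0r addr0; congr (_ * _).
by apply: eq_bigr => i _; rewrite lift0 -natr1; ring.
Qed.

Lemma riseD c x m n : rise c x (m + n) = rise c x m * rise c (x + m%:R * c) n.
Proof.
elim: n => [|n IH]; first by rewrite addn0 rise0 mulr1.
by rewrite addnS !riseSr IH natrD; ring.
Qed.

(** With T_m = [rise c z m] / m!, one has (m + 1) T_(m+1) = (z + m c) T_m. Writing n + 1 = i + (n +
    1 - i) and lowering the index of the factor concerned brings each half back to level n, where
    the two linear factors add up to x + y + n c. *)
Lemma rise_vandermonde c x y n :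
  \sum_(i < n.+1) (rise c x i / i`!%:R) * (rise c y (n - i) / (n - i)`!%:R)
  = rise c (x + y) n / n`!%:R.
Proof.
have g z m : m.+1%:R * (rise c z m.+1 / m.+1`!%:R)
           = (z + m%:R * c) * (rise c z m / m`!%:R).
  rewrite riseSr factS natrM; field.
  by rewrite al_fact_neq0 nat1r al_natr_eq0.
elim: n => [|n IH]; first by rewrite big_ord1 !rise0 fact0 !divr1 mulr1.
apply: (mulfI (_ : n.+1%:R != 0)); first by rewrite al_natr_eq0.
rewrite g -IH !mulr_sumr.
under eq_bigr => i _.
  have -> : n.+1%:R = i%:R + (n.+1 - i)%:R :> K
    by rewrite -natrD subnKC // -ltnS.
  rewrite mulrDl; over.
rewrite big_split /= big_ord_recl mul0r add0r.
rewrite [X in _ + X]big_ord_recr /= subnn mul0r addr0 -big_split /=.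
apply: eq_bigr => i _.
have le_in : (i <= n)%N by rewrite -ltnS.
rewrite /bump leq0n add1n subSS [i.+1%:R * _]mulrA g.
rewrite subSn // [(n - i).+1%:R * _]mulrCA g natrB //; ring.
Qed.

(* For a partition the value [rowJ k la] counts the placements of [k] boxes of
   [la] in distinct columns, a row with [m] boxes having weight
   [1 (1 + alpha) ... (1 + (m - 1) alpha)]. *)
Fixpoint rowJ (k : nat) (s : seq K) : K :=
  if s is x :: s' then
    \sum_(m < k.+1) rise al 1 m / m`!%:R * rise (-1) (x - (k - m)%:R) m
                    * rowJ (k - m) s'
  else (k == 0)%:R.

Lemma rowJ0 s : rowJ 0 s = 1.
Proof.
elim: s => //= x s IH.
by rewrite big_ord1 !rise0 subn0 IH !mulr1 fact0 divr1.
Qed.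

Lemma fall_shift z m :
  rise (-1) (z + 1) m.+1 = rise (-1) z m.+1 + m.+1%:R * rise (-1) z m.
Proof. by rewrite riseSl addrK riseSr -natr1; ring. Qed.

(** For a partition, adding 1 to every row adds a full column. A placement of k + 1 boxes either
    avoids it or puts one box there; a row already holding m boxes then gains the factor 1 + m al,
    and over the rows these factors add up to [size s] + k al. *)
Lemma rowJ_shift k s :
  rowJ k.+1 [seq x + 1 | x <- s]
  = rowJ k.+1 s + ((size s)%:R + k%:R * al) * rowJ k s.
Proof.
elim: s k => [|x s IH] k.
  by case: k => [|k]; rewrite /= !(mulr0n, mul0r, mulr0, addr0, add0r).
pose A m := rise al 1 m / m`!%:R : K.
have AS m : m.+1%:R * A m.+1 = (1 + m%:R * al) * A m.
  rewrite /A riseSr factS natrM; field.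
  by rewrite al_fact_neq0 nat1r al_natr_eq0.
pose z m : K := x - (k.+1 - m)%:R.
have zE (m : 'I_k.+1) : z m + 1 = x - (k - m)%:R.
  by rewrite /z (subSn (leq_ord m)) -natr1; ring.
have -> : rowJ k.+1 [seq x + 1 | x <- x :: s] =
   \sum_(m < k.+2) A m * rise (-1) (z m + 1) m * rowJ (k.+1 - m) s
  + \sum_(m < k.+1) A m * rise (-1) (z m + 1) m *
       (((size s)%:R + (k - m)%:R * al) * rowJ (k - m) s).
  rewrite /= [LHS]big_ord_recr [X in _ = X + _]big_ord_recr /= subnn !rowJ0.
  rewrite [RHS]addrAC.
  congr (_ + _); last by rewrite /z subnn !subr0.
  rewrite -big_split /=; apply: eq_bigr => i _.
  rewrite /z (subSn (leq_ord i)) IH -mulrDr -/(A i).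
  by congr (_ * rise _ _ _ * _); rewrite addrAC.
have -> : \sum_(m < k.+2) A m * rise (-1) (z m + 1) m * rowJ (k.+1 - m) s
  = rowJ k.+1 (x :: s) + \sum_(m < k.+1) (1 + m%:R * al) * (A m *
       rise (-1) (x - (k - m)%:R) m * rowJ (k - m) s).
  rewrite /= [LHS]big_ord_recl [X in _ = X + _]big_ord_recl.
  rewrite -[RHS]addrA; congr (_ + _); first by rewrite /A !rise0.
  rewrite -big_split /=; apply: eq_bigr => i _.
  rewrite /bump /= add1n fall_shift -/(A _) mulrDr mulrDl /z subSS.
  congr (_ + _).
  by rewrite mulrA [A i.+1 * _]mulrC AS /A; ring.
rewrite -addrA; congr (_ + _); rewrite /= mulr_sumr -big_split /=.
apply: eq_bigr => i _; rewrite zE -/(A i) -natr1.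
have -> : k%:R = i%:R + (k - i)%:R :> K by rewrite -natrD subnKC // -ltnS.
ring.
Qed.

Lemma rowJ_cat_zero k s : rowJ k (rcons s 0) = rowJ k s.
Proof.
elim: s k => [|x s IH] k /=; last by apply: eq_bigr => i _; rewrite IH.
case: k => [|k]; first by rewrite big_ord1 !rise0 fact0 divr1 !mulr1.
rewrite big1 // => i _; case: eqP => // /eqP; last by rewrite mulr0.
rewrite subn_eq0 => le_ki; have -> : (i : nat) = k.+1.
  by apply/eqP; rewrite eqn_leq le_ki -ltnS ltn_ord.
by rewrite subnn subr0 [rise (-1) _ _]riseSl mul0r mulr0 mul0r.
Qed.

Lemma poly_nat_zero (p : {poly K}) : (forall n : nat, p.[n%:R] = 0) -> p = 0.
Proof.
move=> H; apply: (@roots_geq_poly_eq0 _ p [seq n%:R | n <- iota 0 (size p)]).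
- by apply/allP => _ /mapP[n _ ->]; apply/rootP.
- by rewrite map_inj_uniq ?iota_uniq //; apply: al_natr_inj.
- by rewrite size_map size_iota.
Qed.

Lemma rowJ_poly k s : exists p : {poly K}, 
  forall t, rowJ k [seq x + t | x <- s] = p.[t].
Proof.
elim: s k => [|x s IH] k; first by exists (k == 0)%:R%:P => t; rewrite hornerC.
have /fin_all_exists [p Hp] : forall m : 'I_k.+1, exists p : {poly K},
    forall t, rise al 1 m / m`!%:R * rise (-1) (x + t - (k - m)%:R) m
       * rowJ (k - m) [seq x + t | x <- s] = p.[t].
  move=> m; have [p Hp] := IH (k - m)%N.
  exists ((rise al 1 m / m`!%:R)%:P * 
    \prod_(i < m) ('X + (x - (k - m)%:R - i%:R)%:P) * p) => t.
  rewrite !hornerM hornerC horner_prod Hp; congr (_ * _ * _).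
  by apply: eq_bigr => i _; rewrite hornerD hornerX hornerC; ring.
by exists (\sum_m p m) => t; rewrite horner_sum /=; apply: eq_bigr => m _.
Qed.

Lemma sum_triangle (n : nat) (F : nat -> nat -> K) :
  \sum_(i < n.+1) \sum_(j < (n - i).+1) F i j
  = \sum_(j < n.+1) \sum_(i < (n - j).+1) F i j.
Proof.
have W (G : nat -> K) (i : 'I_n.+1) : \sum_(j < (n - i).+1) G j
   = \sum_(j < n.+1 | (i + j <= n)%N) G j.
  rewrite (big_ord_widen n.+1 G) ?ltnS ?leq_subr //.
  by apply: eq_bigl => j; rewrite ltnS leq_subRL // -ltnS.
under eq_bigr do rewrite (W (F _)).
under [RHS]eq_bigr => j _ do rewrite (W (fun i => F i j)).
rewrite (exchange_big_dep predT) //=; apply: eq_bigr => j _.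
by apply: eq_bigl => i; rewrite addnC.
Qed.

(** For a partition, the c columns occupied by boxes in the lower rows [s2] cross every row of [s1],
    so each of these rows loses c places. *)
Lemma rowJ_cat k s1 s2 :
  rowJ k (s1 ++ s2)
  = \sum_(c < k.+1) rowJ (k - c) [seq x - c%:R | x <- s1] * rowJ c s2.
Proof.
elim: s1 k => [|x s1 IH] k.
  rewrite /= big_ord_recr /= subnn mul1r big1 ?add0r // => i _.
  by rewrite subn_eq0 leqNgt ltn_ord mul0r.
pose F m c := rise al 1 m / m`!%:R * rise (-1) (x - (k - m)%:R) m
                    * (rowJ (k - m - c) [seq x - c%:R | x <- s1] * rowJ c s2).
transitivity (\sum_(m < k.+1) \sum_(c < (k - m).+1) F m c).
  by rewrite /=; apply: eq_bigr => m _; rewrite IH mulr_sumr.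
rewrite sum_triangle; apply: eq_bigr => c _ /=.
rewrite mulr_suml; apply: eq_bigr => m _; rewrite /F -!mulrA subnAC.
congr (_ * (_ * (rise _ _ _ * _))).
have le_mc : (c + m <= k)%N by have := ltn_ord m; have := ltn_ord c; lia.
by rewrite -addrA -opprD -natrD; congr (x - _%:R); lia.
Qed.

(** By Vandermonde with step [al], the weights [rise al 1] of p equal rows convolve to
    [rise al p]. *)
Lemma rowJ_nseq k p z :
  rowJ k (nseq p z) = rise al p%:R k / k`!%:R * rise (-1) z k.
Proof.
elim: p k => [|p IH] k.
  case: k => [|k] /=; first by rewrite !rise0 fact0 divr1 mulr1.
  by rewrite riseSl !mul0r.
rewrite -add1n natrD -rise_vandermonde mulr_suml /=; apply: eq_bigr => i _.
have -> : rise (-1) z k = rise (-1) z (k - i) * rise (-1) (z - (k - i)%:R) i.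
  by rewrite -{1}(subnK (leq_ord i)) riseD mulrN1.
by rewrite IH; ring.
Qed.

Lemma rowJ1 k y : rowJ k [:: y] = rise al 1 k / k`!%:R * rise (-1) y k.
Proof. exact: (rowJ_nseq k 1 y). Qed.

(** The falling factorial of -1/al is (-1/al)^i times the row weight [rise al 1 i]. Placing a row at
    -1/al thus turns its weight into a second falling factorial, and the sum becomes Vandermonde
    with step -1 for -1/al and x + 1/al. *)
Lemma rowJ_swap_axis k x :
  rowJ k [:: - al^-1; x + al^-1] = rowJ k [:: x; 0].
Proof.
rewrite -[[:: x; 0]]/(rcons [:: x] 0) rowJ_cat_zero rowJ1.
have xE : - al^-1 + (x + al^-1) = x by ring.
transitivity (rise al 1 k * (rise (-1) (- al^-1 + (x + al^-1)) k / k`!%:R));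
  last by rewrite xE; ring.
rewrite -rise_vandermonde mulr_sumr [LHS]/=; apply: eq_bigr => i _.
rewrite -/(rowJ _ [:: _]) rowJ1.
have le_ik : (i <= k)%N by rewrite -ltnS.
pose b := (k - i)%N.
have -> : rise al 1 k = rise al 1 b * rise al (1 + b%:R * al) i.
  by rewrite -riseD subnK.
have -> : rise (-1) (- al^-1 - b%:R) i =
          (- al^-1) ^+ i * rise al (1 + b%:R * al) i.
  rewrite /rise -[X in _ ^+ X]card_ord -prodr_const -big_split /=.
  apply: eq_bigr => t _; field; exact: al_neq0.
have -> : rise (-1) (- al^-1) i = (- al^-1) ^+ i * rise al 1 i.
  rewrite /rise -[X in _ ^+ X]card_ord -prodr_const -big_split /=.
  apply: eq_bigr => t _; field; exact: al_neq0.
by rewrite -/b; ring.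
Qed.

(** When both rows are translated by t, the defect is a polynomial in t. By [rowJ_shift] its
    increments are multiples of the defect of lower degree, which is zero by induction; it therefore
    keeps at all naturals its value at t = 0, given by [rowJ_swap_axis]. *)
Lemma rowJ_swap2 k x y : rowJ k [:: y - al^-1; x + al^-1] = rowJ k [:: x; y].
Proof.
elim: k x y => [|k IH] x y; first by rewrite !rowJ0.
pose G t := rowJ k.+1 [:: t - al^-1; x - y + t + al^-1]
          - rowJ k.+1 [:: x - y + t; t].
have [p Hp] : exists p : {poly K}, forall t, G t = p.[t].
  have [p Hp] := rowJ_poly k.+1 [:: - al^-1; x - y + al^-1].
  have [q Hq] := rowJ_poly k.+1 [:: x - y; 0].
  exists (p - q) => t; rewrite hornerD hornerN -Hp -Hq /G.
  by congr (rowJ _ _ - rowJ _ _); rewrite /=; congr [:: _; _]; ring.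
suff /poly_nat_zero p0 : forall n : nat, p.[n%:R] = 0.
  have := Hp y; rewrite p0 horner0 /G subrK => /eqP.
  by rewrite subr_eq0 => /eqP.
elim=> [|n IHn]; rewrite -Hp /G.
  by rewrite addr0 sub0r rowJ_swap_axis subrr.
rewrite -natr1.
have -> : [:: n%:R + 1 - al^-1; x - y + (n%:R + 1) + al^-1]
   = [seq z + 1 | z <- [:: n%:R - al^-1; x - y + n%:R + al^-1]].
  by rewrite /= ; congr [:: _; _]; ring.
have -> : [:: x - y + (n%:R + 1); n%:R + 1]
   = [seq z + 1 | z <- [:: x - y + n%:R; n%:R]].
  by rewrite /= ; congr [:: _; _]; ring.
by rewrite !rowJ_shift IH opprD addrACA subrr addr0 -[LHS]/(G n%:R) Hp.
Qed.

(** The move exchanges two neighbours among the coordinates al x_i - i; through [rowJ_cat] only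
    these two rows matter. *)
Lemma rowJ_swap k s1 x y s2 :
  rowJ k (s1 ++ y - al^-1 :: x + al^-1 :: s2) = rowJ k (s1 ++ x :: y :: s2).
Proof.
rewrite !rowJ_cat; apply: eq_bigr => c _; congr (_ * _).
rewrite -[_ :: _ :: s2]/([:: _; _] ++ s2) -[x :: y :: s2]/([:: x; y] ++ s2).
rewrite !rowJ_cat; apply: eq_bigr => e _; congr (_ * _).
by rewrite -[RHS]rowJ_swap2; congr rowJ; rewrite /=; congr [:: _; _]; ring.
Qed.

(* The inverse of the change of variables [y_i = al * x_i - i], which turns shifted
   symmetry into symmetry. *)
Fixpoint unshift (i : nat) (y : seq K) : seq K :=
  if y is a :: y' then (a + i%:R) / al :: unshift i.+1 y' else [::].

Lemma unshift_cat i y1 y2 :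
  unshift i (y1 ++ y2) = unshift i y1 ++ unshift (i + size y1) y2.
Proof.
by elim: y1 i => [|a y1 IH] i /=; rewrite ?addn0 // IH addSnnS.
Qed.

Lemma rowJ_unshift_perm k i y1 y2 :
  perm_eq y1 y2 -> rowJ k (unshift i y1) = rowJ k (unshift i y2).
Proof.
move: y1 y2; apply: (@perm_adjacent _ _ (rowJ k \o unshift i)) => s1 a b s2 /=.
rewrite !unshift_cat /= -rowJ_swap; congr (rowJ _ (_ ++ _ :: _ :: _)).
  by rewrite -natr1; field; exact: al_neq0.
by rewrite -natr1; field; exact: al_neq0.
Qed.

Lemma fall_nat_eq0 n m : (n < m)%N -> rise (-1) n%:R m = 0.
Proof.
move=> lt_nm; rewrite -(subnKC lt_nm) riseD riseSr.
by rewrite mulrN1 subrr mulr0 mul0r.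
Qed.

Lemma fall_nat n m : rise (-1) n%:R m = (n ^_ m)%:R.
Proof.
elim: m => [|m IH]; first by rewrite rise0 ffactn0.
rewrite riseSr IH mulrN1 ffactnSr natrM.
case: (leqP m n) => [le_mn|lt_nm]; first by rewrite natrB.
by rewrite ffact_small // !mul0r.
Qed.

(** There are not k distinct columns. In each summand either [s] is too narrow for the k - m
    remaining boxes, or x - (k - m) is a natural number below m and its falling factorial of length
    m is zero. *)
Lemma rowJ_vanish k (la : seq nat) : sorted geq la -> (head 0 la < k)%N ->
  rowJ k [seq n%:R | n <- la] = 0.
Proof.
elim: la k => [|x s IH] k /=; first by case: k.
move=> s_la lt_xk; rewrite big1 // => m _.
have s_s : sorted geq s by apply: path_sorted s_la.
have le_sx : (head 0 s <= x)%N by case: s s_la {s_s IH} => //= y s /andP[].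
case: (ltnP (head 0 s) (k - m)) => [lt|le]; first by rewrite IH ?mulr0.
have le_x := leq_trans le le_sx.
by rewrite -natrB // fall_nat_eq0 ?mulr0 ?mul0r //; lia.
Qed.

Lemma rowJ_filter k (la : seq nat) : sorted geq la ->
  rowJ k [seq n%:R | n <- la & (0 < n)%N] = rowJ k [seq n%:R | n <- la].
Proof.
elim: la k => //= x s IH k s_la.
have s_s : sorted geq s by apply: path_sorted s_la.
case: x s_la => [|x] s_la /=; last by apply: eq_bigr => m _; rewrite IH.
have /all_pred1P s0 : all (pred1 0) (0 :: s).
  move: s_la; rewrite (path_sortedE (rev_trans leq_trans)) => /andP[].
  by rewrite /= => /allP H _; apply/allP => y /H; rewrite /= leqn0.
have -> : [seq n <- s | (0 < n)%N] = [::].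
  by case: s0 => ->; rewrite filter_nseq.
rewrite -[RHS]/(rowJ k [seq n%:R | n <- 0 :: s]) s0 map_nseq rowJ_nseq.
case: k => [|k]; first by rewrite !rise0 fact0 divr1 mulr1.
by rewrite riseSl [rise (-1) _ _]riseSl !mul0r mulr0.
Qed.

(** The right side is the product of al * arm + leg + 1 over the first row. Deleting the first
    column, [rowJ_shift] leaves one term that vanishes because too few columns remain, and one whose
    factor is the hook of the deleted corner box. *)
Lemma rowJ_top r (s : seq nat) : sorted geq (r :: s) ->
  rowJ r [seq n%:R | n <- r :: s]
  = \prod_(c < r) (al * (r - c - 1)%:R + (count (fun x => c < x)%N s)%:R + 1).
Proof.
elim: r s => [|r IH] s s_rs; first by rewrite rowJ0 big_ord0.
pose t := [seq n.-1 | n <- s & (0 < n)%N].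
have sE : [seq n <- s | (0 < n)%N] = [seq n.+1 | n <- t].
  rewrite /t -map_comp -[LHS]map_id; apply/eq_in_map => n.
  by rewrite mem_filter => /andP[n0 _] /=; rewrite prednK.
have s_rt : sorted geq (r :: t).
  have : sorted geq [seq n <- r.+1 :: s | (0 < n)%N].
    by apply: sorted_filter s_rs; apply: rev_trans leq_trans.
  by rewrite /= sE path_map.
have mapE : [seq n%:R : K | n <- r.+1 :: s & (0 < n)%N]
          = [seq x + 1 | x <- [seq n%:R | n <- r :: t]].
  rewrite [LHS]/= sE -[in LHS]map_comp -[in RHS]map_comp /= natr1; congr (_ :: _).
  by apply: eq_map => n /=; rewrite natr1.
rewrite -rowJ_filter // mapE rowJ_shift rowJ_vanish //= add0r.
rewrite -[X in _ * X]/(rowJ r [seq n%:R | n <- r :: t]) IH //.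
rewrite big_ord_recl size_map.
rewrite subn0 subn1; congr (_ * _).
  have -> : count (fun x => (ord0 : 'I_r.+1) < x)%N s = size t.
    by rewrite -size_filter size_map.
  by rewrite /= -natr1; ring.
apply: eq_bigr => c _; rewrite lift0 subSS; congr (_ + _%:R + 1).
rewrite /t count_map count_filter; apply: eq_count => x /=.
by case: x => //= x; rewrite ltnS andbT.
Qed.

End RowFunction.

(** * The Lax operator on coefficient functions *)

Section Lax.

Variables (K : fieldType) (al : K).

(* A function [h b s] is the family of coefficients of [x_0 ^ b * x ^ s] in a series
   symmetric in all variables but [x_0]; on these coefficients [lax] is the
   Dunkl operator [al x_0 d/dx_0 + \sum_(i > 0) x_i / (x_0 - x_i) (1 - s_0i)],
   i.e. the Nazarov-Sklyanin Lax operator; [hop2] is one summand of [hop]. *)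
Definition hop2 (g : nat -> nat -> K) (b c : nat) : K :=
  \sum_(i < c) (g (b + c - i)%N i - g i (b + c - i)%N).

Fixpoint hop (h : nat -> seq nat -> K) (b : nat) (s : seq nat) : K :=
  if s is c :: s' then
    hop2 (fun x y => h x (y :: s')) b c + hop (fun x t => h x (c :: t)) b s'
  else 0.

Definition lax (h : nat -> seq nat -> K) (b : nat) (s : seq nat) : K :=
  al * b%:R * h b s + hop h b s.

(** Multiplication by the power sum of degree i in the variables other than x_0; [xmul] multiplies
    by x_0^i, and [pmul] by the power sum of all variables. *)
Fixpoint psmul (i : nat) (g : seq nat -> K) (s : seq nat) : K :=
  if s is c :: s' then
    (if (i <= c)%N then g (c - i :: s')%N else 0)
    + psmul i (fun t => g (c :: t)) s'
  else 0.

Definition xmul (i : nat) (h : nat -> seq nat -> K) b s : K :=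
  if (i <= b)%N then h (b - i)%N s else 0.

Definition pmul (i : nat) (h : nat -> seq nat -> K) b s : K :=
  xmul i h b s + psmul i (h b) s.

Lemma eq_hop2 g1 g2 b c : g1 =2 g2 -> hop2 g1 b c = hop2 g2 b c.
Proof. by move=> E; apply: eq_bigr => i _; rewrite !E. Qed.

Lemma eq_hop h1 h2 : h1 =2 h2 -> hop h1 =2 hop h2.
Proof.
move=> E b s; elim: s h1 h2 E => //= c s IH h1 h2 E.
congr (_ + _); last exact: IH.
by apply: eq_hop2 => x y; rewrite E.
Qed.

Lemma eq_lax h1 h2 : h1 =2 h2 -> lax h1 =2 lax h2.
Proof. by move=> E b s; rewrite /lax E (eq_hop _ _ E). Qed.

Lemma eq_psmul i g1 g2 : g1 =1 g2 -> psmul i g1 =1 psmul i g2.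
Proof.
move=> E s; elim: s g1 g2 E => //= c s IH g1 g2 E.
by rewrite E; congr (_ + _); apply: IH.
Qed.

Lemma hop2_linear a g1 g2 b c :
  hop2 (fun x y => a * g1 x y + g2 x y) b c = a * hop2 g1 b c + hop2 g2 b c.
Proof.
by rewrite /hop2 mulr_sumr -big_split; apply: eq_bigr => i _ /=; ring.
Qed.

Lemma hop_linear a h1 h2 b s :
  hop (fun x y => a * h1 x y + h2 x y) b s = a * hop h1 b s + hop h2 b s.
Proof.
elim: s h1 h2 => [|c s IH] h1 h2 /=; first by rewrite mulr0 addr0.
by rewrite hop2_linear IH; ring.
Qed.

Lemma lax_linear a h1 h2 b s :
  lax (fun x y => a * h1 x y + h2 x y) b s = a * lax h1 b s + lax h2 b s.
Proof. by rewrite /lax hop_linear; ring. Qed.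

Lemma psmul_linear i a g1 g2 s :
  psmul i (fun x => a * g1 x + g2 x) s = a * psmul i g1 s + psmul i g2 s.
Proof.
elim: s g1 g2 => [|c s IH] g1 g2 /=; first by rewrite mulr0 addr0.
by rewrite IH; case: ifP => _; ring.
Qed.

Lemma hop_zero b s : hop (fun _ _ => 0) b s = 0.
Proof.
elim: s => //= c s ->.
by rewrite addr0 /hop2 big1 // => i _; rewrite subrr.
Qed.

Lemma lax_zero b s : lax (fun _ _ => 0) b s = 0.
Proof. by rewrite /lax hop_zero mulr0 addr0. Qed.

Lemma psmul_zero i s : psmul i (fun _ => 0) s = 0.
Proof.
by elim: s => //= c s ->; rewrite if_same addr0.
Qed.

Lemma lax_sum (I : Type) (r : seq I) (a : I -> K) (h : I -> nat -> seq nat -> K) b s :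
  lax (fun x t => \sum_(i <- r) a i * h i x t) b s
  = \sum_(i <- r) a i * lax (h i) b s.
Proof.
elim: r => [|i r IH].
  by rewrite big_nil -[RHS](lax_zero b s); apply: eq_lax => x t; rewrite big_nil.
rewrite big_cons -IH -lax_linear; apply: eq_lax => x t.
by rewrite big_cons.
Qed.

Lemma psmul_sum (I : Type) (r : seq I) j (g : I -> seq nat -> K) s :
  psmul j (fun t => \sum_(i <- r) g i t) s = \sum_(i <- r) psmul j (g i) s.
Proof.
elim: r => [|i r IH].
  rewrite big_nil -[RHS](psmul_zero j s); apply: eq_psmul => t.
  by rewrite big_nil.
rewrite big_cons -IH -[psmul j (g i) s]mul1r -psmul_linear.
by apply: eq_psmul => t; rewrite big_cons mul1r.
Qed.

Lemma psmul_hop2 j (g : nat -> nat -> seq nat -> K) b c s :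
  psmul j (fun t => hop2 (fun x y => g x y t) b c) s
  = hop2 (fun x y => psmul j (g x y) s) b c.
Proof.
rewrite /hop2 psmul_sum; apply: eq_bigr => i _.
rewrite addrC -mulN1r -psmul_linear.
by apply: eq_psmul => t; rewrite addrC mulN1r.
Qed.

Lemma hop2_0r g b : hop2 g b 0 = 0.
Proof. by rewrite /hop2 big_ord0. Qed.

(** Coefficient of x_0^(b+1) x_1^(c+1) in (x_0 - x_1) D g = x_1 (g - s g), where D is the operator
    [hop2] and s exchanges x_0 and x_1. *)
Lemma hop2_Sr g b c :
  hop2 g b c.+1 = hop2 g b.+1 c + (g b.+1 c - g c b.+1).
Proof.
rewrite /hop2 big_ord_recr /= addnS -addSn addnK; congr (_ + _).
Qed.

(** The two sums are reversals of each other except for their end terms. *)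
Lemma hop2_0l g c : hop2 g 0 c = g c 0%N - g 0%N c.
Proof.
rewrite /hop2 add0n sumrB.
have E : \sum_(i < c) g (c - i)%N i + g 0%N c
       = \sum_(i < c) g i (c - i)%N + g c 0%N.
  transitivity (\sum_(i < c.+1) g (c - i)%N i).
    by rewrite big_ord_recr /= subnn.
  rewrite (reindex_inj rev_ord_inj) big_ord_recr /= subSS subnn subn0.
  congr (_ + _); apply: eq_bigr => i _.
  by rewrite subSS subKn // ltnW.
by apply/eqP; rewrite subr_eq addrAC -subr_eq opprK [X in _ == X]addrC E.
Qed.

(** Multiplication by the symmetric function x_0^i + x_1^i commutes with the divided difference. On
    coefficients the boundary cases are i = b + 1, closed by [hop2_0l], and i = c + 1. *)
Lemma hop2_mul i g b c : (0 < i)%N ->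
  let M (f : nat -> nat -> K) x y :=
    (if (i <= x)%N then f (x - i)%N y else 0)
    + (if (i <= y)%N then f x (y - i)%N else 0) in
  hop2 (M g) b c = M (hop2 g) b c.
Proof.
move=> i0 M; elim: c b => [|c IH] b.
  by rewrite hop2_0r /M !hop2_0r !if_same addr0.
rewrite hop2_Sr IH /M.
have Eb : (if (i <= b)%N then hop2 g (b - i) c.+1 else 0)
  = (if (i <= b.+1)%N then hop2 g (b.+1 - i) c + (g (b.+1 - i)%N c - g c (b.+1 - i)%N) else 0).
  case: (leqP i b) => [le|lt].
    by rewrite (leq_trans le) // hop2_Sr subSn.
  case: leqP => // le; have -> : i = b.+1 by apply/eqP; rewrite eqn_leq le.
  by rewrite subnn hop2_0l; ring.
have Ec : (if (i <= c.+1)%N then hop2 g b (c.+1 - i) else 0)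
  = (if (i <= c)%N then hop2 g b.+1 (c - i) + (g b.+1 (c - i)%N - g (c - i)%N b.+1) else 0).
  case: (leqP i c) => [le|lt].
    by rewrite (leq_trans le) // subSn // hop2_Sr.
  case: leqP => // le; have -> : i = c.+1 by apply/eqP; rewrite eqn_leq le.
  by rewrite subnn hop2_0r.
rewrite Eb Ec; case: (i <= b.+1)%N; case: (i <= c)%N; ring.
Qed.

Lemma hop_pmul i h b s : (0 < i)%N -> hop (pmul i h) b s = pmul i (hop h) b s.
Proof.
move=> i0; elim: s h => [|c s IH] h.
  by rewrite /pmul /xmul /= if_same addr0.
rewrite [hop _ _ _]/=.
rewrite (eq_hop2 _ (fun x y => 1 * ((if (i <= x)%N then h (x - i)%N (y :: s) else 0)
    + (if (i <= y)%N then h x (y - i :: s)%N else 0))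
    + psmul i (fun t => h x (y :: t)) s)); last first.
  by move=> x y; rewrite mul1r /pmul /xmul /= addrA.
rewrite hop2_linear mul1r (hop2_mul i (fun x y => h x (y :: s))) //.
rewrite -psmul_hop2.
rewrite (eq_hop _ (fun x t => (i <= c)%N%:R * h x (c - i :: t)%N
   + pmul i (fun x t => h x (c :: t)) x t)); last first.
  move=> x t; rewrite /pmul /xmul /=.
  by case: (i <= c)%N; rewrite ?mul1r ?mul0r; ring.
rewrite hop_linear IH /pmul /xmul /=.
have -> : psmul i (fun t => hop2 (fun x y => h x (y :: t)) b c
             + hop (fun x t => h x (c :: t)) b t) s
  = psmul i (fun t => hop2 (fun x y => h x (y :: t)) b c) s
    + psmul i (hop (fun x t => h x (c :: t)) b) s.
  rewrite -[X in _ = X + _]mul1r -psmul_linear.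
  by apply: eq_psmul => t; rewrite mul1r.
case: (i <= c)%N; case: (i <= b)%N; rewrite /= ?mul1r ?mul0r; ring.
Qed.

(** Of the two parts of [lax], only the derivation al x_0 d/dx_0 fails to commute with a power sum,
    and it adds al i x_0^i. *)
Lemma lax_pmul i h b s : (0 < i)%N ->
  lax (pmul i h) b s = pmul i (lax h) b s + al * i%:R * xmul i h b s.
Proof.
move=> i0; rewrite /lax hop_pmul // /pmul psmul_linear /xmul.
by case: leqP => [le|_]; rewrite ?natrB //; ring.
Qed.

End Lax.

(** * Action of the Lax operator on p_rho x_0^a *)

Section PowerSums.

Variables (K : fieldType) (al : K).
Local Notation lax := (lax K al).
Local Notation hop := (hop K).
Local Notation pmul := (pmul K).
Local Notation xmul := (xmul K).
Local Notation psmul := (psmul K).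

Definition delta (a b : nat) (s : seq nat) : K :=
  ((b == a) && all (pred1 0%N) s)%:R.

Lemma hop_delta a b s :
  hop (delta a) b s = \sum_(i <- iota 1 a) psmul i (delta (a - i) b) s.
Proof.
elim: s => [|c s IH] /=; first by rewrite big1_seq.
case: c => [|c].
  rewrite hop2_0r add0r IH; apply: eq_big_seq => i; rewrite mem_iota.
  by case: i => //= i _; rewrite add0r; apply: eq_psmul.
rewrite (eq_hop _ _ (fun _ _ => 0)); last by move=> x t; rewrite /delta andbF.
rewrite hop_zero addr0.
under [RHS]eq_bigr => i _.
  rewrite (eq_psmul _ _ _ (fun _ => 0)); last by move=> t; rewrite /delta andbF.
  rewrite psmul_zero addr0; over.
rewrite /hop2 sumrB [X in _ - X]big1 ?subr0 => [|i _]; last first.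
  rewrite /delta /=; have := ltn_ord i => lt_ic.
  have -> : (b + c.+1 - i == 0)%N = false by lia. by rewrite /= andbF.
rewrite big_ord_recl /= big1 ?addr0 => [|i _]; last by rewrite /delta /= andbF.
rewrite /delta /= subn0.
under eq_bigr => i _.
  have -> : (if (i <= c.+1)%N then ((b == a - i)%N && ((c.+1 - i == 0)%N && all (pred1 0%N) s))%:R
    else 0) = (i == c.+1)%:R * ((b == a - c.+1)%N && all (pred1 0%N) s)%:R :> K.
    case: (eqVneq i c.+1) => [->|ne]; first by rewrite leqnn subnn eqxx /= mul1r.
    rewrite mul0r; case: ifP => // le; rewrite subn_eq0 leqNgt ltn_neqAle ne le.
    by rewrite andbF.
  over.
rewrite -mulr_suml.
have -> : \sum_(i <- iota 1 a) (i == c.+1)%:R = (c.+1 <= a)%N%:R :> K.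
  rewrite -natr_sum; congr _%:R.
  under eq_bigr do rewrite -[nat_of_bool _]/(if (_ == c.+1) then 1 else 0)%N.
  rewrite -big_mkcond sum1_count count_uniq_mem ?iota_uniq // mem_iota.
  by rewrite add1n ltnS.
rewrite -natrM mulnb; congr _%:R; congr nat_of_bool.
by rewrite andbA; congr (_ && _); lia.
Qed.

(** x_j (x_0^a - x_j^a) / (x_0 - x_j) is the sum of x_j^i x_0^(a-i) over 1 <= i <= a. Completing the
    sums over j to power sums that include x_0 adds a x_0^a, whence al - 1 instead of al. *)
Lemma lax_delta a b s :
  lax (delta a) b s = (al - 1) * a%:R * delta a b s
                      + \sum_(i <- iota 1 a) pmul i (delta (a - i)) b s.
Proof.
rewrite big_split /= -hop_delta /lax addrA; congr (_ + _).
have -> : \sum_(i <- iota 1 a) xmul i (delta (a - i)) b s = a%:R * delta a b s.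
  transitivity (\sum_(i <- iota 1 a) delta a b s); last first.
    by rewrite big_const_seq count_predT size_iota iter_addr_0 mulr_natl.
  apply: eq_big_seq => i; rewrite mem_iota /xmul /delta => i_a.
  case: leqP => le_ib; first by congr (nat_of_bool (_ && _))%:R; lia.
  by have -> : (b == a) = false by lia.
rewrite /delta; case: eqP => [->|_] /=; last by rewrite !mulr0 addr0.
ring.
Qed.

(* [psi rho a] and [ps rho] are the coefficients of [p_rho * x_0 ^ a] and [p_rho]. *)
Definition psi (rho : seq nat) (a : nat) : nat -> seq nat -> K :=
  foldr pmul (delta a) rho.

Definition ps (rho : seq nat) : seq nat -> K :=
  foldr psmul (fun s => (all (pred1 0%N) s)%:R) rho.

Lemma eq_pmul i h1 h2 : h1 =2 h2 -> pmul i h1 =2 pmul i h2.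
Proof.
move=> E b s; rewrite /pmul /xmul E; congr (_ + _).
by apply: eq_psmul => t; rewrite E.
Qed.

Lemma psiE rho a b s :
  psi rho a b s = if (a <= b)%N then ps rho ((b - a)%N :: s) else 0.
Proof.
elim: rho b s => [|i rho IH] b s /=.
  rewrite /delta; case: leqP => [le|lt]; last by have -> : (b == a) = false by lia.
  by congr (nat_of_bool (_ && _))%:R; lia.
rewrite (eq_pmul _ _ _ IH) /pmul /xmul.
case: (leqP a b) => [le|lt].
  congr (_ + _); rewrite subnAC; case: (leqP i b) => [le1|lt1].
    by have -> : (a <= b - i)%N = (i <= b - a)%N by lia.
  by have -> : (i <= b - a)%N = false by lia.
rewrite psmul_zero addr0.
have -> : (a <= b - i)%N = false by lia.
  by rewrite if_same.
Qed.

Lemma psi0 rho b s : psi rho 0 b s = ps rho (b :: s).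
Proof. by rewrite psiE subn0. Qed.

(** Reading the exponent 0 of x_0 sets x_0 to zero: this is the projection that ends a
    Nazarov-Sklyanin operator. *)
Lemma psi_pi0 rho a s : {in rho, forall i, 0 < i}%N ->
  psi rho a 0 s = if (a == 0)%N then ps rho s else 0.
Proof.
move=> pos; rewrite psiE leqn0; case: eqP => // ->; rewrite subn0.
elim: rho pos s => //= i rho IH pos s.
rewrite leqNgt pos ?mem_head //= add0r; apply: eq_psmul => t.
by apply: IH => j j_rho; apply: pos; rewrite inE j_rho orbT.
Qed.

Lemma xmul_psi i rho a b s : xmul i (psi rho a) b s = psi rho (a + i) b s.
Proof.
rewrite /xmul !psiE; case: leqP => [le|lt].
  by rewrite -subnDA addnC; congr (if _ then _ else _); lia.
by have -> : (a + i <= b)%N = false by lia.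
Qed.

Lemma psmulC i j g s : psmul i (psmul j g) s = psmul j (psmul i g) s.
Proof.
elim: s g => //= c s IH g.
have E (k l : nat) : psmul k (fun t => (if (l <= c)%N then g (c - l :: t)%N else 0)
     + psmul l (fun t => g (c :: t)) t) s
   = (if (l <= c)%N then psmul k (fun t => g (c - l :: t)%N) s else 0)
     + psmul k (psmul l (fun t => g (c :: t))) s.
  rewrite (eq_psmul _ _ _ (fun t => (l <= c)%N%:R * g (c - l :: t)%N + psmul l (fun t => g (c :: t)) t)).
    by rewrite psmul_linear; case: ifP; rewrite ?mul1r ?mul0r.
  by move=> t; case: ifP; rewrite ?mul1r ?mul0r.
rewrite !E IH.
have F k l : (if (k <= c)%N then (if (l <= c - k)%N then g (c - k - l :: s)%N else 0)
        + psmul l (fun t => g (c - k :: t)%N) s else 0)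
  = (if (k + l <= c)%N then g (c - (k + l) :: s)%N else 0)
    + (if (k <= c)%N then psmul l (fun t => g (c - k :: t)%N) s else 0).
  case: (leqP k c) => le; last first.
    have -> : (k + l <= c)%N = false by lia.
  by rewrite addr0.
  by rewrite subnDA leq_subRL.
by rewrite !F addnC; ring.
Qed.

Lemma ps_perm rho1 rho2 s : perm_eq rho1 rho2 -> ps rho1 s = ps rho2 s.
Proof.
move: rho1 rho2; apply: (@perm_adjacent _ _ (fun rho => ps rho s)) => r1 i j r2.
elim: r1 s => /= [|k r1 IH] s; first by rewrite psmulC.
exact: eq_psmul.
Qed.

Lemma psi_perm rho1 rho2 a b s : perm_eq rho1 rho2 -> psi rho1 a b s = psi rho2 a b s.
Proof. by move=> p12; rewrite !psiE (ps_perm _ _ _ p12). Qed.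

Fixpoint picks (rho : seq nat) : seq (nat * seq nat) :=
  if rho is j :: rho' then
    (j, rho') :: [seq (x.1, j :: x.2) | x <- picks rho']
  else [::].

Lemma pmul_linear i a h1 h2 b s :
  pmul i (fun x t => a * h1 x t + h2 x t) b s = a * pmul i h1 b s + pmul i h2 b s.
Proof.
by rewrite /pmul psmul_linear /xmul; case: ifP => _; ring.
Qed.

Lemma pmul_sum (I : Type) (r : seq I) i (a : I -> K) h b s :
  pmul i (fun x t => \sum_(j <- r) a j * h j x t) b s
  = \sum_(j <- r) a j * pmul i (h j) b s.
Proof.
elim: r => [|j r IH]; last first.
  by rewrite big_cons -IH -pmul_linear; apply: eq_pmul => x t; rewrite big_cons.
rewrite big_nil (eq_pmul _ _ (fun _ _ => 0)) => [|x t]; last by rewrite big_nil.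
by rewrite /pmul psmul_zero /xmul if_same addr0.
Qed.

(** [pmul] is [psmul] with x_0 treated as one more variable of the list. *)
Lemma pmulC i j h b s : pmul i (pmul j h) b s = pmul j (pmul i h) b s.
Proof. exact: (psmulC i j (fun t => h (head 0 t)%N (behead t)) (b :: s)). Qed.

(** The Nazarov-Sklyanin matrix: besides its diagonal, al j x_0^j d/dp_j removes a part j, and
    x_0^(-i) p_i adds a part i as long as i <= a. *)
Lemma lax_psi rho a b s : {in rho, forall i, 0 < i}%N ->
  lax (psi rho a) b s
  = (al - 1) * a%:R * psi rho a b s
    + \sum_(x <- picks rho) al * x.1%:R * psi x.2 (a + x.1) b s
    + \sum_(i <- iota 1 a) psi (i :: rho) (a - i) b s.
Proof.
elim: rho b s => [|j rho IH] b s pos; first by rewrite lax_delta big_nil addr0.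
have j0 : (0 < j)%N by rewrite pos ?mem_head.
have {}IH b' s' := IH b' s' (fun i i_rho => pos i (mem_behead (i_rho : i \in behead (j :: rho)))).
rewrite [LHS]lax_pmul // xmul_psi (eq_pmul _ _ _ IH) /= big_cons big_map /=.
rewrite (eq_pmul _ _ (fun x t => (al - 1) * a%:R * psi rho a x t
   + (1 * (\sum_(y <- picks rho) al * y.1%:R * psi y.2 (a + y.1) x t)
      + \sum_(i <- iota 1 a) 1 * pmul i (psi rho (a - i)) x t))); last first.
  move=> x t; rewrite mul1r addrA; congr (_ + _).
  by apply: eq_bigr => i _; rewrite mul1r.
rewrite !pmul_linear !pmul_sum mul1r.
have -> : \sum_(i <- iota 1 a) 1 * pmul j (pmul i (psi rho (a - i))) b s
   = \sum_(i <- iota 1 a) pmul i (pmul j (psi rho (a - i))) b s.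
  by apply: eq_bigr => i _; rewrite mul1r pmulC.
ring.
Qed.

End PowerSums.

(** * Counting maps versus multiplying power sums *)

Section PmCoef.

Variable K : fieldType.

Lemma psmulE i (g : seq nat -> K) s :
  psmul K i g s = \sum_(j < size s) (if (i <= nth 0 s j)%N
      then g (set_nth 0 s j (nth 0 s j - i))%N else 0).
Proof.
elim: s g => [|c s IH] g; first by rewrite big_ord0.
by rewrite big_ord_recl /= IH.
Qed.

Definition fiber_sums (n : nat) (rho : seq nat) (t : 'I_n -> nat)
    (f : {ffun 'I_(size rho) -> 'I_n}) : bool :=
  [forall i, (\sum_(j | f j == i) nth 0 rho j)%N == t i].

(** Conditioning on the row that receives the first part reproduces the recursion of [psmul]. *)
Lemma fiber_sums_cons n r rho (t : 'I_n -> nat) :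
  #|[set f | fiber_sums n (r :: rho) t f]|
  = (\sum_(j < n) if r <= t j then
       #|[set f | fiber_sums n rho (fun i => t i - (i == j) * r) f]| else 0)%N.
Proof.
pose cons_ff (p : 'I_n * {ffun 'I_(size rho) -> 'I_n}) :
    {ffun 'I_(size rho).+1 -> 'I_n} :=
  [ffun i => if unlift ord0 i is Some k then p.2 k else p.1].
have cons_bij : bijective cons_ff.
  exists (fun f : {ffun 'I_(size rho).+1 -> 'I_n} => (f ord0, [ffun k => f (lift ord0 k)])).
    move=> [j g]; congr (_, _); first by rewrite ffunE unlift_none.
    by apply/ffunP => k; rewrite !ffunE liftK.
  move=> f; apply/ffunP => i; rewrite ffunE.
  by case: unliftP => [k ->|->] //=; rewrite ffunE.
rewrite -sum1dep_card big_mkcond /= (reindex cons_ff) /=; last exact: onW_bij.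
rewrite -(pair_bigA _ (fun j g => if fiber_sums n (r :: rho) t (cons_ff (j, g)) then 1 else 0)%N) /=.
apply: eq_bigr => j _.
have condE g : fiber_sums n (r :: rho) t (cons_ff (j, g))
   = (r <= t j)%N && fiber_sums n rho (fun i => t i - (i == j) * r)%N g.
  have E i : (\sum_(k | cons_ff (j, g) k == i) nth 0 (r :: rho) k
      = (i == j) * r + \sum_(k | g k == i) nth 0 rho k)%N.
    rewrite big_mkcond big_ord_recl /= ffunE unlift_none /= [j == i]eq_sym.
    congr (_ + _)%N; first by case: (i == j); rewrite ?mul1n.
    rewrite [RHS]big_mkcond; apply: eq_bigr => k _.
    by rewrite ffunE liftK.
  apply/forallP/andP => [H|[le_r /forallP H] i].
    have le_r : (r <= t j)%N.
      by have /eqP <- := H j; rewrite E eqxx mul1n leq_addr.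
    split=> //; apply/forallP => i; have /eqP <- := H i.
    by rewrite E addKn.
  rewrite E (eqP (H i)) subnKC //.
  by case: eqP => [->|_]; rewrite ?mul1n.
under eq_bigr do rewrite condE.
case: (r <= t j)%N => /=; last by rewrite big1.
by rewrite -big_mkcond sum1dep_card.
Qed.

Lemma pm_coefE rho tau : (pm_coef rho tau)%:R = ps K rho tau.
Proof.
suff H n t : size t = n ->
    (#|[set f | fiber_sums n rho (fun i : 'I_n => nth 0%N t i) f]|)%:R = ps K rho t.
  exact: H.
elim: rho n t => [|r rho IH] n t sz_t.
  have E f : fiber_sums n [::] (fun i : 'I_n => nth 0%N t i) f = all (pred1 0%N) t.
    apply/forallP/(all_nthP 0%N) => [H i lt_i|H i].
      rewrite sz_t in lt_i; have := H (Ordinal lt_i).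
      by rewrite big_ord0 eq_sym.
    by rewrite big_ord0 eq_sym; apply: H; rewrite sz_t.
  rewrite /= (eq_card (_ : _ =i [set f : {ffun 'I_0 -> 'I_n} | all (pred1 0%N) t])).
    case: (all _ t) => /=; last by rewrite eq_card0 // => f; rewrite inE.
    rewrite (eq_card (_ : _ =i predT)) ?card_ffun ?card_ord //.
    by move=> f; rewrite !inE.
  by move=> f; rewrite !inE; apply: E.
rewrite fiber_sums_cons natr_sum [RHS]psmulE sz_t; apply: eq_bigr => j _.
case: leqP => // le_r.
rewrite -[RHS]/(ps K rho (set_nth 0 t j (nth 0 t j - r))%N) -(IH n); last first.
  by rewrite size_set_nth sz_t; apply/maxn_idPr; rewrite ltn_ord.
congr _%:R; apply: eq_card => f; rewrite !inE; apply: eq_forallb => i.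
rewrite nth_set_nth /=; case: (eqVneq i j) => [->|ne]; first by rewrite eqxx mul1n.
by rewrite -val_eqE in ne; rewrite (negPf ne) subn0.
Qed.

End PmCoef.

(** * Removing and inserting a part of a partition *)

Lemma picks_perm rho x : x \in picks rho -> perm_eq (x.1 :: x.2) rho.
Proof.
elim: rho x => //= j rho IH x; rewrite inE => /orP[/eqP -> //|/mapP[y /IH y_rho ->]] /=.
by rewrite -(cat1s y.1) -(cat1s j) perm_catCA perm_cons.
Qed.

Lemma picks_sorted rho x : sorted geq rho -> x \in picks rho -> sorted geq x.2.
Proof.
have geq_tr : transitive geq by apply: rev_trans leq_trans.
elim: rho x => //= j rho IH x s_rho; rewrite inE => /orP[/eqP -> /=|/mapP[y y_rho ->]] /=.
  exact: path_sorted s_rho.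
move: s_rho; rewrite !(path_sortedE geq_tr) => /andP[/allP H s_rho].
rewrite (IH y) // andbT; apply/allP => z z_y; apply: H.
by rewrite -(perm_mem (picks_perm _ _ y_rho)) inE z_y orbT.
Qed.

Lemma count_picks rho j : count (fun x => x.1 == j) (picks rho) = count_mem j rho.
Proof. by elim: rho => //= i rho <-; rewrite count_map. Qed.

Lemma sort_insE i rho : sorted geq (sort geq (i :: rho)).
Proof. by apply: sort_sorted => x y; apply: leq_total. Qed.

Lemma sorted_geq_eq s t : sorted geq s -> sorted geq t -> perm_eq s t -> s = t.
Proof.
apply: sorted_eq; first exact: rev_trans leq_trans.
by move=> x y /andP[le1 le2]; apply/eqP; rewrite eqn_leq; apply/andP.
Qed.

Lemma zee_bound rho m : (sumn rho < m)%N ->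
  zee rho = (\prod_(1 <= i < m) (i ^ count_mem i rho * (count_mem i rho)`!))%N.
Proof.
move=> lt_m; rewrite (big_cat_nat (n := (sumn rho).+1)) //= [X in (_ * X)%N]big_nat.
rewrite [X in (_ * X)%N]big1 ?muln1 // => i /andP[lt_i _].
suff /count_memPn -> : i \notin rho by rewrite expn0.
apply/negP => i_rho; move: lt_i; rewrite ltnNge; case/negP.
elim: rho {lt_m} i_rho => //= j rho IH; rewrite inE => /orP[/eqP <-|/IH le].
  exact: leq_addr.
exact: leq_trans le (leq_addl _ _).
Qed.

Lemma zee_perm rho1 rho2 : perm_eq rho1 rho2 -> zee rho1 = zee rho2.
Proof.
move=> p12; rewrite /zee !sumnE (perm_big _ p12) /=.
by apply: eq_bigr => i _; rewrite (seq.permP p12).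
Qed.

Lemma zee_cons j rho : (0 < j)%N ->
  zee (j :: rho) = (j * (count_mem j rho).+1 * zee rho)%N.
Proof.
move=> j0; pose m := (sumn (j :: rho)).+1.
have lt_jm : (j < m)%N by rewrite /m /= ltnS leq_addr.
rewrite (zee_bound (j :: rho) m) // (zee_bound rho m) ?ltnS ?leq_addl //.
have j_m : j \in index_iota 1 m by rewrite mem_index_iota j0.
rewrite !(bigD1_seq j) ?iota_uniq //= mulnA eqxx add1n; congr (_ * _)%N.
  by rewrite expnS factS; lia.
by apply: eq_bigr => i ne; rewrite eq_sym (negPf ne).
Qed.

Lemma is_part_picks rho x : is_part rho -> x \in picks rho -> (0 < x.1)%N /\ is_part x.2.
Proof.
move=> /andP[s_rho /allP pos] x_rho; have p := picks_perm _ _ x_rho.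
split; first by apply: pos; rewrite -(perm_mem p) mem_head.
rewrite /is_part (picks_sorted _ _ s_rho) //; apply/allP => z z_x.
by apply: pos; rewrite -(perm_mem p) inE z_x orbT.
Qed.

Lemma is_part_ins i rho : (0 < i)%N -> is_part rho -> is_part (sort geq (i :: rho)).
Proof.
move=> i0 /andP[_ pos]; rewrite /is_part sort_insE.
by rewrite (perm_all _ (permEl (perm_sort _ _))) /= i0.
Qed.

(** * Self-adjointness of the Lax operator *)

Section LaxLists.

Variables (K : fieldType) (al : K).

(* [(rho, a)] stands for [p_rho x_0 ^ a] *)
Definition wterm := (seq nat * nat)%type.

(** The Jack scalar product extended by making the powers of x_0 orthonormal; inclusion at x_0^0 and
    projection to x_0^0 are then adjoint to each other. *)
Definition wpair (e f : wterm) : K :=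
  if e == f then (zee e.1)%:R * al ^+ size e.1 else 0.

(* The action of [lax] on [p_rho * x_0 ^ a], see [lax_psi]. *)
Definition laxb (e : wterm) : seq (K * wterm) :=
  ((al - 1) * e.2%:R, e)
  :: [seq (al * x.1%:R, (x.2, e.2 + x.1)%N) | x <- picks e.1]
  ++ [seq (1, (sort geq (i :: e.1), e.2 - i)%N) | i <- iota 1 e.2].

Lemma wpair_sym e f : wpair e f = wpair f e.
Proof. by rewrite /wpair eq_sym; case: eqP => // ->. Qed.

(** Removing j with a factor x_0^j is adjoint to adding j with a factor x_0^(-j). Only j = b - a
    counts, and if rho is sig with a part j added, occurring m_j times in rho, then al j m_j z_sig
    al^(size sig) = z_rho al^(size rho). *)
Lemma pick_pair rho a sig b : is_part rho -> is_part sig ->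
  \sum_(x <- picks rho) al * x.1%:R * wpair (x.2, a + x.1)%N (sig, b)
  = \sum_(i <- iota 1 b) wpair (rho, a) (sort geq (i :: sig), b - i)%N.
Proof.
move=> p_rho p_sig; rewrite /wpair.
have [s_rho _] := andP p_rho; have [s_sig _] := andP p_sig.
case: (ltnP a b) => [lt_ab|le_ba]; last first.
  rewrite !big1_seq // => [i|x] /=.
    rewrite mem_iota xpair_eqE => /andP[i0 ib].
    have -> : (a == b - i)%N = false by lia.
    by rewrite andbF.
  move=> x_rho; have [x0 _] := is_part_picks _ _ p_rho x_rho.
  rewrite xpair_eqE; have -> : (a + x.1 == b)%N = false by lia.
  by rewrite andbF mulr0.
pose j := (b - a)%N.
have -> : \sum_(i <- iota 1 b) (if (rho, a) == (sort geq (i :: sig), b - i)%N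
       then (zee rho)%:R * al ^+ size rho else 0)
   = if rho == sort geq (j :: sig) then (zee rho)%:R * al ^+ size rho else 0.
  rewrite (bigD1_seq j) ?iota_uniq ?mem_iota //=; last by rewrite /j; lia.
  rewrite xpair_eqE (_ : (a == b - j)%N) ?andbT; last by rewrite /j; lia.
  rewrite big1_seq ?addr0 // => i /andP[ne]; rewrite mem_iota => /andP[i0 ib].
  rewrite xpair_eqE (_ : (a == b - i)%N = false) ?andbF //.
  by apply/eqP; rewrite /j in ne *; move/eqP: ne; lia.
case: eqP => [rhoE|ne]; last first.
  rewrite big1_seq // => x /= x_rho; rewrite xpair_eqE.
  case: eqP => [x2E|_] /=; last by rewrite mulr0.
  case: eqP => [x1E|_] /=; last by rewrite mulr0.
  case: ne; apply: sorted_geq_eq (sort_insE _ _) _ => //.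
  rewrite perm_sym perm_sort -x2E (_ : j = x.1) ?picks_perm //.
  by rewrite /j -x1E addKn.
have -> : \sum_(x <- picks rho) al * x.1%:R * (if (x.2, a + x.1)%N == (sig, b)
      then (zee x.2)%:R * al ^+ size x.2 else 0)
  = \sum_(x <- picks rho | x.1 == j) al * j%:R * ((zee sig)%:R * al ^+ size sig).
  rewrite [RHS]big_mkcond; apply: eq_big_seq => x x_rho; rewrite xpair_eqE.
  have -> : (a + x.1 == b)%N = (x.1 == j) by rewrite /j; lia.
  case: (x.1 =P j) => [x1E|_]; last by rewrite andbF mulr0.
  suff -> : x.2 = sig by rewrite eqxx x1E.
  apply: sorted_geq_eq s_sig _; first exact: picks_sorted s_rho x_rho.
  have := picks_perm _ _ x_rho; rewrite x1E rhoE => /perm_trans p.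
  by rewrite -(perm_cons j); apply: p; rewrite perm_sort.
rewrite -big_filter big_const_seq count_predT size_filter count_picks iter_addr_0.
have prho : perm_eq rho (j :: sig) by rewrite rhoE perm_sort.
have j0 : (0 < j)%N by rewrite /j; lia.
rewrite (zee_perm _ _ prho) zee_cons // (seq.permP prho) (perm_size prho) /= eqxx.
by rewrite add1n exprS !natrM -mulr_natr; ring.
Qed.

Lemma laxb_sym e f : is_part e.1 -> is_part f.1 ->
  \sum_(y <- laxb e) y.1 * wpair y.2 f = \sum_(y <- laxb f) y.1 * wpair e y.2.
Proof.
case: e f => [rho a] [sig b] /= p_rho p_sig.
rewrite !big_cons !big_cat !big_map /=.
rewrite pick_pair //.
under [in X in _ = _ + (X + _)]eq_bigr => x _ do rewrite wpair_sym.
rewrite pick_pair //.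
under [in X in _ + (_ + X) = _]eq_bigr => x _ do rewrite mul1r wpair_sym.
under [in X in _ = _ + (_ + X)]eq_bigr => x _ do rewrite mul1r.
congr (_ + _); last by rewrite addrC.
by rewrite /wpair; case: eqP => [[-> ->] //|]; rewrite !mulr0.
Qed.

End LaxLists.

Section WExpansions.

Variables (K : fieldType) (al : K).
Local Notation psum := (seq (K * seq nat)).
Local Notation wsum := (seq (K * wterm)).

(* Over an arbitrary field; convertible to [mcoef] and [jack_ip] at [Qa], [alpha],
   where algebraic computations are prohibitively slow. *)
Definition mono_coef (A : psum) (tau : seq nat) : K :=
  \sum_(x <- A) x.1 * (pm_coef x.2 tau)%:R.

Definition jack_form (A B : psum) : K :=
  \sum_(x <- A) \sum_(y <- B)
     x.1 * y.1 * (if x.2 == y.2 then (zee x.2)%:R * al ^+ size x.2 else 0).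

Definition homogeneous (n : nat) (A : psum) : bool :=
  all (fun x => is_part x.2 && (sumn x.2 == n)) A.

Definition whomog (n : nat) (A : wsum) : bool :=
  all (fun x => is_part x.2.1 && (sumn x.2.1 + x.2.2 == n)%N) A.

Definition weval (A : wsum) (b : nat) (s : seq nat) : K :=
  \sum_(x <- A) x.1 * psi K x.2.1 x.2.2 b s.

Definition wip (A B : wsum) : K :=
  \sum_(x <- A) \sum_(y <- B) x.1 * y.1 * wpair K al x.2 y.2.

Definition wlax (A : wsum) : wsum :=
  flatten [seq [seq (x.1 * y.1, y.2) | y <- laxb K al x.2] | x <- A].

Definition winj (A : psum) : wsum := [seq (x.1, (x.2, 0%N)) | x <- A].
Definition wproj (A : wsum) : psum :=
  [seq (x.1, x.2.1) | x <- A & x.2.2 == 0%N].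

Lemma is_part_pos rho : is_part rho -> {in rho, forall i, 0 < i}%N.
Proof. by case/andP => _ /allP. Qed.

Lemma weval_lax n A b s : whomog n A -> weval (wlax A) b s = lax K al (weval A) b s.
Proof.
move=> /allP hA; rewrite /weval lax_sum /wlax big_flatten big_map.
apply: eq_big_seq => x x_A; rewrite big_map /=.
have /andP[p_x _] := hA x x_A.
rewrite lax_psi; last exact: is_part_pos.
rewrite /laxb big_cons big_cat !big_map /= !mulrDr -addrA.
congr (_ + (_ + _)); first by rewrite -!mulrA.
    by rewrite mulr_sumr; apply: eq_bigr => y _; rewrite /= !mulrA.
rewrite mulr_sumr; apply: eq_bigr => i _; rewrite mulr1; congr (_ * _).
by apply: (psi_perm K _ (i :: x.2.1)); rewrite perm_sort.
Qed.

Lemma wlax_homog n A : whomog n A -> whomog n (wlax A).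
Proof.
move=> /allP hA; apply/allP => z /flatten_mapP[x x_A /mapP[y y_x ->]] /=.
have /andP[p_x /eqP n_x] := hA x x_A.
move: y_x; rewrite inE mem_cat => /orP[/eqP ->|/orP[/mapP[v v_x ->]|/mapP[i i_x ->]]] /=.
- by rewrite p_x n_x eqxx.
- have [v0 pv] := is_part_picks _ _ p_x v_x; rewrite pv /=.
  have := picks_perm _ _ v_x; rewrite -n_x !sumnE => p_v.
  by rewrite -(perm_big _ p_v) big_cons /= addnC -addnA [X in _ == X]addnC.
move: i_x; rewrite mem_iota => /andP[i0 i_x].
rewrite is_part_ins //= -n_x !sumnE (perm_big _ (permEl (perm_sort _ _))) big_cons /=.
by rewrite addnAC subnKC // addnC.
Qed.

Lemma wip_lax n m A B : whomog n A -> whomog m B ->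
  wip (wlax A) B = wip A (wlax B).
Proof.
move=> /allP hA /allP hB; rewrite /wip /wlax big_flatten big_map.
apply: eq_big_seq => x x_A; rewrite big_flatten !big_map exchange_big.
apply: eq_big_seq => z z_B; rewrite !big_map.
have /andP[p_x _] := hA x x_A; have /andP[p_z _] := hB z z_B.
have := laxb_sym K al _ _ p_x p_z => /(congr1 (fun t => x.1 * z.1 * t)).
rewrite !mulr_sumr => E.
transitivity (\sum_(i <- laxb K al x.2) x.1 * z.1 * (i.1 * wpair K al i.2 z.2)).
  by apply: eq_bigr => i _ /=; ring.
by rewrite E; apply: eq_bigr => i _ /=; ring.
Qed.

(** The m-th Nazarov-Sklyanin operator. *)
Definition wpow m (A : psum) : psum := wproj (iter m wlax (winj A)).

Lemma winj_homog n A : homogeneous n A -> whomog n (winj A).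
Proof.
move=> /allP hA; apply/allP => _ /mapP[x x_A ->] /=.
by rewrite addn0; apply: hA.
Qed.

Lemma iter_wlax_homog n m A : whomog n A -> whomog n (iter m wlax A).
Proof. by move=> hA; elim: m => //= m; apply: wlax_homog. Qed.

Lemma wpow_homog n m A : homogeneous n A -> homogeneous n (wpow m A).
Proof.
move=> hA; have /allP H := iter_wlax_homog n m _ (winj_homog n A hA).
apply/allP => y /mapP[x]; rewrite mem_filter => /andP[/eqP x0 /H] x_n -> /=.
by move: x_n; rewrite x0 addn0.
Qed.

Lemma weval_inj A b s : weval (winj A) b s = mono_coef A (b :: s).
Proof.
rewrite /weval big_map; apply: eq_bigr => x _ /=.
by rewrite (pm_coefE K) psi0.
Qed.

Lemma weval_iter n m A b s : whomog n A ->
  weval (iter m wlax A) b s = iter m (lax K al) (weval A) b s.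
Proof.
move=> hA; elim: m b s => //= m IH b s.
rewrite (weval_lax n); last exact: iter_wlax_homog.
exact: eq_lax.
Qed.

Lemma eq_iter_lax m h1 h2 : h1 =2 h2 -> iter m (lax K al) h1 =2 iter m (lax K al) h2.
Proof. by move=> E; elim: m => //= m IH; apply: eq_lax. Qed.

(** Links the two pictures of the operator: power sums, which show self-adjointness, and monomial
    coefficients, which show triangularity. *)
Lemma mono_coef_wpow n m A s : homogeneous n A ->
  mono_coef (wpow m A) s = iter m (lax K al) (fun b t => mono_coef A (b :: t)) 0%N s.
Proof.
move=> hA; have hw := winj_homog n A hA.
rewrite -(eq_iter_lax m _ _ (weval_inj A)) -(weval_iter n) //.
rewrite /mono_coef big_map big_filter big_mkcond /=; apply: eq_big_seq => x x_A.
have /allP /(_ x x_A) /andP[p_x _] := iter_wlax_homog n m _ hw.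
rewrite psi_pi0; last exact: is_part_pos.
by case: ifP => _; rewrite ?mulr0 // (pm_coefE K).
Qed.

Lemma wip_inj A B : wip A (winj B) = jack_form (wproj A) B.
Proof.
rewrite /wip /jack_form big_map big_filter [RHS]big_mkcond; apply: eq_bigr => x _.
rewrite big_map /wpair; case: ifP => [/eqP x0|/negP x0].
  apply: eq_bigr => y _ /=; congr (_ * _).
  by case: x x0 => [c [rho a]] /= ->; rewrite xpair_eqE andbT.
rewrite big1 // => y _; case: eqP => [E|_]; last by rewrite mulr0.
by case: x0; rewrite E.
Qed.

Lemma wip_sym A B : wip A B = wip B A.
Proof.
rewrite /wip exchange_big; apply: eq_bigr => x _; apply: eq_bigr => y _.
by rewrite wpair_sym; ring.
Qed.

Lemma jack_form_sym A B : jack_form A B = jack_form B A.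
Proof.
rewrite /jack_form exchange_big; apply: eq_bigr => x _; apply: eq_bigr => y _.
by rewrite eq_sym; case: eqP => [->|_]; ring.
Qed.

Lemma jack_form_wpow n m A B : homogeneous n A -> homogeneous n B -> jack_form (wpow m A) B = jack_form A (wpow m B).
Proof.
move=> hA hB; rewrite -wip_inj jack_form_sym -wip_inj.
have : whomog n (winj A) by exact: winj_homog.
have : whomog n (winj B) by exact: winj_homog.
move: (winj A) (winj B) => {A hA} A {B hB} B hB hA.
rewrite [RHS]wip_sym; elim: m B hB => //= m IH B hB.
rewrite (wip_lax n n) //; last exact: iter_wlax_homog.
by rewrite IH -?iterSr //; exact: wlax_homog.
Qed.

End WExpansions.

(** * From power sums to monomials: triangularity and nondegeneracy *)

Lemma size_part rho : is_part rho -> (size rho <= sumn rho)%N.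
Proof.
case/andP => _; elim: rho => //= i rho IH /andP[i0 /IH le].
by rewrite -add1n leq_add.
Qed.

(** A counted map reaches every row of tau, since the rows are nonzero. With equally many parts and
    rows it is a bijection, and each part equals its row. *)
Lemma pm_coef_neq0 rho tau : is_part rho -> is_part tau -> pm_coef rho tau != 0%N ->
  (size tau <= size rho)%N /\ ((size rho <= size tau)%N -> rho = tau).
Proof.
move=> p_rho p_tau; rewrite -lt0n => /card_gt0P[f]; rewrite inE => /forallP H.
have surj i : exists j, f j == i.
  apply/existsP; apply: contraT => /existsPn ne.
  have := H i; rewrite big_pred0 => [|j]; last exact/negbTE/ne.
  have : nth 0%N tau i \in tau by apply: mem_nth.
  by move/(is_part_pos _ p_tau) => + /eqP E; rewrite -E.
have codomE : [set: 'I_(size tau)] \subset f @: [set: 'I_(size rho)].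
  by apply/subsetP => i _; have [j /eqP <-] := surj i; apply: imset_f.
have le : (size tau <= size rho)%N.
  have := subset_leq_card codomE; rewrite cardsT card_ord => /leq_trans; apply.
  by apply: leq_trans (leq_imset_card _ _) _; rewrite cardsT card_ord.
split=> // ge; have sz : size rho = size tau by apply/eqP; rewrite eqn_leq le ge.
have f_inj : injective f.
  have : #|f @: [set: 'I_(size rho)]| == #|[set: 'I_(size rho)]|.
    rewrite eqn_leq leq_imset_card /=; apply: leq_trans (subset_leq_card codomE).
    by rewrite !cardsT !card_ord.
  by move/imset_injP => inj j k jk; apply: inj => //; rewrite in_setT.
have rhoE : rho = [seq nth 0%N tau (f k) | k <- enum 'I_(size rho)].
  rewrite -{1}[rho](mkseq_nth 0%N) /mkseq -val_enum_ord -map_comp.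
  apply: eq_map => k /=; rewrite -(eqP (H (f k))).
  by rewrite (big_pred1 k) // => j; rewrite /= (inj_eq f_inj).
have tauE : tau = map (fun i : 'I_(size tau) => nth 0%N tau i) (enum 'I_(size tau)).
  by rewrite -{1}[tau](mkseq_nth 0%N) /mkseq -val_enum_ord -map_comp.
have [/andP[s_rho _] /andP[s_tau _]] := (p_rho, p_tau).
apply: sorted_geq_eq => //; rewrite rhoE [X in perm_eq _ X]tauE.
rewrite (map_comp (fun i : 'I_(size tau) => nth 0%N tau i)); apply: perm_map.
apply: uniq_perm => [||i].
- by rewrite (map_inj_uniq f_inj) enum_uniq.
- exact: enum_uniq.
by rewrite mem_enum; have [j /eqP <-] := surj i; rewrite map_f // mem_enum.
Qed.

Lemma pm_coef_diag rho : pm_coef rho rho != 0%N.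
Proof.
rewrite -lt0n; apply/card_gt0P; exists [ffun i => i]; rewrite inE.
apply/forallP => i; rewrite (big_pred1 i) // => j.
by rewrite /= ffunE.
Qed.

Section Injectivity.

Variables (K : fieldType) (al : K).
Hypothesis al_lin : forall a b : int, a%:~R + b%:~R * al = 0 -> a = 0 /\ b = 0.
Local Notation psum := (seq (K * seq nat)).

(** An expansion may list p_rho several times; a symmetric function is zero when these collected
    coefficients are. *)
Definition pcoef (A : psum) (rho : seq nat) : K := \sum_(x <- A | x.2 == rho) x.1.

Lemma sum_pcoef (A : psum) (F : seq nat -> K) :
  \sum_(x <- A) x.1 * F x.2
  = \sum_(s <- undup [seq x.2 | x <- A]) pcoef A s * F s.
Proof.
transitivity (\sum_(x <- A) \sum_(s <- undup [seq x.2 | x <- A])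
    (if x.2 == s then x.1 else 0) * F s).
  apply: eq_big_seq => x x_A; rewrite (bigD1_seq x.2) ?undup_uniq //=; last first.
    by rewrite mem_undup map_f.
  rewrite eqxx big1 ?addr0 // => s ne.
  by rewrite eq_sym (negPf ne) mul0r.
rewrite exchange_big; apply: eq_bigr => s _.
by rewrite -mulr_suml -big_mkcond.
Qed.

Lemma pcoef0_sum (A : psum) (F : seq nat -> K) : (forall rho, pcoef A rho = 0) ->
  \sum_(x <- A) x.1 * F x.2 = 0.
Proof. by move=> A0; rewrite sum_pcoef big1 // => s _; rewrite A0 mul0r. Qed.

Lemma mono_coef_inj n (A : psum) : homogeneous K n A ->
  (forall tau, is_part tau -> sumn tau = n -> mono_coef K A tau = 0) ->
  forall rho, pcoef A rho = 0.
Proof.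
move=> /allP hA A0 rho.
have [k] := ubnP (n - size rho); elim: k rho => // k IH rho lt_k.
have [rho_A|rho_nA] := boolP (rho \in [seq x.2 | x <- A]); last first.
  rewrite /pcoef big1_seq // => x /andP[/eqP xE x_A].
  by rewrite -xE map_f in rho_nA.
have partA s : s \in [seq x.2 | x <- A] -> is_part s /\ sumn s = n.
  by move=> /mapP[x /hA /andP[p /eqP e] ->].
have [p_rho n_rho] := partA _ rho_A.
have := A0 rho p_rho n_rho; rewrite /mono_coef (sum_pcoef A (fun s => (pm_coef s rho)%:R)).
rewrite (bigD1_seq rho) ?undup_uniq ?mem_undup //= big1_seq ?addr0.
  by move/eqP; rewrite mulf_eq0 (al_natr_eq0 K al) // (negPf (pm_coef_diag _)) orbF => /eqP.
move=> s /andP[ne]; rewrite mem_undup => /partA[p_s n_s].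
have [->|/(pm_coef_neq0 _ _ p_s p_rho)[le]] := eqVneq (pm_coef s rho) 0%N.
  by rewrite mulr0.
case: leqP => [_ /(_ isT) E|lt _]; first by rewrite E eqxx in ne.
rewrite IH ?mul0r //; have := size_part _ p_s; rewrite n_s; lia.
Qed.

Lemma jack_form_pcoef0 (A B : psum) : (forall rho, pcoef A rho = 0) -> jack_form K al A B = 0.
Proof.
move=> A0; rewrite /jack_form exchange_big big1 // => y _.
rewrite -[RHS](pcoef0_sum A (fun s => y.1 * (if s == y.2 then (zee s)%:R * al ^+ size s else 0))) //.
by apply: eq_bigr => x _; rewrite mulrA.
Qed.

Lemma zee_gt0 rho : (0 < zee rho)%N.
Proof.
rewrite /zee big_seq prodn_cond_gt0 // => i; rewrite mem_index_iota => /andP[i0 _].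
by rewrite muln_gt0 expn_gt0 i0 fact_gt0.
Qed.

Lemma jack_form_nondeg n (A : psum) : homogeneous K n A ->
  (forall B, homogeneous K n B -> jack_form K al A B = 0) -> forall rho, pcoef A rho = 0.
Proof.
move=> /allP hA A0 rho.
have [rho_A|rho_nA] := boolP (rho \in [seq x.2 | x <- A]); last first.
  rewrite /pcoef big1_seq // => x /andP[/eqP xE x_A].
  by rewrite -xE map_f in rho_nA.
have hB : homogeneous K n [:: (1, rho)].
  by case/mapP: rho_A => x /hA + ->; rewrite /homogeneous /= andbT.
have := A0 _ hB; rewrite /jack_form.
have -> : \sum_(x <- A) \sum_(y <- [:: (1, rho)])
     x.1 * y.1 * (if x.2 == y.2 then (zee x.2)%:R * al ^+ size x.2 else 0)
   = pcoef A rho * ((zee rho)%:R * al ^+ size rho).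
  rewrite /pcoef mulr_suml [RHS]big_mkcond; apply: eq_bigr => x _.
  rewrite big_seq1 mulr1; case: eqP => [->|_]; first by [].
  by rewrite mulr0.
move/eqP; rewrite !mulf_eq0 (al_natr_eq0 K al) // eqn0Ngt zee_gt0 /=.
by rewrite expf_eq0 (negPf (al_neq0 K al al_lin)) andbF orbF => /eqP.
Qed.

End Injectivity.

(* Dominance is only used through [qsum], which is strictly increasing for it. *)
Definition qsum (s : seq nat) : nat := sumn [seq x ^ 2 | x <- s]%N.

(** Abel summation as a recursion: c is the surplus of la over tau left by the earlier rows, and
    since tau decreases it may be weighted by the next part of tau. *)
Lemma dominated_dot (tau la : seq nat) c : sorted geq tau ->
  (forall i, (i <= size tau)%N -> (sumn (take i tau) <= c + sumn (take i la))%N) ->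
  (qsum tau <= c * head 0 tau + \sum_(i < size tau) nth 0 tau i * nth 0 la i)%N.
Proof.
elim: tau la c => [|t tau IH] la c //= s_tau H.
rewrite big_ord_recl /=.
have le1 : (t <= c + nth 0 la 0)%N.
  by have := H 1%N isT; rewrite /= take0 addn0; case: la {H} => //= l la; rewrite take0 addn0.
have {}IH := IH (behead la) (c + nth 0 la 0 - t)%N (path_sorted s_tau).
have le_ht : (head 0 tau <= t)%N by case: tau s_tau {IH H} => //= x tau /andP[].
have {}H : forall i, (i <= size tau)%N ->
    (sumn (take i tau) <= c + nth 0 la 0 - t + sumn (take i (behead la)))%N.
  move=> i le_i; have := H i.+1; rewrite ltnS => /(_ le_i) /=.
  by case: la {H IH} le1 => [|l la] /= le1; lia.
have := IH H; rewrite /qsum /=.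
have -> : (\sum_(i < size tau) nth 0 tau i * nth 0 (behead la) i
      = \sum_(i < size tau) nth 0 tau i * nth 0 la (bump 0 i))%N.
  by apply: eq_bigr => i _; rewrite nth_behead.
move: (\sum_(i < size tau) _)%N => S.
have : ((c + nth 0 la 0 - t) * head 0 tau <= (c + nth 0 la 0 - t) * t)%N.
  by rewrite leq_mul.
nia.
Qed.

Lemma sum_nth_pad (s : seq nat) (G : nat -> nat -> nat) m : (size s <= m)%N ->
  (forall i, G 0 i = 0)%N ->
  (\sum_(i < size s) G (nth 0 s i) i = \sum_(i < m) G (nth 0 s i) i)%N.
Proof.
elim: s m G => [|x s IH] m G le G0.
  by rewrite big_ord0 big1 // => i _; rewrite nth_nil.
case: m le => // m le; rewrite !big_ord_recl; congr (_ + _)%N.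
exact: (IH m (fun x i => G x i.+1)).
Qed.

Lemma qsum_nth s m : (size s <= m)%N -> qsum s = (\sum_(i < m) nth 0 s i ^ 2)%N.
Proof.
move=> le; rewrite -(sum_nth_pad s (fun x i => x ^ 2)%N) //.
elim: s {le} => [|x s IH]; first by rewrite big_ord0.
by rewrite big_ord_recl -IH.
Qed.

(** [dominated_dot] gives |tau|^2 <= <tau, la>. Were |la|^2 <= |tau|^2, every inequality 2 a b <=
    a^2 + b^2 between corresponding rows would be an equality, and tau would equal la. *)
Lemma dominated_qsum tau la : is_part tau -> is_part la -> dominated tau la ->
  tau != la -> (qsum tau < qsum la)%N.
Proof.
move=> p_tau p_la /andP[/eqP n_tl /allP dom] ne.
have [s_tau _] := andP p_tau.
have dot : (qsum tau <= \sum_(i < size tau) nth 0 tau i * nth 0 la i)%N.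
  have := dominated_dot tau la 0 s_tau; rewrite mul0n add0n; apply.
  by move=> i le_i; rewrite add0n; apply: dom; rewrite mem_iota add0n ltnS.
pose m := maxn (size tau) (size la).
have [le1 le2] : (size tau <= m)%N /\ (size la <= m)%N.
  by rewrite leq_maxl leq_maxr.
rewrite ltnNge; apply: contra ne => le_q.
rewrite (sum_nth_pad tau (fun x i => x * nth 0 la i)%N m) // in dot.
rewrite (qsum_nth _ _ le1) in dot le_q; rewrite (qsum_nth _ _ le2) in le_q.
have := @leqif_sum _ (fun _ : 'I_m => true) (fun i : 'I_m => nth 0 tau i == nth 0 la i)%N
   (fun i => 2 * (nth 0 tau i * nth 0 la i))%N
   (fun i => nth 0 tau i ^ 2 + nth 0 la i ^ 2)%N (fun i _ => nat_Cauchy _ _).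
rewrite -big_distrr big_split /= => -[le E].
have /forallP {E} E : [forall i : 'I_m, nth 0 tau i == nth 0 la i]%N.
  rewrite -E eqn_leq le mul2n -addnn; exact: leq_add dot (leq_trans le_q dot).
have {}E i : nth 0%N tau i = nth 0%N la i.
  have [lt|ge] := ltnP i m; first by have /eqP := E (Ordinal lt).
  by rewrite !nth_default //; apply: leq_trans ge.
have pos (s t : seq nat) : is_part s -> (forall i, nth 0%N s i = nth 0%N t i) ->
    (size s <= size t)%N.
  move=> p_s st; rewrite leqNgt; apply/negP => lt.
  have := is_part_pos _ p_s _ (mem_nth 0%N lt).
  by rewrite st nth_default.
apply/eqP/(@eq_from_nth _ 0%N); last by move=> i _.
by apply/eqP; rewrite eqn_leq !pos.
Qed.

Lemma qsum_cat s t : qsum (s ++ t) = (qsum s + qsum t)%N.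
Proof. by rewrite /qsum map_cat sumn_cat. Qed.

Lemma qsum_perm s t : perm_eq s t -> qsum s = qsum t.
Proof. by move=> st; rewrite /qsum !sumnE !big_map; apply: perm_big. Qed.

Lemma qsum_filter s : qsum [seq x <- s | (0 < x)%N] = qsum s.
Proof. by elim: s => //= -[|x] s IH; rewrite /qsum /= -/(qsum _) IH. Qed.

Lemma sq_spread b c j : (j < b)%N -> (j < c)%N ->
  (b ^ 2 + c ^ 2 < (b + c - j) ^ 2 + j ^ 2)%N.
Proof.
move=> ib ic; have [x ->] : exists x, b = (x + j).+1 by exists (b - j).-1; lia.
have [y ->] : exists y, c = (y + j).+1 by exists (c - j).-1; lia.
have -> : ((x + j).+1 + (y + j).+1 - j = x + y + j + 2)%N by lia.
by rewrite !expnS !expn0; nia.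
Qed.

(** * Triangularity of the Lax operator for the sum of squares, and its eigenvalues *)

Section Triangularity.

Variables (K : fieldType) (al : K).
Local Notation hop := (hop K).
Local Notation lax := (lax K al).
Implicit Types h : nat -> seq nat -> K.

Definition sinv h := forall b s1 x y s2, h b (s1 ++ x :: y :: s2) = h b (s1 ++ y :: x :: s2).
Definition zinv h := forall b s1 s2, h b (s1 ++ 0%N :: s2) = h b (s1 ++ s2).

Lemma zinv_filter h b s : zinv h -> h b [seq x <- s | (0 < x)%N] = h b s.
Proof.
move=> hz; elim: s h hz => //= -[|x] s IH h hz /=.
  by rewrite IH // -(hz b [::] s).
by apply: (IH (fun x' t => h x' (x.+1 :: t))) => y s1 s2; apply: (hz y (x.+1 :: s1)).
Qed.

Lemma hop_sinv h : sinv h -> sinv (hop h).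
Proof.
move=> hs b s1; elim: s1 h hs => [|c s1 IH] h hs x y s2 /=; last first.
  congr (_ + _); first by apply: eq_hop2 => u v; apply: (hs u (v :: s1)).
  by apply: IH => u t1; apply: (hs u (c :: t1)).
rewrite addrCA; congr (_ + (_ + _)).
- by apply: eq_hop2 => u v; apply: (hs u [::]).
- by apply: eq_hop2 => u v; apply: (hs u [::]).
by apply: eq_hop => u t; apply: (hs u [::]).
Qed.

Lemma hop_zinv h : zinv h -> zinv (hop h).
Proof.
move=> hz b s1; elim: s1 h hz => [|c s1 IH] h hz s2 /=.
  rewrite hop2_0r add0r; apply: eq_hop => x t; exact: (hz x [::]).
congr (_ + _); first by apply: eq_hop2 => u v; apply: (hz u (v :: s1)).
by apply: IH => u t1; apply: (hz u (c :: t1)).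
Qed.

Lemma lax_sinv h : sinv h -> sinv (lax h).
Proof. by move=> hs b s1 x y s2; rewrite /lax hs hop_sinv. Qed.

Lemma lax_zinv h : zinv h -> zinv (lax h).
Proof. by move=> hz b s1 s2; rewrite /lax hz hop_zinv. Qed.

Lemma iter_lax_sinv m h : sinv h -> sinv (iter m lax h).
Proof. by move=> hs; elim: m => //= m; apply: lax_sinv. Qed.

Lemma iter_lax_zinv m h : zinv h -> zinv (iter m lax h).
Proof. by move=> hz; elim: m => //= m; apply: lax_zinv. Qed.

(** For b < c, the summands with i >= b telescope as in [hop2_0l] after lowering both exponents by
    b, which leaves the exchange of b and c. The other summands have exponents further apart than b
    and c. *)
Lemma hop2_top g b c :
  hop2 K g b c = \sum_(i < minn b c) (g (b + c - i)%N i - g i (b + c - i)%N)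
               + if (b < c)%N then g c b - g b c else 0.
Proof.
case: (ltnP b c) => [lt_bc|le_cb]; last first.
  by rewrite addr0.
have [d cE] : exists d, c = (b + d)%N by exists (c - b)%N; rewrite subnKC // ltnW.
subst c; rewrite /hop2 big_split_ord /=; congr (_ + _).
have := hop2_0l K (fun x y => g (b + x) (b + y))%N d; rewrite /hop2 addn0 => <-.
by apply: eq_bigr => i _; congr (g _ _ - g _ _); have := ltn_ord i; lia.
Qed.

(** [k] accounts for the squares of the variables that the recursion of [hop] has already passed. *)
Definition supp (R k : nat) h := forall b s, (R < k + b ^ 2 + qsum s)%N -> h b s = 0.

(** At the edge of the support only exchanges survive: every other term spreads two exponents and so
    leaves the support by [sq_spread]. *)
Lemma hop_top R k h w b s : supp R k h -> (R <= k + b ^ 2 + qsum s)%N ->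
  (forall s1 c s2, s = s1 ++ c :: s2 -> (b < c)%N -> h c (s1 ++ b :: s2) = w c) ->
  h b s = w b -> hop h b s = \sum_(c <- s | (b < c)%N) (w c - w b).
Proof.
elim: s k h => [|c s IH] k h hR le hw hb; first by rewrite big_nil.
have qc : qsum (c :: s) = (c ^ 2 + qsum s)%N by [].
rewrite /= hop2_top big1 => [|i _]; last first.
  have lt_i : (i < minn b c)%N by [].
  have lt_q : (b ^ 2 + c ^ 2 < (b + c - i) ^ 2 + i ^ 2)%N.
    by move: lt_i; rewrite leq_min => /andP[ib ic]; apply: sq_spread.
  by rewrite !hR ?subrr // /qsum /= -/(qsum _); rewrite qc in le; lia.
rewrite add0r (IH (k + c ^ 2)%N).
- rewrite big_cons; case: ifP => lt_bc; last by rewrite add0r.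
  by congr (_ - _ + _); first exact: (hw [::]).
- by move=> x t lt; apply: hR; rewrite /qsum /= -/(qsum _); lia.
- by rewrite qc in le; lia.
- by move=> s1 x s2 sE; apply: (hw (c :: s1)); rewrite sE.
by [].
Qed.

Lemma lax_supp R h : supp R 0 h -> supp R 0 (lax h).
Proof.
move=> hR b s lt; rewrite /lax hR // mulr0 add0r.
rewrite (hop_top R 0 h (fun _ => 0)) //; first by rewrite big1 // => *; rewrite subrr.
- exact: ltnW.
- move=> s1 c s2 sE _; apply: hR; move: lt.
  by rewrite sE !qsum_cat /qsum /= ; lia.
exact: hR.
Qed.

Lemma iter_lax_supp R m h : supp R 0 h -> supp R 0 (iter m lax h).
Proof. by move=> hR; elim: m => //= m; apply: lax_supp. Qed.

(* [eigval la m 0] is the eigenvalue at [J la] of the m-th Nazarov-Sklyanin operator. *)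
Fixpoint eigval (la : seq nat) (m : nat) (b : nat) : K :=
  if m is m'.+1 then
    al * b%:R * eigval la m' b + \sum_(c <- la | (b < c)%N) (eigval la m' c - eigval la m' b)
  else 1.

(** The arrangements of la form a block at the edge of the support. [lax] preserves it, and the
    values on it depend only on the exponent of x_0. *)
Lemma iter_block h la a : supp (qsum la) 0 h ->
  (forall b s, perm_eq [seq x <- b :: s | 0 < x]%N la -> h b s = a) ->
  forall m b s, perm_eq [seq x <- b :: s | 0 < x]%N la -> iter m lax h b s = a * eigval la m b.
Proof.
move=> hR ha; elim=> [|m IH] b s p_bs; first by rewrite /= mulr1 ha.
rewrite [LHS]/= /lax IH // [eigval _ _ _]/= mulrDr mulrCA; congr (_ + _).
have hRm := iter_lax_supp _ m _ hR.
rewrite (hop_top _ _ _ (fun c => a * eigval la m c) _ _ hRm) ?IH //.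
- rewrite -(perm_big _ p_bs) big_filter_cond big_cons ltnn andbF mulr_sumr.
  apply: eq_big => [c|c _]; last by rewrite mulrBr.
  by case: (ltnP b c) => [/(leq_ltn_trans (leq0n _)) ->|_]; rewrite ?andbF.
- by rewrite -(qsum_perm _ _ p_bs) qsum_filter.
move=> s1 c s2 sE _; rewrite IH //; apply: perm_trans p_bs.
rewrite sE; apply: perm_filter; apply/seq.permP => p /=.
by rewrite !count_cat /=; lia.
Qed.

End Triangularity.

Lemma psmul_sinv (K : fieldType) i (g : seq nat -> K) :
  (forall s1 x y s2, g (s1 ++ x :: y :: s2) = g (s1 ++ y :: x :: s2)) ->
  forall s1 x y s2, psmul K i g (s1 ++ x :: y :: s2) = psmul K i g (s1 ++ y :: x :: s2).
Proof.
move=> gs s1; elim: s1 g gs => [|c s1 IH] g gs x y s2 /=.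
  rewrite addrCA; congr (_ + (_ + _)).
  - by case: ifP => // _; apply: (gs [::]).
  - by case: ifP => // _; apply: (gs [::]).
  by apply: eq_psmul => t; apply: (gs [::]).
congr (_ + _); first by case: ifP => // _; apply: (gs (_ :: s1)).
by apply: IH => t1; apply: (gs (c :: t1)).
Qed.

Lemma ps_sinv (K : fieldType) rho s1 x y s2 :
  ps K rho (s1 ++ x :: y :: s2) = ps K rho (s1 ++ y :: x :: s2).
Proof.
elim: rho s1 x y s2 => [|i rho IH] s1 x y s2; last exact: psmul_sinv.
by rewrite /= !all_cat /=; congr (nat_of_bool (_ && _))%:R; rewrite andbCA.
Qed.

Lemma psmul_zinv (K : fieldType) i (g : seq nat -> K) : (0 < i)%N ->
  (forall s1 s2, g (s1 ++ 0%N :: s2) = g (s1 ++ s2)) ->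
  forall s1 s2, psmul K i g (s1 ++ 0%N :: s2) = psmul K i g (s1 ++ s2).
Proof.
move=> i0 gz s1; elim: s1 g gz => [|c s1 IH] g gz s2 /=.
  rewrite leqNgt i0 add0r; apply: eq_psmul => t; exact: (gz [::]).
congr (_ + _); first by case: ifP => // _; apply: (gz (_ :: s1)).
by apply: IH => t1; apply: (gz (c :: t1)).
Qed.

Lemma ps_zinv (K : fieldType) rho s1 s2 : {in rho, forall i, 0 < i}%N ->
  ps K rho (s1 ++ 0%N :: s2) = ps K rho (s1 ++ s2).
Proof.
elim: rho s1 s2 => [|i rho IH] s1 s2 pos; first by rewrite /= !all_cat.
apply: psmul_zinv; first by rewrite pos ?mem_head.
by move=> t1 t2; apply: IH => j j_rho; rewrite pos // inE j_rho orbT.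
Qed.

Definition parts (n : nat) : seq (seq nat) :=
  undup [seq s <- [seq [seq x <- map val (t : n.-tuple 'I_n.+1) | 0 < x]%N
                  | t <- enum {: n.-tuple 'I_n.+1}] | is_part s & sumn s == n].

Lemma mem_parts n s : (s \in parts n) = is_part s && (sumn s == n).
Proof.
rewrite mem_undup mem_filter; apply/andP/idP => [[]//|ps]; split=> //.
have /andP[p_s /eqP n_s] := ps.
have le_s : (size s <= n)%N by rewrite -n_s size_part.
have le_x x : x \in s -> (x < n.+1)%N.
  move=> x_s; rewrite ltnS -n_s; elim: s x_s {ps p_s n_s le_s} => //= y s IH.
  rewrite inE => /orP[/eqP ->|/IH le]; first exact: leq_addr.
  exact: leq_trans le (leq_addl _ _).
have sz : size ([seq inord x : 'I_n.+1 | x <- s] ++ nseq (n - size s) ord0) == n.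
  by rewrite size_cat size_map size_nseq subnKC.
apply/mapP; exists (Tuple sz); first by rewrite mem_enum.
rewrite /= map_cat filter_cat map_nseq filter_nseq /= cats0 -map_comp.
have -> : map (val \o (inord : nat -> 'I_n.+1)) s = s.
  rewrite -[RHS]map_id; apply/eq_in_map => x x_s /=.
  by rewrite inordK // le_x.
by apply/esym/all_filterP/allP => x /(is_part_pos _ p_s).
Qed.

Section PsumLists.

Variables (K : fieldType) (al : K).
Local Notation psum := (seq (K * seq nat)).
Local Notation mono_coef := (mono_coef K).

Definition pscale (c : K) (A : psum) : psum := [seq (c * x.1, x.2) | x <- A].

Lemma mono_coef_cat A B s : mono_coef (A ++ B) s = mono_coef A s + mono_coef B s.
Proof. by rewrite /mono_coef big_cat. Qed.

Lemma mono_coef_scale c A s : mono_coef (pscale c A) s = c * mono_coef A s.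
Proof.
rewrite /mono_coef big_map mulr_sumr; apply: eq_bigr => x _ /=.
by rewrite mulrA.
Qed.

Lemma mono_coef_flatten (I : Type) (r : seq I) (F : I -> psum) s :
  mono_coef (flatten [seq F i | i <- r]) s = \sum_(i <- r) mono_coef (F i) s.
Proof. by rewrite /mono_coef big_flatten big_map. Qed.

Lemma jack_form_cat A B C : jack_form K al (A ++ B) C = jack_form K al A C + jack_form K al B C.
Proof. by rewrite /jack_form big_cat. Qed.

Lemma jack_form_scale c A B : jack_form K al (pscale c A) B = c * jack_form K al A B.
Proof.
rewrite /jack_form big_map mulr_sumr; apply: eq_bigr => x _.
by rewrite mulr_sumr; apply: eq_bigr => y _ /=; ring.
Qed.

Lemma jack_form_flatten (I : Type) (r : seq I) (F : I -> psum) C :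
  jack_form K al (flatten [seq F i | i <- r]) C = \sum_(i <- r) jack_form K al (F i) C.
Proof. by rewrite /jack_form big_flatten big_map. Qed.

Lemma homog_cat n A B : homogeneous K n (A ++ B) = homogeneous K n A && homogeneous K n B.
Proof. by rewrite /homogeneous all_cat. Qed.

Lemma homog_scale n c A : homogeneous K n A -> homogeneous K n (pscale c A).
Proof. by rewrite /homogeneous all_map => /allP H; apply/allP => x /H. Qed.

Lemma homog_flatten (I : eqType) n (r : seq I) (F : I -> psum) :
  (forall i, i \in r -> homogeneous K n (F i)) -> homogeneous K n (flatten [seq F i | i <- r]).
Proof.
move=> H; apply/allP => x /flatten_mapP[i i_r x_i].
exact: (allP (H i i_r)).
Qed.

End PsumLists.

Definition nrm (s : seq nat) : seq nat := sort geq [seq x <- s | 0 < x]%N.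

Lemma nrm_part s : is_part (nrm s).
Proof.
rewrite /is_part /nrm (perm_all _ (permEl (perm_sort _ _))) filter_all andbT.
by apply: sort_sorted => x y; apply: leq_total.
Qed.

Lemma perm_nrm s : perm_eq (nrm s) [seq x <- s | 0 < x]%N.
Proof. by rewrite perm_sort. Qed.

Lemma sumn_nrm s : sumn (nrm s) = sumn s.
Proof.
rewrite [LHS]sumnE (perm_big _ (perm_nrm s)) /= -sumnE.
by elim: s => //= -[|x] s IH /=; rewrite IH.
Qed.

Lemma qsum_nrm s : qsum (nrm s) = qsum s.
Proof. by rewrite (qsum_perm _ _ (perm_nrm s)) qsum_filter. Qed.

(** * Jack functions as eigenfunctions *)

Section JackFamily.

Variables (K : fieldType) (al : K).
Hypothesis al_lin : forall a b : int, a%:~R + b%:~R * al = 0 -> a = 0 /\ b = 0.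
Local Notation psum := (seq (K * seq nat)).
Local Notation mono_coef := (mono_coef K).
Local Notation jack_form := (jack_form K al).
Local Notation lax := (lax K al).
Local Notation eigval := (eigval K al).

Variables (J : seq nat -> psum) (H : seq nat -> K).
Hypothesis J_homog : forall la, is_part la -> homogeneous K (sumn la) (J la).
Hypothesis J_tri : forall la tau, is_part la -> is_part tau ->
  mono_coef (J la) tau != 0 -> dominated tau la.
Hypothesis J_lead : forall la, is_part la -> mono_coef (J la) la = H la.
Hypothesis J_orth : forall la mu, is_part la -> is_part mu -> mu != la ->
  jack_form (J la) (J mu) = 0.
Hypothesis H_neq0 : forall la, is_part la -> H la != 0.

Lemma mono_coef_perm (A : psum) s t : perm_eq s t -> mono_coef A s = mono_coef A t.
Proof.
move=> st; apply: eq_bigr => z _; rewrite !(pm_coefE K); congr (_ * _).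
by move: s t st; apply: perm_adjacent => s1 x y s2; apply: ps_sinv.
Qed.

Lemma mono_coef_filter n (A : psum) s : homogeneous K n A ->
  mono_coef A [seq x <- s | 0 < x]%N = mono_coef A s.
Proof.
move=> /allP hA; apply: eq_big_seq => z /hA /andP[/is_part_pos pos _].
rewrite !(pm_coefE K); congr (_ * _).
apply: (zinv_filter K (fun _ => ps K z.2) 0%N) => b s1 s2.
exact: ps_zinv.
Qed.

Lemma mono_coef_nrm n (A : psum) s : homogeneous K n A -> mono_coef A (nrm s) = mono_coef A s.
Proof. by move=> hA; rewrite (mono_coef_perm _ _ _ (perm_nrm s)) (mono_coef_filter n). Qed.

Local Notation u la := (mono_coef (J la)).

Lemma u_dom la s : is_part la -> u la s != 0 -> dominated (nrm s) la.
Proof.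
move=> p_la; rewrite -(mono_coef_nrm (sumn la)) ?J_homog //.
by apply: J_tri => //; apply: nrm_part.
Qed.

Lemma u_qsum la s : is_part la -> u la s != 0 ->
  nrm s = la \/ (qsum s < qsum la)%N.
Proof.
move=> p_la /(u_dom _ _ p_la) dom; have [->|ne] := eqVneq (nrm s) la; first by left.
by right; rewrite -qsum_nrm; apply: dominated_qsum => //; apply: nrm_part.
Qed.

Lemma u_nrm la s : is_part la -> nrm s = la -> u la s = H la.
Proof.
by move=> p_la sE; rewrite -(mono_coef_nrm (sumn la)) ?J_homog // sE J_lead.
Qed.

Lemma u_head la s : is_part la -> u la s != 0 -> {in s, forall x, x <= head 0 la}%N.
Proof.
move=> p_la /(u_dom _ _ p_la) /andP[_ /allP dom] x x_s.
have [->//|x0] := posnP x.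
have x_n : x \in nrm s by rewrite (perm_mem (perm_nrm s)) mem_filter x0.
have := nrm_part s; case: (nrm s) x_n dom => // y t y_t dom.
rewrite /is_part /= (path_sortedE (rev_trans leq_trans)) => /andP[/andP[/allP le _] _].
have {}dom : (y <= head 0 la)%N.
  have := dom 1%N; rewrite mem_iota /= take0 addn0 => /(_ isT).
  by case: (la) => //= z r; rewrite take0 addn0.
move: y_t; rewrite inE => /orP[/eqP -> //|/le /= le_xy]; exact: leq_trans le_xy dom.
Qed.

(** Elimination from the largest sum of squares downwards. Distinct partitions at one level do not
    interact, because J_s has there no coefficient other than its leading one. *)
Lemma span n (A : psum) R : homogeneous K n A ->
  (forall tau, is_part tau -> sumn tau = n -> mono_coef A tau != 0 -> (qsum tau < R)%N) ->
  exists S : psum,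
    (forall y, y \in S -> [/\ is_part y.2, sumn y.2 = n & (qsum y.2 < R)%N])
    /\ (forall rho, pcoef K (A ++ pscale K (-1) (flatten [seq pscale K y.1 (J y.2) | y <- S])) rho = 0).
Proof.
move=> hA; elim: R A hA => [|R IH] A hA suppA.
  exists [::]; split=> //= rho; rewrite cats0.
  apply: (mono_coef_inj K al al_lin n A hA) => tau p_tau n_tau.
  by apply/eqP; apply: contraT => /(suppA tau p_tau n_tau).
pose S1 := [seq (mono_coef A s / H s, s) | s <- parts n & qsum s == R].
have S1P y : y \in S1 -> [/\ is_part y.2, sumn y.2 = n & qsum y.2 = R].
  move=> /mapP[s]; rewrite mem_filter mem_parts => /andP[/eqP qs /andP[ps /eqP ns]] ->.
  by [].
pose B := flatten [seq pscale K y.1 (J y.2) | y <- S1].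
have hB : homogeneous K n B.
  apply: homog_flatten => y /S1P[p_y n_y _]; apply: homog_scale.
  by rewrite -n_y J_homog.
have [|tau p_tau n_tau|S2 [S2P E]] := IH (A ++ pscale K (-1) B).
- by rewrite homog_cat hA homog_scale.
- rewrite mono_coef_cat mono_coef_scale mulN1r mono_coef_flatten big_map big_filter.
  under eq_bigr do rewrite mono_coef_scale /=.
  rewrite ltnNge => nz; apply/negP => le_R; case/negP: nz; apply/eqP.
  have [q_tau|lt_R] := eqVneq (qsum tau) R; last first.
    have {lt_R}lt_R : (R < qsum tau)%N by rewrite ltn_neqAle eq_sym lt_R.
    have -> : mono_coef A tau = 0.
      apply/eqP; apply: contraT => /(suppA tau p_tau n_tau).
      by rewrite ltnNge lt_R.
    rewrite big1_seq ?subr0 // => s /andP[/eqP qs]; rewrite mem_parts => /andP[ps _].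
    have [->|/(u_qsum _ _ ps)[sE|]] := eqVneq (u s tau) 0; first by rewrite mulr0.
      by move: lt_R; rewrite -qs -sE qsum_nrm ltnn.
    by rewrite qs ltnNge (ltnW lt_R).
  rewrite -big_filter (bigD1_seq tau) ?filter_uniq ?undup_uniq //=; last first.
    by rewrite mem_filter q_tau eqxx mem_parts p_tau n_tau eqxx.
  rewrite J_lead // divfK ?H_neq0 // big_filter_cond big1_seq ?addr0 ?subrr //.
  move=> s /andP[/andP[/eqP qs ne]]; rewrite mem_parts => /andP[ps _].
  have [->|/(u_qsum _ _ ps)[sE|]] := eqVneq (u s tau) 0; first by rewrite mulr0.
    case/negP: ne; rewrite -sE; apply/eqP; apply: sorted_geq_eq.
    - by case/andP: (nrm_part tau).
    - by case/andP: p_tau.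
    apply: perm_trans (perm_nrm _) _.
    by have /all_filterP -> : all (fun x => 0 < x)%N tau by case/andP: p_tau.
  by rewrite qs q_tau ltnn.
exists (S1 ++ S2); split=> [y|rho].
  rewrite mem_cat => /orP[/S1P[p_y n_y ->]|/S2P[p_y n_y lt]]; split=> //.
  exact: ltnW.
by rewrite -(E rho) /pscale map_cat flatten_cat map_cat catA.
Qed.

Lemma span_jack_form n (A : psum) R : homogeneous K n A ->
  (forall tau, is_part tau -> sumn tau = n -> mono_coef A tau != 0 -> (qsum tau < R)%N) ->
  forall D, (forall mu, is_part mu -> sumn mu = n -> (qsum mu < R)%N -> jack_form (J mu) D = 0) ->
  jack_form A D = 0.
Proof.
move=> hA sA D JD; have [S [SP E]] := span n A R hA sA.
have := jack_form_pcoef0 K al _ D E.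
rewrite jack_form_cat jack_form_scale mulN1r jack_form_flatten => /eqP; rewrite subr_eq0 => /eqP ->.
by rewrite big1_seq // => y /SP[p_y n_y q_y]; rewrite jack_form_scale JD ?mulr0.
Qed.

Lemma qsum_le s : (qsum s <= sumn s ^ 2)%N.
Proof.
elim: s => //= x s IH; rewrite /qsum /= -/(qsum s).
by apply: leq_trans (leq_add (leqnn _) IH) _; rewrite sqrnD leq_addr.
Qed.

Lemma top_value (g : seq nat -> K) tau m :
  (forall s t, perm_eq [seq x <- s | 0 < x]%N [seq x <- t | 0 < x]%N -> g s = g t) ->
  (forall s, (qsum tau < qsum s)%N -> g s = 0) -> all (fun x => 0 < x)%N tau ->
  iter m lax (fun b s => g (b :: s)) 0%N tau = g tau * eigval tau m 0.
Proof.
move=> g_inv g_supp /all_filterP tauE; apply: iter_block => [b s|b s|].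
- by rewrite add0n => lt; apply: g_supp.
- by move=> bs; apply: g_inv; rewrite tauE.
by rewrite /= tauE.
Qed.

Lemma mono_coef_inv n (A : psum) s t : homogeneous K n A ->
  perm_eq [seq x <- s | 0 < x]%N [seq x <- t | 0 < x]%N -> mono_coef A s = mono_coef A t.
Proof.
move=> hA st; rewrite -(mono_coef_filter n A s) // -(mono_coef_filter n A t) //.
exact: mono_coef_perm.
Qed.

Lemma u_supp la s : is_part la -> (qsum la < qsum s)%N -> u la s = 0.
Proof.
move=> p_la lt; apply/eqP; apply: contraT => /(u_qsum _ _ p_la)[sE|lt'].
  by rewrite -sE qsum_nrm ltnn in lt.
by rewrite ltnNge ltnW in lt.
Qed.

Lemma nrm_id s : is_part s -> nrm s = s.
Proof.
move=> p_s; apply: sorted_geq_eq; first by case/andP: (nrm_part s).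
  by case/andP: p_s.
by apply: perm_trans (perm_nrm _) _; have /andP[_ /all_filterP ->] := p_s.
Qed.

Lemma wpow_supp la m tau : is_part la -> mono_coef (wpow K al m (J la)) tau != 0 ->
  (qsum tau <= qsum la)%N.
Proof.
move=> p_la; rewrite (mono_coef_wpow K al (sumn la)) ?J_homog // leqNgt.
have hs : supp K (qsum la) 0 (fun b s => u la (b :: s)).
  by move=> b s; rewrite add0n => lt; apply: u_supp.
by apply: contra => lt; apply/eqP; apply: (iter_lax_supp K al _ m _ hs 0%N tau).
Qed.

(** C, the operator minus its expected eigenvalue applied to J_la, lies strictly below la by
    [top_value]. It is orthogonal to each J_mu: if mu is not below la, because C is spanned by
    functions J_nu below la; if mu is below, because the operator moves to J_mu and stays at or
    below mu. Nondegeneracy gives C = 0. *)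
Lemma jack_eigen la m s : is_part la ->
  iter m lax (fun b t => u la (b :: t)) 0%N s = eigval la m 0 * u la s.
Proof.
move=> p_la; pose n := sumn la; have hJ := J_homog _ p_la.
pose B := wpow K al m (J la); have hB : homogeneous K n B by apply: wpow_homog.
rewrite -(mono_coef_wpow K al n) // -/B.
pose C := B ++ pscale K (- eigval la m 0) (J la).
have hC : homogeneous K n C by rewrite homog_cat hB homog_scale.
suff C0 : forall rho, pcoef K C rho = 0.
  have : mono_coef C s = 0 by apply: (pcoef0_sum K C (fun rho => (pm_coef rho s)%:R)).
  by rewrite mono_coef_cat mono_coef_scale mulNr => /eqP; rewrite subr_eq0 => /eqP.
have C_supp tau : is_part tau -> sumn tau = n -> mono_coef C tau != 0 -> (qsum tau < qsum la)%N.
  move=> p_tau n_tau; apply: contraR; rewrite -leqNgt => le_q.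
  rewrite mono_coef_cat mono_coef_scale /B (mono_coef_wpow K al n) // top_value.
  - have [->|/(u_qsum _ _ p_la)[|lt]] := eqVneq (u la tau) 0.
    + by rewrite mul0r mulr0 addr0.
    + by rewrite nrm_id // => ->; rewrite mulNr mulrC subrr.
    by rewrite ltnNge le_q in lt.
  - by move=> x y; apply: (mono_coef_inv n).
  - by move=> x lt; apply: u_supp => //; apply: leq_ltn_trans lt.
  by case/andP: p_tau.
have CJ mu : is_part mu -> sumn mu = n -> jack_form C (J mu) = 0.
  move=> p_mu n_mu; case: (ltnP (qsum mu) (qsum la)) => [lt|le]; last first.
    apply: (span_jack_form n C (qsum la) hC C_supp) => nu p_nu n_nu lt; apply: J_orth => //.
    by apply: contraTneq lt => <-; rewrite -leqNgt.
  have ne_mu : mu != la by apply: contraTneq lt => ->; rewrite ltnn.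
  have hM : homogeneous K n (J mu) by rewrite -n_mu J_homog.
  rewrite jack_form_cat jack_form_scale J_orth // mulr0 addr0 (jack_form_wpow K al n) //.
  rewrite jack_form_sym; apply: (span_jack_form n _ (qsum la)); first exact: wpow_homog.
    by move=> tau p_tau n_tau /(wpow_supp _ _ _ p_mu) le; apply: leq_ltn_trans le lt.
  move=> nu p_nu n_nu lt'; apply: J_orth => //.
  by apply: contraTneq lt' => <-; rewrite ltnn.
apply: (jack_form_nondeg K al al_lin n) => // D hD; rewrite jack_form_sym.
apply: (span_jack_form n D (n ^ 2).+1 hD) => [tau _ n_tau _|mu p_mu n_mu _].
  by rewrite ltnS -n_tau qsum_le.
by rewrite jack_form_sym CJ.
Qed.

End JackFamily.

(** * Eigenvalue equations independent of the size *)

Section HopLemmas.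

Variable K : fieldType.
Local Notation hop := (hop K).

Lemma eq_hop_deg h1 h2 b s :
  (forall x t, (x + sumn t = b + sumn s)%N -> h1 x t = h2 x t) ->
  hop h1 b s = hop h2 b s.
Proof.
elim: s h1 h2 => //= c s IH h1 h2 E; congr (_ + _).
  apply: eq_bigr => i _; congr (_ - _); apply: E => /=; have := ltn_ord i; lia.
by apply: IH => x t xt; apply: E => /=; lia.
Qed.

Lemma hop_cat h b s1 s2 :
  hop h b (s1 ++ s2)
  = hop (fun x t => h x (t ++ s2)) b s1 + hop (fun x t => h x (s1 ++ t)) b s2.
Proof.
elim: s1 h => [|c s1 IH] h /=; first by rewrite add0r.
by rewrite IH addrA.
Qed.

Lemma hop_ones h b t : sinv K h -> zinv K h ->
  hop h b (nseq t 1%N)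
  = t%:R * (h b.+1 (nseq t.-1 1%N) - h 0%N (b.+1 :: nseq t.-1 1%N)).
Proof.
elim: t h => [|t IH] h hs hz; first by rewrite mul0r.
rewrite /= /hop2 big_ord1 subn0 addn1 (hz _ [::]) IH; first last.
- by move=> x s1 s2; apply: (hz x (1%N :: s1)).
- by move=> x s1 y z s2; apply: (hs x (1%N :: s1)).
case: t {IH} => [|t]; first by rewrite mul0r addr0 mul1r.
by rewrite /= (hs 0%N [::] 1%N) -[t.+2%:R]nat1r; ring.
Qed.

Lemma hop_sym (g : seq nat -> K) b s :
  (forall s t, perm_eq s t -> g s = g t) -> hop (fun x t => g (x :: t)) b s = 0.
Proof.
elim: s g => //= c s IH g hg; rewrite /hop2 big1 ?add0r => [|i _].
  rewrite -[RHS](IH (fun t => g (c :: t))) => [|s1 t1 st].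
    by apply: eq_hop => x t; apply: hg; rewrite -(cat1s x) -(cat1s c) perm_catCA.
  by apply: hg; rewrite perm_cons.
apply/eqP; rewrite subr_eq0; apply/eqP/hg.
by apply/seq.permP => p /=; rewrite addnCA.
Qed.

End HopLemmas.

Section Universal.

Variables (K : fieldType) (al : K).
Hypothesis al_lin : forall a b : int, a%:~R + b%:~R * al = 0 -> a = 0 /\ b = 0.
Local Notation lax := (lax K al).
Local Notation hop := (hop K).
Local Notation eigval := (eigval K al).

Variables (u : seq nat -> seq nat -> K).
Hypothesis u_inv : forall la s t, is_part la ->
  perm_eq [seq x <- s | 0 < x]%N [seq x <- t | 0 < x]%N -> u la s = u la t.
Hypothesis u_eigen : forall la m s, is_part la ->
  iter m lax (fun b t => u la (b :: t)) 0%N s = eigval la m 0 * u la s.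

(* [Ko la mu] is Ko_mu(la), and [Ko_lax] is its analogue for [lax ^ m]. *)
Definition Ko (la s : seq nat) : K :=
  if (sumn s <= sumn la)%N then
    u la (s ++ nseq (sumn la - sumn s) 1%N) / (sumn la - sumn s)`!%:R
  else 0.

Definition Ko_lax (m : nat) (la : seq nat) (b : nat) (s : seq nat) : K :=
  if (b + sumn s <= sumn la)%N then
    iter m lax (fun b t => u la (b :: t)) b (s ++ nseq (sumn la - (b + sumn s)) 1%N)
      / (sumn la - (b + sumn s))`!%:R
  else 0.

(** The factors 1 - s_0i kill a symmetric function, so the first application of [lax] consumes no
    part 1. This is the origin of [m.-1] in the degree bounds below. *)
Lemma uhm1 la b s : is_part la -> Ko_lax 1 la b s = al * b%:R * Ko la (b :: s).
Proof.
move=> p_la; rewrite /Ko_lax /Ko /=; case: ifP => _; last by rewrite mulr0.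
rewrite /lax hop_sym ?addr0 ?mulrA // => x y xy.
by apply: u_inv => //; apply: perm_filter.
Qed.

Lemma u_sinv m la : is_part la -> sinv K (iter m lax (fun b t => u la (b :: t))).
Proof.
move=> p_la; apply: iter_lax_sinv => b s1 x y s2; apply: u_inv => //.
by apply: perm_filter; apply/seq.permP => p; rewrite /= !count_cat /=; lia.
Qed.

Lemma u_zinv m la : is_part la -> zinv K (iter m lax (fun b t => u la (b :: t))).
Proof.
move=> p_la; apply: iter_lax_zinv => b s1 s2; apply: u_inv => //.
by rewrite -!cat_cons !filter_cat /= perm_refl.
Qed.

(** The T appended ones are interchangeable and contribute a factor T by [hop_ones]. It turns 1/T!
    into 1/(T-1)!, the normalization for one appended 1 fewer, so the size of la disappears from the
    relation. *)
Lemma Ko_lax_rec m la b s : is_part la ->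
  Ko_lax m.+1 la b s = al * b%:R * Ko_lax m la b s + hop (Ko_lax m la) b s
                    + Ko_lax m la b.+1 s - Ko_lax m la 0 (s ++ [:: b.+1]).
Proof.
move=> p_la; set n := sumn la.
have sE : sumn (s ++ [:: b.+1]) = (b.+1 + sumn s)%N by rewrite sumn_cat /= addn0 addnC.
case: (leqP (b + sumn s) n) => [le|lt]; last first.
  have -> : hop (Ko_lax m la) b s = 0.
    rewrite -[RHS](hop_zero K b s); apply: eq_hop_deg => x t xt.
    by rewrite /Ko_lax xt leqNgt -/n lt.
  rewrite /Ko_lax !sE add0n -/n.
  have -> : (b + sumn s <= n)%N = false by lia.
  have -> : (b.+1 + sumn s <= n)%N = false by lia.
  by rewrite mulr0 !addr0 subr0.
set T := (n - (b + sumn s))%N.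
pose h := iter m lax (fun b t => u la (b :: t)).
have hopE : hop (fun x t => h x (t ++ nseq T 1%N)) b s / T`!%:R = hop (Ko_lax m la) b s.
  transitivity (hop (fun x t => T`!%:R^-1 * h x (t ++ nseq T 1%N) + 0) b s).
    by rewrite hop_linear hop_zero addr0 mulrC.
  apply: eq_hop_deg => x t xt.
  by rewrite /Ko_lax xt -/n le -/T addr0 mulrC.
have [hs hz] := (u_sinv m la p_la, u_zinv m la p_la).
rewrite [LHS]/Ko_lax -/n le -/T [iter _ _ _]/= -/h /lax mulrDl hop_cat mulrDl hopE.
rewrite -!addrA; congr (_ + (_ + _)).
  by rewrite [in RHS]/Ko_lax -/n le -/T -/h mulrA.
rewrite hop_ones; first last.
- by move=> x s1 s2; rewrite !catA; apply: hz.
- by move=> x s1 y z s2; rewrite !catA; apply: hs.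
rewrite /Ko_lax sE add0n -/n -/h; case: (leqP (b.+1 + sumn s) n) => [lt|ge]; last first.
  (* No 1 is left to consume; the right side agrees through the zero convention in [Ko_lax]. *)
  have -> : T = 0%N by rewrite /T; lia.
  by rewrite !mul0r subr0.
have TE : T = (n - (b + sumn s).+1).+1 by rewrite /T; lia.
rewrite [_ ++ [:: _]]cats1 cat_rcons TE /= -mulrBl factS natrM; field.
by rewrite (al_fact_neq0 K al) // nat1r (al_natr_eq0 K al).
Qed.

(** The bound N on the number of rows is kept because passing from eigenvalues to functions of N
    contents involves N itself, see [rowsum_full]. *)
Definition rep (N k : nat) (g : seq nat -> K) : Prop :=
  exists F : seq (K * seq nat), all (fun x => sumn x.2 <= k)%N F /\
    forall la, is_part la -> (size la <= N)%N -> g la = \sum_(x <- F) x.1 * Ko la x.2.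

Lemma eq_rep N k g1 g2 : (forall la, is_part la -> (size la <= N)%N -> g1 la = g2 la) ->
  rep N k g2 -> rep N k g1.
Proof. by move=> E [F [F_k gF]]; exists F; split=> // la p_la le; rewrite E ?gF. Qed.

Lemma rep_le N k1 k2 g : (k1 <= k2)%N -> rep N k1 g -> rep N k2 g.
Proof.
move=> le [F [/allP F_k gF]]; exists F; split=> //.
by apply/allP => x /F_k le1; apply: leq_trans le1 le.
Qed.

Lemma rep0 N k : rep N k (fun _ => 0).
Proof. by exists [::]; split=> // la _ _; rewrite big_nil. Qed.

Lemma rep_Ko N k s : (sumn s <= k)%N -> rep N k (fun la => Ko la s).
Proof.
by move=> le; exists [:: (1, s)]; rewrite /= le; split=> // la _ _; rewrite big_seq1 mul1r.
Qed.

Lemma rep_lin N k a g1 g2 : rep N k g1 -> rep N k g2 -> rep N k (fun la => a * g1 la + g2 la).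
Proof.
move=> [F1 [F1k g1F]] [F2 [F2k g2F]]; exists ([seq (a * x.1, x.2) | x <- F1] ++ F2).
rewrite all_cat all_map F2k andbT; split; first by apply: sub_all F1k => x.
move=> la p_la le; rewrite big_cat big_map g1F // g2F // mulr_sumr; congr (_ + _).
by apply: eq_bigr => x _; rewrite mulrA.
Qed.

Lemma rep_scale N k a g : rep N k g -> rep N k (fun la => a * g la).
Proof.
move=> gk; apply: eq_rep (rep_lin _ _ a _ _ gk (rep0 N k)) => la _ _.
by rewrite addr0.
Qed.

Lemma rep_add N k g1 g2 : rep N k g1 -> rep N k g2 -> rep N k (fun la => g1 la + g2 la).
Proof.
move=> r1 r2; apply: eq_rep (rep_lin _ _ 1 _ _ r1 r2) => la _ _.
by rewrite mul1r.
Qed.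

Lemma rep_sum (I : eqType) (r : seq I) N k (g : I -> seq nat -> K) :
  (forall i, i \in r -> rep N k (g i)) -> rep N k (fun la => \sum_(i <- r) g i la).
Proof.
elim: r => [|i r IH] H.
  by apply: eq_rep (rep0 N k) => la _ _; rewrite big_nil.
apply: eq_rep (rep_add _ _ _ _ (H i (mem_head _ _)) (IH _)) => [la _ _|j j_r].
  by rewrite big_cons.
by apply: H; rewrite inE j_r orbT.
Qed.

Lemma rep_hop N k (h : seq nat -> nat -> seq nat -> K) b s :
  (forall x t, (x + sumn t = b + sumn s)%N -> rep N k (fun la => h la x t)) ->
  rep N k (fun la => hop (h la) b s).
Proof.
elim: s h => [|c s IH] h H /=; first exact: rep0.
apply: rep_add; last first.
  by apply: (IH (fun la x t => h la x (c :: t))) => x t xt; apply: H => /=; lia.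
apply: rep_sum => i _; have lt := ltn_ord i; rewrite /=.
apply: eq_rep (rep_lin _ _ (-1) _ _ (H i ((b + c - i)%N :: s) _)
                 (H (b + c - i)%N (nat_of_ord i :: s) _)) => [la _ _||] /=; try lia.
by rewrite mulN1r addrC.
Qed.

Lemma rep_Ko_lax N m b s : rep N (b + sumn s + m.-1) (fun la => Ko_lax m la b s).
Proof.
case: m => [|m]; first by rewrite addn0; apply: (rep_Ko N _ (b :: s)).
elim: m b s => [|m IH] b s.
  rewrite addn0; apply: eq_rep (rep_scale _ _ (al * b%:R) _ (rep_Ko N _ (b :: s) _)) => //.
  by move=> la p_la _; rewrite uhm1.
have IH' x t : (x + sumn t <= (b + sumn s).+1)%N ->
    rep N (b + sumn s + m.+1) (fun la => Ko_lax m.+1 la x t).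
  by move=> le; apply: rep_le (IH x t); rewrite addnS -addSn leq_add2r.
apply: (eq_rep _ _ _ (fun la => al * b%:R * Ko_lax m.+1 la b s +
   (hop (Ko_lax m.+1 la) b s + (Ko_lax m.+1 la b.+1 s + -1 * Ko_lax m.+1 la 0 (s ++ [:: b.+1]))))).
  by move=> la p_la _; rewrite Ko_lax_rec // mulN1r !addrA.
apply: rep_lin; first by apply: IH'.
apply: rep_add; first by apply: rep_hop => x t xt; apply: IH'; rewrite xt.
apply: rep_add; first by apply: IH'.
by apply: rep_scale; apply: IH'; rewrite sumn_cat /=; lia.
Qed.

(** [Ko_lax m la 0 s] is read in two ways: by the eigenvalue equation, and by unfolding the operator
    as in [rep_Ko_lax]. *)
Lemma rep_eigen N k m g : rep N k g -> rep N (k + m.-1) (fun la => eigval la m 0 * g la).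
Proof.
move=> [F [/allP F_k gF]].
apply: (eq_rep _ _ _ (fun la => \sum_(x <- F) x.1 * Ko_lax m la 0 x.2)) => [la p_la le|].
  rewrite gF // mulr_sumr; apply: eq_bigr => x _; rewrite mulrCA; congr (_ * _).
  rewrite /Ko_lax /Ko add0n; case: ifP => _; last by rewrite mulr0.
  by rewrite u_eigen // mulrA.
apply: rep_sum => x /F_k le; apply: rep_scale.
by apply: rep_le (rep_Ko_lax N m 0 x.2); rewrite add0n leq_add2r.
Qed.

End Universal.

(** * From eigenvalues to symmetric functions of the contents *)

Definition elsym (R : pzSemiRingType) (n : nat) (y : 'I_n -> R) (b : nat) : R :=
  \sum_(h : {set 'I_n} | #|h| == b) \prod_(i in h) y i.

Lemma prod_elsym (R : comNzRingType) n (y : 'I_n -> R) (a c : R) :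
  \prod_(i < n) (a - y i * c)
  = \sum_(b < n.+1) (-1) ^+ b * elsym R n y b * (a ^+ (n - b) * c ^+ b).
Proof.
under eq_bigr do rewrite addrC.
rewrite bigA_distr (partition_big (fun J : {set 'I_n} => inord #|J| : 'I_n.+1) predT) //=.
apply: eq_bigr => b _; rewrite /elsym mulr_sumr mulr_suml.
have card_lt (J : {set 'I_n}) : (#|J| < n.+1)%N.
  by rewrite ltnS -[X in (_ <= X)%N]card_ord max_card.
apply: eq_big => [J|J]; first by rewrite -val_eqE /= inordK.
rewrite -val_eqE /= inordK // => /eqP <-.
rewrite (bigID (mem J)) /= (eq_bigr (fun i => -1 * y i * c)) => [|i ->]; last first.
  by rewrite mulN1r mulNr.
rewrite !big_split /= !prodr_const -!mulrA; congr (_ * (_ * _)).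
rewrite mulrC; congr (_ * _).
rewrite (eq_bigr (fun=> a)) => [|i /negPf -> //].
rewrite (eq_bigl (fun i => i \in ~: J)) => [|i]; last by rewrite inE.
rewrite prodr_const; congr (_ ^+ _); have := cardsC J; rewrite card_ord => nE.
by rewrite -[X in (X - _)%N]nE addKn.
Qed.

Section Generating.

Variables (K : fieldType).

Lemma coef_1X n k : ((1 + 'X : {poly K}) ^+ n)`_k = 'C(n, k)%:R.
Proof.
elim: n k => [|n IH] k; first by rewrite expr0 coef1 bin0n.
rewrite exprS mulrDl mul1r coefD coefXM !IH.
by case: k => [|k] /=; rewrite ?bin0 ?addr0 // binS natrD.
Qed.

Variables (al : K).
Local Notation eigval := (eigval K al).

Section OnePartition.

Variable la : seq nat.
Hypothesis p_la : is_part la.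

Definition contents (i : nat) : K := al * (nth 0%N la i)%:R - i%:R.
Local Notation y := contents.

(** Earlier rows of the same length contribute zero, so the sum over longer rows may run over all i
    earlier rows; their number turns al la_i into the content al la_i - i. *)
Lemma eigval_row m i :
  eigval la m.+1 (nth 0%N la i)
  = y i * eigval la m (nth 0%N la i) + \sum_(j < i) eigval la m (nth 0%N la j).
Proof.
set b := nth 0%N la i; set F := eigval la m.
rewrite /= -/F.
have -> : \sum_(c <- la | (b < c)%N) (F c - F b) = \sum_(j < i) (F (nth 0%N la j) - F b).
  have [s_la _] := andP p_la.
  have le_nth j k : (j <= k)%N -> (nth 0 la k <= nth 0 la j)%N.
    move=> le_jk; have [lt|ge] := ltnP k (size la); last by rewrite nth_default.
    apply: (sorted_leq_nth (rev_trans leq_trans) leqnn) => //.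
    by rewrite inE; apply: leq_ltn_trans le_jk lt.
  pose G c := if (b < c)%N then F c - F b else 0.
  have E s M : (size s <= M)%N -> \sum_(c <- s | (b < c)%N) (F c - F b) = \sum_(j < M) G (nth 0%N s j).
    elim: s M => [|c s IH] M; first by rewrite big_nil big1 // => j _; rewrite nth_nil.
    by case: M => // M /(IH M) IHs; rewrite big_cons big_ord_recl -IHs /G /=; case: ifP; rewrite ?add0r.
  pose M := maxn (size la) i; rewrite (E la M) ?leq_maxl //.
  rewrite (big_ord_widen M (fun j => F (nth 0%N la j) - F b)) ?leq_maxr //.
  rewrite [RHS]big_mkcond; apply: eq_bigr => j _; rewrite /G.
  case: (ltnP j i) => [lt|ge]; last by rewrite ltnNge /b le_nth.
  case: ltnP => // le; have -> : nth 0%N la j = b.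
    by apply/eqP; rewrite eqn_leq le le_nth // ltnW.
  by rewrite subrr.
rewrite sumrB sumr_const card_ord /y -/b -mulr_natl; ring.
Qed.

(* [rowsum_gen]: the generating series of [rowsum N] is a product over the contents,
   so the eigenvalues determine the elementary symmetric functions of the contents. *)
Definition rowsum (i m : nat) : K :=
  if m is m'.+1 then \sum_(j < i) eigval la m' (nth 0%N la j) else 1.

(** Coefficient form of (1 - y_i X) S_(i+1) = (1 + X - y_i X) S_i for the generating series S_i. *)
Lemma rowsum_rec i m : rowsum i.+1 m.+1 - y i * rowsum i.+1 m = rowsum i m.+1 + (1 - y i) * rowsum i m.
Proof.
rewrite [rowsum i.+1 m.+1]big_ord_recr /=; case: m => [|m].
  by rewrite /=; ring.
by rewrite eigval_row /= big_ord_recr /=; ring.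
Qed.

(** This is [eigval_row] at the empty row of index N, whose content is -N. *)
Lemma rowsum_full m N : (size la <= N)%N -> rowsum N m.+1 = eigval la m.+1 0 + N%:R * eigval la m 0.
Proof.
move=> le; have := eigval_row m N; rewrite nth_default // => ->.
by rewrite /rowsum /y nth_default //; ring.
Qed.

Lemma rowsum_gen M N m : (m < M)%N ->
  (\prod_(j < N) (1 - (y j)%:P * 'X) * \poly_(k < M) rowsum N k)`_m
  = (\prod_(j < N) (1 + 'X - (y j)%:P * 'X))`_m.
Proof.
have cong_mul (r p q : {poly K}) : (forall k, (k < M)%N -> p`_k = q`_k) ->
    forall k, (k < M)%N -> (r * p)`_k = (r * q)`_k.
  move=> pq k lt; rewrite !coefM; apply: eq_bigr => i _; congr (_ * _).
  by apply: pq; apply: leq_ltn_trans lt; apply: leq_subr.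
elim: N m => [|N IH] m lt_m.
  rewrite !big_ord0 mul1r coef_poly lt_m coef1 /rowsum.
  by case: m lt_m => //= m _; rewrite big_ord0.
rewrite !big_ord_recr /= -mulrA.
have step k : (k < M)%N -> ((1 - (y N)%:P * 'X) * \poly_(k < M) rowsum N.+1 k)`_k
    = ((1 + 'X - (y N)%:P * 'X) * \poly_(k < M) rowsum N k)`_k.
  move=> lt; rewrite !mulrBl !mulrDl !mul1r !coefB !coefD -!mulrA !coefCM !coefXM !coef_poly lt.
  case: k lt => [|k] lt /=; first by rewrite !mulr0 addr0.
  by rewrite (ltnW lt) [LHS]rowsum_rec /=; ring.
rewrite (cong_mul _ _ _ step) // mulrCA [in RHS]mulrC.
by apply: cong_mul.
Qed.

(** Newton-type recursion from the coefficient of X^(j+1) in [rowsum_gen]. The terms b = j + 1 agree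
    on both sides; the terms b = j carry N and N - j, and their difference isolates j e_j. *)
Lemma elsym_rec N j : (size la <= N)%N -> (j <= N)%N ->
  let e := elsym K N (fun i => y i) in
  j%:R * (-1) ^+ j * e j
  = \sum_(b < j) (-1) ^+ b * e b * ('C(N - b, j.+1 - b)%:R - rowsum N (j.+1 - b)).
Proof.
move=> le_la le_j e.
have e_big b : (N < b)%N -> e b = 0.
  move=> lt; rewrite /e /elsym big_pred0 // => h; apply/negbTE.
  by rewrite neq_ltn (leq_ltn_trans _ lt) // -[X in (_ <= X)%N]card_ord max_card.
have LE : \prod_(j < N) (1 - (y j)%:P * 'X) = \poly_(b < N.+1) ((-1) ^+ b * e b) :> {poly K}.
  have := prod_elsym {poly K} N (fun i => (y i)%:P) 1 'X; rewrite /= => ->.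
  rewrite poly_def; apply: eq_bigr => b _; rewrite expr1n mul1r -mul_polyC; congr (_ * _).
  rewrite rmorphM rmorphXn rmorphN1 /=; congr (_ * _).
  by rewrite /e /elsym rmorph_sum; apply: eq_bigr => h _; rewrite rmorph_prod.
have RE : \prod_(j < N) (1 + 'X - (y j)%:P * 'X)
     = \sum_(b < N.+1) ((-1) ^+ b * e b)%:P * ((1 + 'X) ^+ (N - b) * 'X^b) :> {poly K}.
  have := prod_elsym {poly K} N (fun i => (y i)%:P) (1 + 'X) 'X; rewrite /= => ->.
  apply: eq_bigr => b _; congr (_ * _).
  rewrite rmorphM rmorphXn rmorphN1 /=; congr (_ * _).
  by rewrite /e /elsym rmorph_sum; apply: eq_bigr => h _; rewrite rmorph_prod.
have := rowsum_gen j.+2 N j.+1 (ltnSn _); rewrite LE RE coefM coef_sum.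
pose L b := (-1) ^+ b * e b * rowsum N (j.+1 - b).
pose Q b := (-1) ^+ b * e b * 'C(N - b, j.+1 - b)%:R.
have -> : \sum_(b < j.+2) (\poly_(b < N.+1) ((-1) ^+ b * e b))`_b * (\poly_(k < j.+2) rowsum N k)`_(j.+1 - b)
     = \sum_(b < j.+2) L b.
  apply: eq_bigr => b _; rewrite !coef_poly /L.
  have -> : (j.+1 - b < j.+2)%N by rewrite ltnS leq_subr.
  by case: ltnP => // lt; rewrite e_big // mulr0.
have -> : \sum_(b < N.+1) (((-1) ^+ b * e b)%:P * ((1 + 'X) ^+ (N - b) * 'X^b))`_j.+1
     = \sum_(b < j.+2) Q b.
  (* [e b] vanishes for b > N and the coefficient for b > j + 1, so both ranges extend to a common
     one. *)
  pose Q' b := if (b <= j.+1)%N then Q b else 0.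
  transitivity (\sum_(b < maxn N.+1 j.+2) Q' b).
    rewrite (big_ord_widen (maxn N.+1 j.+2) (fun b => (((-1) ^+ b * e b)%:P * ((1 + 'X) ^+ (N - b) * 'X^b))`_j.+1)) ?leq_maxl //.
    rewrite big_mkcond; apply: eq_bigr => b _; rewrite /Q' /Q; case: ltnP => [_|lt]; last first.
      by rewrite e_big // mulr0 mul0r if_same.
    rewrite coefCM coefMXn ltnNge; case: leqP => _ /=; first by rewrite coef_1X.
    by rewrite mulr0.
  rewrite (big_ord_widen (maxn N.+1 j.+2) Q) ?leq_maxr // [RHS]big_mkcond.
  by apply: eq_bigr => b _; rewrite /Q' ltnS.
have -> : \sum_(b < j.+2) L b = \sum_(b < j) L b + (-1) ^+ j * e j * N%:R + Q j.+1.
  rewrite !big_ord_recr /=; congr (_ + _ + _); last by rewrite /L /Q subnn bin0.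
  by rewrite /L subSnn /rowsum sumr_const card_ord.
have -> : \sum_(b < j.+2) Q b
     = \sum_(b < j) Q b + (-1) ^+ j * e j * (N%:R - j%:R) + Q j.+1.
  rewrite !big_ord_recr /=; congr (_ + _ + _).
  by rewrite /Q subSnn bin1 natrB.
move=> /addIr E.
transitivity (\sum_(b < j) Q b - \sum_(b < j) L b); last first.
  by rewrite -sumrB; apply: eq_bigr => b _; rewrite mulrBr.
have -> : \sum_(b < j) Q b = \sum_(b < j) L b + (-1) ^+ j * e j * N%:R
    - (-1) ^+ j * e j * (N%:R - j%:R) by rewrite E addrK.
ring.
Qed.

End OnePartition.
End Generating.

Lemma meval_mesym (R : comNzRingType) n k (v : 'I_n -> R) :
  (mesym n R k).@[v] = elsym R n v k.
Proof.
rewrite mesymE raddf_sum /=; apply: eq_bigr => h _.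
rewrite mevalX [RHS]big_mkcond; apply: eq_bigr => i _.
by rewrite mnmE; case: (i \in h); rewrite ?expr1 ?expr0.
Qed.

(** * Symmetric functions of the contents acting on the Ko_mu *)

Section Density.

Variables (K : fieldType) (al : K).
Hypothesis al_lin : forall a b : int, a%:~R + b%:~R * al = 0 -> a = 0 /\ b = 0.
Local Notation eigval := (eigval K al).

Variables (u : seq nat -> seq nat -> K).
Hypothesis u_inv : forall la s t, is_part la ->
  perm_eq [seq x <- s | 0 < x]%N [seq x <- t | 0 < x]%N -> u la s = u la t.
Hypothesis u_eigen : forall la m s, is_part la ->
  iter m (lax K al) (fun b t => u la (b :: t)) 0%N s = eigval la m 0 * u la s.
Local Notation rep := (rep K u).
Local Notation Ko := (Ko K u).

Definition elsym_contents N la : nat -> K := elsym K N (fun i => contents K al la i).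

(** The degrees fit exactly: e_b costs b by induction, and the eigenvalue of order j + 1 - b costs j
    - b more. *)
Lemma rep_elsym N k j g : (j <= N)%N -> rep N k g ->
  rep N (k + j) (fun la => elsym_contents N la j * g la).
Proof.
elim/ltn_ind: j k g => j IH k g le_jN gk.
have [j0|j0] := posnP j.
  rewrite j0 addn0; apply: eq_rep gk => la _ _.
  rewrite /elsym_contents /elsym (big_pred1 set0) => [|h]; last by rewrite cards_eq0.
  by rewrite big_set0 mul1r.
have [j_neq0 sgn_neq0] : j%:R != 0 :> K /\ (-1) ^+ j != 0 :> K.
  by rewrite (al_natr_eq0 K al) // -lt0n j0 signr_eq0.
pose f la := \sum_(b <- enum 'I_j) ((-1) ^+ b * 'C(N - b, j.+1 - b)%:R * (elsym_contents N la b * g la)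
  + - (-1) ^+ b * (eigval la (j.+1 - b) 0 * (elsym_contents N la b * g la)
     + N%:R * (eigval la (j - b) 0 * (elsym_contents N la b * g la)))).
apply: (eq_rep _ _ _ _ _ (fun la => (j%:R * (-1) ^+ j)^-1 * f la)) => [la p_la le|].
  have -> : f la = j%:R * (-1) ^+ j * elsym_contents N la j * g la.
    rewrite (elsym_rec K al la p_la N j le le_jN) mulr_suml /f -[RHS]big_enum /=.
    apply: eq_bigr => b _; rewrite (subSn (ltnW (ltn_ord b))) rowsum_full // /elsym_contents; ring.
  by field; rewrite sgn_neq0 j_neq0.
apply: rep_scale; apply: rep_sum => b _.
have lt_b := ltn_ord b.
have eb : rep N (k + b) (fun la => elsym_contents N la b * g la).
  by apply: IH => //; apply: leq_trans (ltnW lt_b) le_jN.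
apply: rep_lin; first by apply: rep_le eb; rewrite leq_add2l ltnW.
apply: rep_scale; apply: rep_add.
  apply: (rep_le _ _ _ (k + b + (j.+1 - b).-1)%N); first by lia.
  exact: (rep_eigen K al al_lin u u_inv u_eigen).
apply: rep_scale; apply: (rep_le _ _ _ (k + b + (j - b).-1)%N); first by lia.
exact: (rep_eigen K al al_lin u u_inv u_eigen).
Qed.

Lemma rep_prod_elsym N k (r : seq 'I_N) (m : 'I_N -> nat) g : rep N k g ->
  rep N (k + \sum_(i <- r) m i * i.+1)%N
    (fun la => \prod_(i <- r) elsym_contents N la i.+1 ^+ m i * g la).
Proof.
move=> gk; elim: r => [|i r IH].
  by rewrite big_nil addn0; apply: eq_rep gk => la _ _; rewrite big_nil mul1r.
rewrite big_cons addnCA addnC.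
apply: (eq_rep _ _ _ _ _ (fun la => elsym_contents N la i.+1 ^+ m i *
    (\prod_(j <- r) elsym_contents N la j.+1 ^+ m j * g la))).
  by move=> la _ _; rewrite big_cons mulrA.
elim: (m i) => [|p IHp].
  by rewrite addn0; apply: eq_rep IH => la _ _; rewrite expr0 mul1r.
rewrite mulSn [(i.+1 + _)%N]addnC addnA.
apply: eq_rep (rep_elsym N _ i.+1 _ (ltn_ord i) IHp) => la _ _.
by rewrite exprS -mulrA.
Qed.

Lemma rep_symmetric N k k' (P : {mpoly K[N]}) g : P \is symmetric ->
  (msize P <= k'.+1)%N -> rep N k g ->
  rep N (k + k') (fun la => P.@[fun i => contents K al la i] * g la).
Proof.
move=> P_sym P_k gk; have [t [tP t_P]] := sym_fundamental P_sym.
apply: (eq_rep _ _ _ _ _ (fun la => \sum_(m <- msupp t) t@_m *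
    (\prod_(i <- enum 'I_N) elsym_contents N la i.+1 ^+ m i * g la))) => [la _ _|].
  rewrite -tP comp_mpoly_meval mevalE mulr_suml; apply: eq_bigr => m _.
  rewrite mulrA big_enum /=; congr (_ * _ * _); apply: eq_bigr => i _.
  by rewrite tnth_mktuple meval_mesym.
apply: rep_sum => m m_t; apply: rep_scale.
apply: rep_le (rep_prod_elsym N k (enum 'I_N) m g gk); rewrite leq_add2l big_enum /=.
have := leq_trans (mmeasure_mnm_lt _ m_t) (leq_trans t_P P_k).
by rewrite ltnS.
Qed.

Variable H : seq nat -> K.
Hypothesis H_neq0 : forall la, is_part la -> H la != 0.
Hypothesis u_nrm : forall la s, is_part la -> nrm s = la -> u la s = H la.
Hypothesis u_qsum : forall la s, is_part la -> u la s != 0 ->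
  nrm s = la \/ (qsum s < qsum la)%N.

Lemma filter_nrm s : perm_eq [seq x <- nrm s | 0 < x]%N [seq x <- s | 0 < x]%N.
Proof.
rewrite /nrm -{2}[[seq x <- s | _]]filter_id; apply: perm_filter; exact: perm_nrm.
Qed.

(** At size j the matrix u_la(tau) is triangular for the sum of squares, with the nonzero diagonal
    H. A relation holding for all la of size j is therefore formal and holds for any [phi] that
    ignores order and zeros. *)
Lemma u_separates j (F : seq (K * seq nat)) (phi : seq nat -> K) :
  all (fun x => sumn x.2 == j) F ->
  (forall la, is_part la -> sumn la = j -> \sum_(x <- F) x.1 * u la x.2 = 0) ->
  (forall s t, perm_eq [seq x <- s | 0 < x]%N [seq x <- t | 0 < x]%N -> phi s = phi t) ->
  \sum_(x <- F) x.1 * phi x.2 = 0.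
Proof.
move=> /allP F_j F0 phi_inv; pose F' := [seq (x.1, nrm x.2) | x <- F].
have sumF' (psi : seq nat -> K) :
    (forall s t, perm_eq [seq x <- s | 0 < x]%N [seq x <- t | 0 < x]%N -> psi s = psi t) ->
    \sum_(x <- F) x.1 * psi x.2 = \sum_(x <- F') x.1 * psi x.2.
  move=> psi_inv; rewrite big_map; apply: eq_bigr => x _ /=.
  by congr (_ * _); apply: psi_inv; rewrite perm_sym filter_nrm.
rewrite (sumF' phi) //; apply: pcoef0_sum => s.
have [q] := ubnP (qsum s); elim: q s => // q IH s lt_q.
have [s_F|s_nF] := boolP (s \in [seq x.2 | x <- F']); last first.
  rewrite /pcoef big1_seq // => x /andP[/eqP xE x_F].
  by rewrite -xE map_f in s_nF.
have F'P t : t \in [seq x.2 | x <- F'] -> is_part t /\ sumn t = j.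
  rewrite -map_comp => /mapP[x x_F ->] /=.
  by rewrite nrm_part sumn_nrm (eqP (F_j x x_F)).
have [p_s n_s] := F'P _ s_F.
have := F0 s p_s n_s; rewrite (sumF' (u s)); last by move=> x y; apply: u_inv.
rewrite (sum_pcoef K F') (bigD1_seq s) ?undup_uniq ?mem_undup //= big1_seq ?addr0.
  move/eqP; rewrite mulf_eq0 u_nrm ?nrm_id // (negPf (H_neq0 s p_s)) orbF.
  by move/eqP.
move=> t /andP[ne]; rewrite mem_undup => /F'P[p_t _].
have [->|/(u_qsum _ _ p_s)[]] := eqVneq (u s t) 0; first by rewrite mulr0.
  by rewrite nrm_id // => tE; rewrite tE eqxx in ne.
by move=> lt; rewrite IH ?mul0r //; apply: leq_trans lt _; rewrite -ltnS.
Qed.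

Lemma Ko_inv la s t : is_part la ->
  perm_eq [seq x <- s | 0 < x]%N [seq x <- t | 0 < x]%N -> Ko la s = Ko la t.
Proof.
move=> p_la st; have E : sumn s = sumn t.
  by rewrite -(sumn_nrm s) -(sumn_nrm t) !sumnE; apply/perm_big; rewrite !perm_sort perm_sym perm_sort perm_sym.
rewrite /Ko E; case: ifP => // _; congr (_ / _); apply: u_inv => //.
by rewrite !filter_cat perm_cat2r.
Qed.

(** The components of the expansion are treated by increasing size j. On |la| = j the larger ones
    vanish by the convention in [Ko] and the smaller ones by induction, so [u_separates] applies to
    component j. At j = k, component k is matched with c Ko_(k): no mu other than (k) has a nonzero
    coefficient at (k), as k^2 is the largest sum of squares. *)
Lemma rep_vanish N k G : (k <= N)%N -> (0 < k)%N ->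
  rep N k (fun la => G la * Ko la [::]) ->
  (forall la, is_part la -> (sumn la <= k)%N -> la != [:: k] -> G la = 0) ->
  forall la, is_part la -> (size la <= N)%N ->
    G [:: k] * Ko [:: k] [::] * Ko la [:: k] = H [:: k] * (G la * Ko la [::]).
Proof.
move=> le_kN k0 [F [/allP F_k GF]] G0.
pose Fj j := [seq x <- F | sumn x.2 == j].
have split (phi : seq nat -> K) : \sum_(x <- F) x.1 * phi x.2
    = \sum_(j < k.+1) \sum_(x <- Fj j) x.1 * phi x.2.
  rewrite (eq_bigr (fun j : 'I_k.+1 => \sum_(x <- F) if sumn x.2 == j then x.1 * phi x.2 else 0)).
    rewrite exchange_big; apply: eq_big_seq => x /F_k le.
    rewrite (bigD1 (inord (sumn x.2))) //= inordK // eqxx big1 ?addr0 // => j ne.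
    by case: eqP => // E; rewrite E inord_val eqxx in ne.
  by move=> j _; rewrite big_filter -big_mkcond.
have KoE la j : sumn la = j -> \sum_(x <- Fj j) x.1 * Ko la x.2 = \sum_(x <- Fj j) x.1 * u la x.2.
  move=> n_la; rewrite !big_filter; apply: eq_bigr => x /eqP xj; congr (_ * _).
  by rewrite /Ko xj n_la leqnn subnn cats0 fact0 divr1.
have FjP j : all (fun x => sumn x.2 == j) (Fj j) by apply: filter_all.
have size_le la j : is_part la -> sumn la = j -> (j <= k)%N -> (size la <= N)%N.
  by move=> p_la n_la le; apply: leq_trans (size_part _ p_la) _; rewrite n_la (leq_trans le).
have eval_at j la : (j <= k)%N -> is_part la -> sumn la = j ->
    (forall i, (i < j)%N -> \sum_(x <- Fj i) x.1 * Ko la x.2 = 0) ->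
    G la * Ko la [::] = \sum_(x <- Fj j) x.1 * u la x.2.
  move=> le_j p_la n_la lo; rewrite GF ?(size_le la j) // split.
  rewrite (bigD1 (inord j)) //= inordK ?ltnS // (KoE la j n_la) [X in _ + X]big1 ?addr0 // => i ne.
  have [lt|gt|E] := ltngtP i j; first exact: lo; last by rewrite -E inord_val eqxx in ne.
  rewrite big_filter big1 // => x /eqP xi.
  by rewrite /Ko xi n_la leqNgt gt mulr0.
have low j : (j < k)%N -> forall la, is_part la -> \sum_(x <- Fj j) x.1 * Ko la x.2 = 0.
  elim/ltn_ind: j => j IH lt_j la p_la.
  apply: (u_separates j) => // [mu p_mu n_mu|s t]; last exact: Ko_inv.
  rewrite -(eval_at j mu (ltnW lt_j)) // => [|i lt_i].
    rewrite G0 ?mul0r ?n_mu ?(ltnW lt_j) //.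
    by apply: contraTneq lt_j => mE; rewrite -n_mu mE /= addn0 ltnn.
  by apply: IH => //; apply: ltn_trans lt_i lt_j.
move=> la p_la le_la.
have p_k : is_part [:: k] by rewrite /is_part /= k0.
pose c := G [:: k] * Ko [:: k] [::] / H [:: k].
have top : \sum_(x <- rcons (Fj k) (- c, [:: k])) x.1 * Ko la x.2 = 0.
  apply: (u_separates k) => [|mu p_mu n_mu|s t]; last exact: Ko_inv.
    by rewrite all_rcons FjP /= addn0 eqxx.
  rewrite -cats1 big_cat big_seq1 /= -(eval_at k mu (leqnn _)) // => [|i lt_i]; last exact: low.
  have [->|ne] := eqVneq mu [:: k].
    by rewrite u_nrm ?nrm_id // /c mulNr divfK ?H_neq0 // subrr.
  rewrite G0 ?n_mu // mul0r add0r.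
  have [->|/(u_qsum _ _ p_mu)[]] := eqVneq (u mu [:: k]) 0; first by rewrite mulr0.
    by rewrite nrm_id // => E; rewrite E eqxx in ne.
  by have := qsum_le mu; rewrite n_mu /qsum /= addn0 leqNgt => /negPf ->.
have {top} -> : G la * Ko la [::] = c * Ko la [:: k].
  rewrite GF // split big_ord_recr /= big1 ?add0r => [|i _]; last by apply: low.
  move: top; rewrite -cats1 big_cat big_seq1 /= mulNr => /eqP.
  by rewrite subr_eq0 => /eqP.
by rewrite /c; field; apply: H_neq0.
Qed.

End Density.

(** * Symmetrization and polynomial functions of bounded degree *)

Section SymmetricPolynomials.

Variables (K : fieldType) (n : nat).

Lemma msym_mpolyE (s : 'S_n) (p : {mpoly K[n]}) :
  msym s p = \sum_(m <- msupp p) p@_m *: msym s 'X_[m].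
Proof.
rewrite {1}[p]mpolyE (big_morph (msym s) (msymD s) (msym0 K s)).
by apply: eq_bigr => m _; rewrite msymZ.
Qed.

Lemma meval_msym (s : 'S_n) (p : {mpoly K[n]}) v :
  (msym s p).@[v] = p.@[v \o s].
Proof.
rewrite msym_mpolyE raddf_sum /= [RHS]mevalE; apply: eq_bigr => m _.
rewrite mevalZ msymX mevalX; congr (_ * _).
rewrite (reindex_inj (@perm_inj _ s)) /=; apply: eq_bigr => i _.
by rewrite mnmE permK.
Qed.

Lemma msize_msym (s : 'S_n) (p : {mpoly K[n]}) : (msize (msym s p) <= msize p)%N.
Proof.
rewrite msym_mpolyE; apply: leq_trans (msize_sum _ _ _) _.
rewrite big_seq; apply: (big_ind (fun d => d <= msize p)%N) => // [x y lx ly|m m_p].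
  by rewrite geq_max lx ly.
rewrite msymX; apply: leq_trans (msizeZ_le _ _) _; rewrite msizeX mdeg_mperm.
exact: msize_mdeg_lt.
Qed.

Lemma symmetrize k (p : {mpoly K[n]}) (g : ('I_n -> K) -> K) :
  n`!%:R != 0 :> K -> (msize p <= k)%N -> (forall v, p.@[v] = g v) ->
  (forall v (s : 'S_n), g (v \o s) = g v) ->
  exists q : {mpoly K[n]}, [/\ q \is symmetric, (msize q <= k)%N & forall v, q.@[v] = g v].
Proof.
move=> n0 p_k pE gs; exists (n`!%:R^-1 *: \sum_(s : 'S_n) msym s p); split.
- apply/issymP => t; rewrite msymZ (big_morph (msym t) (msymD t) (msym0 K t)); congr (_ *: _).
  rewrite [RHS](reindex_inj (mulIg t)) /=; apply: eq_bigr => s _.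
  by rewrite msymMm.
- apply: leq_trans (msizeZ_le _ _) (leq_trans (msize_sum _ _ _) _).
  apply: (big_ind (fun d => d <= k)%N) => // [x y lx ly|s _].
    by rewrite geq_max lx ly.
  by apply: leq_trans (msize_msym s p) p_k.
move=> v; rewrite mevalZ raddf_sum /= (eq_bigr (fun=> g v)) => [|s _].
  by rewrite sumr_const card_Sn -[g v *+ _]mulr_natl mulKf.
by rewrite meval_msym pE gs.
Qed.

Definition polyfn (k : nat) (g : ('I_n -> K) -> K) : Prop :=
  exists p : {mpoly K[n]}, (msize p <= k.+1)%N /\ forall v, p.@[v] = g v.

Lemma eq_polyfn k g1 g2 : (forall v, g1 v = g2 v) -> polyfn k g2 -> polyfn k g1.
Proof. by move=> E [p [p_k pE]]; exists p; split=> // v; rewrite pE E. Qed.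

Lemma polyfn_le k1 k2 g : (k1 <= k2)%N -> polyfn k1 g -> polyfn k2 g.
Proof. by move=> le [p [p_k pE]]; exists p; split=> //; apply: leq_trans p_k _. Qed.

Lemma polyfn_const k c : polyfn k (fun=> c).
Proof.
exists c%:MP; split=> [|v]; last by rewrite mevalC.
by apply: leq_trans (_ : 1 <= _)%N => //; rewrite msizeC; case: eqP.
Qed.

Lemma polyfn_var (i : 'I_n) : polyfn 1 (fun v => v i).
Proof. by exists 'X_i; split=> [|v]; rewrite ?mevalXU // msizeX mdeg1. Qed.

Lemma polyfn_add k g1 g2 : polyfn k g1 -> polyfn k g2 -> polyfn k (fun v => g1 v + g2 v).
Proof.
move=> [p1 [p1k p1E]] [p2 [p2k p2E]]; exists (p1 + p2); split=> [|v].
  by apply: leq_trans (msizeD_le _ _) _; rewrite geq_max p1k.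
by rewrite mevalD p1E p2E.
Qed.

Lemma polyfn_mul k1 k2 g1 g2 : polyfn k1 g1 -> polyfn k2 g2 ->
  polyfn (k1 + k2) (fun v => g1 v * g2 v).
Proof.
move=> [p1 [p1k p1E]] [p2 [p2k p2E]]; exists (p1 * p2); split=> [|v]; last first.
  by rewrite mevalM p1E p2E.
have [->|nz1] := eqVneq p1 0; first by rewrite mul0r msize0.
have [->|nz2] := eqVneq p2 0; first by rewrite mulr0 msize0.
rewrite msizeM //; move: p1k p2k; move: (msize p1) (msize p2) => a b; lia.
Qed.

Lemma polyfn_scale k c g : polyfn k g -> polyfn k (fun v => c * g v).
Proof. exact: (polyfn_mul 0 k _ _ (polyfn_const 0 c)). Qed.

Lemma polyfn_sum k (I : eqType) (r : seq I) (g : I -> ('I_n -> K) -> K) :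
  (forall i, i \in r -> polyfn k (g i)) -> polyfn k (fun v => \sum_(i <- r) g i v).
Proof.
elim: r => [|i r IH] H.
  by apply: eq_polyfn (polyfn_const k 0) => v; rewrite big_nil.
apply: eq_polyfn (polyfn_add _ _ _ (H i (mem_head _ _)) (IH _)) => [v|j j_r].
  by rewrite big_cons.
by apply: H; rewrite inE j_r orbT.
Qed.

Lemma polyfn_prod (I : Type) (r : seq I) (d : I -> nat) (g : I -> ('I_n -> K) -> K) :
  (forall i, polyfn (d i) (g i)) ->
  polyfn (\sum_(i <- r) d i) (fun v => \prod_(i <- r) g i v).
Proof.
move=> H; elim: r => [|i r IH].
  by rewrite big_nil; apply: eq_polyfn (polyfn_const 0 1) => v; rewrite big_nil.
rewrite big_cons; apply: eq_polyfn (polyfn_mul _ _ _ _ (H i) IH) => v.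
by rewrite big_cons.
Qed.

Lemma polyfn_exp d k g : polyfn d g -> polyfn (k * d) (fun v => g v ^+ k).
Proof.
move=> H; elim: k => [|k IH]; first exact: polyfn_const.
rewrite mulSn; apply: eq_polyfn (polyfn_mul _ _ _ _ H IH) => v.
by rewrite exprS.
Qed.

End SymmetricPolynomials.

Section RowPolynomial.

Variables (K : fieldType) (al : K).

Lemma polyfn_rowJ n k (s : seq (('I_n -> K) -> K)) :
  (forall g, List.In g s -> polyfn K n 1 g) ->
  polyfn K n k (fun v => rowJ K al k [seq g v | g <- s]).
Proof.
elim: s k => [|g s IH] k H; first exact: polyfn_const.
rewrite /=; apply: polyfn_sum => m _.
apply: (polyfn_le _ _ (0 + m + (k - m))); first by have := ltn_ord m; lia.
apply: polyfn_mul; last by apply: IH => g' g's; apply: H; right.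
apply: polyfn_mul; first exact: polyfn_const.
rewrite /rise -[X in polyfn _ _ X _]muln1 -[X in (X * 1)%N]card_ord -sum_nat_const.
apply: (polyfn_prod K n _ _ (fun=> 1%N)) => i.
apply: polyfn_add; last exact: polyfn_const.
by apply: polyfn_add; [apply: H; left | exact: polyfn_const].
Qed.

Lemma nth_unshift i (y : seq K) j : (j < size y)%N ->
  nth 0 (unshift K al i y) j = (nth 0 y j + (i + j)%:R) / al.
Proof.
elim: y i j => //= a y IH i [|j] lt; first by rewrite addn0.
by rewrite /= IH // addSnnS.
Qed.

Lemma size_unshift i (y : seq K) : size (unshift K al i y) = size y.
Proof. by elim: y i => //= a y IH i; rewrite IH. Qed.

End RowPolynomial.

(** * Shifted symmetric functions determined by vanishing *)

Section Interpolation.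

Variables (K : fieldType) (al : K).
Hypothesis al_lin : forall a b : int, a%:~R + b%:~R * al = 0 -> a = 0 /\ b = 0.
Local Notation eigval := (eigval K al).
Local Notation lax := (lax K al).
Local Notation rowJ := (rowJ K al).
Local Notation unshift := (unshift K al).

Variables (u : seq nat -> seq nat -> K) (H : seq nat -> K).
Hypothesis u_inv : forall la s t, is_part la ->
  perm_eq [seq x <- s | 0 < x]%N [seq x <- t | 0 < x]%N -> u la s = u la t.
Hypothesis u_eigen : forall la m s, is_part la ->
  iter m lax (fun b t => u la (b :: t)) 0%N s = eigval la m 0 * u la s.
Hypothesis H_neq0 : forall la, is_part la -> H la != 0.
Hypothesis u_nrm : forall la s, is_part la -> nrm s = la -> u la s = H la.
Hypothesis u_qsum : forall la s, is_part la -> u la s != 0 ->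
  nrm s = la \/ (qsum s < qsum la)%N.
Local Notation Ko := (Ko K u).
Local Notation nats la := [seq n%:R : K | n <- la].

Section OneFunction.

Variables (k : nat) (F : seq K -> K).
Hypothesis F_poly : forall N, polyfn K N k (fun v => F (unshift 0 [seq v i | i <- enum 'I_N])).
Hypothesis F_sym : forall y1 y2, perm_eq y1 y2 -> F (unshift 0 y1) = F (unshift 0 y2).
Hypothesis F_stable : forall x, F (rcons x 0) = F x.

(** Stability lets one polynomial, in N contents, evaluate F at all partitions with at most N
    rows. *)
Lemma stable_pad la N : (size la <= N)%N ->
  F (unshift 0 [seq contents K al la (i : 'I_N) | i <- enum 'I_N]) = F (nats la).
Proof.
move=> le; have pad m x : F (x ++ nseq m 0) = F x.
  elim: m x => [|m IH] x; first by rewrite cats0.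
  by rewrite -cat_rcons IH F_stable.
rewrite -[RHS](pad (N - size la)%N); congr F.
have al0 := al_neq0 K al al_lin.
apply: (@eq_from_nth _ 0) => [|i].
  by rewrite size_unshift size_map size_enum_ord size_cat size_nseq size_map subnKC.
rewrite size_unshift size_map size_enum_ord => lt_i.
rewrite nth_unshift; last by rewrite size_map size_enum_ord.
rewrite (nth_map (Ordinal lt_i)) ?size_enum_ord // nth_enum_ord // /contents add0n.
rewrite subrK mulrC mulKf // nth_cat size_map.
case: ltnP => [lt|ge]; first by rewrite (nth_map 0%N).
by rewrite nth_default // nth_nseq; case: ifP.
Qed.

Lemma rep_interp N : rep K u N k (fun la => F (nats la) * Ko la [::]).
Proof.
have [p [p_k pE]] := F_poly N.
have [|q [q_sym q_k qE]] := symmetrize K N k.+1 p _ (al_fact_neq0 K al al_lin N) p_k pE.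
  move=> v s; apply: F_sym; rewrite (map_comp v s); apply: perm_map.
  apply: uniq_perm => [||i]; rewrite ?(map_inj_uniq (@perm_inj _ s)) ?enum_uniq //.
  by rewrite mem_enum -[i](permKV s) map_f // mem_enum.
have := rep_symmetric K al al_lin u u_inv u_eigen N 0 k q (fun la => Ko la [::]) q_sym q_k
   (rep_Ko K u N 0 [::] (leqnn _)).
apply: eq_rep => la p_la le; rewrite qE.
by rewrite -(stable_pad la N).
Qed.

Hypothesis k_gt0 : (0 < k)%N.
Hypothesis F_vanish : forall la, is_part la -> (sumn la <= k)%N -> la != [:: k] -> F (nats la) = 0.

Lemma interp la : is_part la ->
  F [:: k%:R] * Ko [:: k] [::] * Ko la [:: k] = H [:: k] * (F (nats la) * Ko la [::]).
Proof.
move=> p_la; pose N := maxn k (size la).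
apply: (rep_vanish K u u_inv H H_neq0 u_nrm u_qsum N k (fun la => F (nats la))) => //.
- exact: leq_maxl.
- exact: rep_interp.
exact: leq_maxr.
Qed.

End OneFunction.

Lemma rowJ_interp k la : (0 < k)%N -> is_part la ->
  rowJ k [:: k%:R] * Ko [:: k] [::] * Ko la [:: k] = H [:: k] * (rowJ k (nats la) * Ko la [::]).
Proof.
move=> k0 p_la; apply: (interp k (rowJ k)) => //.
- move=> N.
  pose gs := [seq (fun v : 'I_N -> K => (v i + i%:R) / al) | i : 'I_N <- enum 'I_N].
  have gsP g : List.In g gs -> polyfn K N 1 g.
    rewrite /gs; elim: (enum 'I_N) => //= i s IH [<-|/IH //].
    apply: (polyfn_mul K N 1 0); last exact: polyfn_const.
    by apply: polyfn_add; [apply: polyfn_var | apply: polyfn_const].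
  apply: eq_polyfn (polyfn_rowJ K al N k gs gsP) => v.
  congr rowJ; rewrite /gs -[in RHS]map_comp.
  apply: (@eq_from_nth _ 0); first by rewrite size_unshift !size_map.
  move=> i; rewrite size_unshift size_map. rewrite size_enum_ord => lt_i.
  rewrite nth_unshift ?size_map ?size_enum_ord //.
  have E : nth (Ordinal lt_i) (enum (ordinal N)) i = Ordinal lt_i.
    exact: (nth_ord_enum (Ordinal lt_i) (Ordinal lt_i)).
  rewrite (nth_map (Ordinal lt_i)) ?size_enum_ord // [in RHS](nth_map (Ordinal lt_i)) ?E //.
    by rewrite size_enum_ord.
  by rewrite -enumT size_enum_ord.
- by move=> y1 y2; apply: rowJ_unshift_perm.
- by move=> x; apply: rowJ_cat_zero.
move=> mu p_mu le_mu ne; apply: rowJ_vanish; first by case/andP: p_mu.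
rewrite ltnNge; apply: contra ne.
case: mu p_mu le_mu => [_ _|x mu] /=; first by rewrite leqNgt k0.
move=> p_mu le_mu le_x; have mu0 : (sumn mu <= 0)%N by lia.
have xk : x = k by lia.
have : (size (x :: mu) <= 1)%N.
  case: mu p_mu mu0 {le_mu} => [|y mu] //= /andP[_ /and3P[_ y0 _]]; lia.
by rewrite xk; case: mu {p_mu le_mu mu0}.
Qed.

End Interpolation.

(** * Extracting the longest row *)

Section Bounded.

Variables (K : fieldType) (al : K).
Local Notation lax := (lax K al).
Local Notation hop := (hop K).
Local Notation eigval := (eigval K al).

Definition hbound (r : nat) (h : nat -> seq nat -> K) :=
  forall b s, ~~ all (fun x => x <= r)%N (b :: s) -> h b s = 0.

Lemma hop2_bound r (g : nat -> nat -> K) b c : (r < b)%N || (r < c)%N ->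
  (forall x y, (r < x)%N || (r < y)%N -> g x y = 0) -> hop2 K g b c = 0.
Proof.
move=> bc g0; rewrite hop2_top big1 => [|i _]; last first.
  have : (i < minn b c)%N by []. 
  rewrite leq_min => /andP[ib ic].
  have lt : (r < b + c - i)%N by lia.
  by rewrite !g0 ?subrr // lt ?orbT.
by rewrite !g0 ?subrr ?if_same ?addr0 // orbC.
Qed.

Lemma hop_bound r h b s : hbound r h -> ~~ all (fun x => x <= r)%N (b :: s) -> hop h b s = 0.
Proof.
elim: s h => //= c s IH h hr bad.
have -> : hop2 K (fun x y => h x (y :: s)) b c = 0.
  have [s_ok|s_bad] := boolP (all (fun x => x <= r)%N s).
    apply: (hop2_bound r) => [|x y xy]; first by move: bad; rewrite s_ok; lia.
    by apply: hr => /=; rewrite s_ok; lia.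
  rewrite /hop2 big1 // => i _; rewrite !hr ?subrr //=.
    by rewrite (negPf s_bad) !andbF.
  by rewrite (negPf s_bad) !andbF.
rewrite add0r; case: (leqP c r) => [le|lt].
  apply: IH => [x t xt|]; last by move: bad; rewrite /= le.
  by apply: hr; move: xt; rewrite /= le.
rewrite -[RHS](hop_zero K b s); apply: eq_hop => x t.
by apply: hr; rewrite /= [(c <= r)%N]leqNgt lt andbF.
Qed.

Lemma lax_bound r h : hbound r h -> hbound r (lax h).
Proof. by move=> hr b s bad; rewrite /lax hr // (hop_bound r) // mulr0 addr0. Qed.

Lemma iter_lax_bound r m h : hbound r h -> hbound r (iter m lax h).
Proof. by move=> hr; elim: m => //= m; apply: lax_bound. Qed.

Lemma hop_max r h s : hbound r h -> hop h r s = 0.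
Proof.
elim: s h => //= c s IH h hr.
rewrite hop2_top big1 => [|i _]; last first.
  have : (i < minn r c)%N by [].
  rewrite leq_min => /andP[ib ic].
  have lt : (r + c - i <= r)%N = false by lia.
  by rewrite !hr /= ?lt ?andbF ?subrr.
rewrite add0r; case: ltnP => [lt|le].
  have rc : (c <= r)%N = false by rewrite leqNgt lt.
  rewrite !hr /= ?rc ?andbF ?subrr ?add0r //.
  rewrite -[RHS](hop_zero K r s); apply: eq_hop => x t.
  by apply: hr; rewrite /= rc andbF.
by rewrite add0r; apply: IH => x t xt; apply: hr; move: xt; rewrite /= le.
Qed.

(** At the largest exponent every hop would need an exponent above r, so [lax] acts there as the
    scalar al r. *)
Lemma iter_lax_max r m h s : hbound r h -> iter m lax h r s = (al * r%:R) ^+ m * h r s.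
Proof.
move=> hr; elim: m => [|m IH]; first by rewrite mul1r.
rewrite /= {1}/lax hop_max; last exact: iter_lax_bound.
by rewrite addr0 IH exprS mulrA.
Qed.

(* Extracting the coefficient of [x_1 ^ r], where [r] bounds all exponents, is an
   intertwiner of [lax] up to terms that are multiples of the initial value. *)
Lemma lax_extract r m h b s : hbound r h -> (forall b s, h r (b :: s) = h b (r :: s)) ->
  let z m b s := iter m lax h b (r :: s) in
  lax (z m) b s = z m.+1 b s + z m b s - (al * r%:R) ^+ m * z 0%N b s.
Proof.
move=> hr h_sym z; have hrm := iter_lax_bound r m h hr.
rewrite {2}/z /= {2}/lax [hop _ _ (_ :: _)]/= -/(z m b s).
suff -> : hop2 K (fun x y => iter m lax h x (y :: s)) b r
    = (al * r%:R) ^+ m * z 0%N b s - z m b s by rewrite /lax; ring.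
case: (leqP b r) => [le|lt]; last first.
  have br : (b <= r)%N = false by rewrite leqNgt lt.
  rewrite (hop2_bound r) ?lt // => [|x y]; last first.
    by move=> xy; apply: hrm => /=; lia.
  by rewrite /z hrm /= ?br // hr /= ?br // mulr0 subrr.
rewrite hop2_top big1 => [|i _]; last first.
  have : (i < minn b r)%N by [].
  rewrite leq_min => /andP[ib ic].
  have lt : (b + r - i <= r)%N = false by lia.
  by rewrite !hrm /= ?lt ?andbF ?subrr.
rewrite add0r iter_lax_max // h_sym; move: le; rewrite leq_eqVlt => /orP[/eqP ->|->//].
by rewrite ltnn /z [iter m _ _ _ _]iter_lax_max // subrr.
Qed.

End Bounded.

Section EigenvalueThree.

Variables (K : fieldType) (al : K).
Local Notation eigval := (eigval K al).

(** For a partition this is minus the sum of (2 i + 1) la_i, rows numbered from 0; [eigval3_0] is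
    then the Laplace-Beltrami eigenvalue up to a factor and a multiple of |la|. *)
Definition zsum (la : seq nat) : int :=
  \sum_(c <- la) (\sum_(d <- la | (c < d)%N) (d%:Z - c%:Z) - (sumn la)%:Z).

Lemma eigvalS la m b : eigval la m.+1 b
  = al * b%:R * eigval la m b + \sum_(c <- la | (b < c)%N) (eigval la m c - eigval la m b).
Proof. by []. Qed.

Lemma eigval1 la b : eigval la 1 b = al * b%:R.
Proof. by rewrite /= mulr1 big1 ?addr0 // => i _; rewrite subrr. Qed.

Lemma eigval2_0 la : eigval la 2 0 = al * (sumn la)%:R.
Proof.
rewrite eigvalS mulr0 mul0r add0r.
under eq_bigr do rewrite !eigval1 mulr0 subr0.
rewrite -mulr_sumr; congr (_ * _); elim: la => [|c la IH]; first by rewrite big_nil.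
rewrite big_cons IH /= natrD; case: ifP => // /negbT; rewrite -leqNgt leqn0 => /eqP ->.
by rewrite add0r.
Qed.

Lemma eigval3_0 la : all (fun x => 0 < x)%N la ->
  eigval la 3 0 = al ^+ 2 * (qsum la)%:R + al * (zsum la)%:~R.
Proof.
move=> pos; have E : eigval la 3 0 = \sum_(c <- la | (0 < c)%N) (eigval la 2 c - eigval la 2 0).
  by rewrite eigvalS mulr0 mul0r add0r.
rewrite E big_mkcond (eq_big_seq (fun c => al ^+ 2 * (c ^ 2)%:R
    + al * (\sum_(d <- la | (c < d)%N) (d%:Z - c%:Z) - (sumn la)%:Z)%:~R)).
  rewrite big_split /= -!mulr_sumr -(rmorph_sum (intr : int -> K)) /zsum.
  congr (_ * _ + _); rewrite /qsum sumnE big_map.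
  by rewrite (big_morph _ (natrD K) (mulr0n 1)).
move=> c c_la; rewrite (allP pos c c_la) eigval2_0 (eigvalS la 1) eigval1 mulrzBr rmorph_sum -pmulrn mulrBr.
have -> : \sum_(d <- la | (c < d)%N) (eigval la 1 d - al * c%:R)
   = al * \sum_(d <- la | (c < d)%N) (d%:Z - c%:Z)%:~R.
  by rewrite mulr_sumr; apply: eq_bigr => d _; rewrite eigval1 mulrzBr -!pmulrn mulrBr.
by rewrite natrX expr2; ring.
Qed.

Lemma zsum_cons r mu : all (fun x => x <= r)%N mu ->
  zsum (r :: mu) = zsum mu - r%:Z - (sumn mu)%:Z *+ 2.
Proof.
move=> /allP le_r; rewrite /zsum big_cons big_cons ltnn.
rewrite big1_seq ?sub0r => [|d /andP[lt /le_r]]; last by rewrite leqNgt lt.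
rewrite (eq_big_seq (fun c => (\sum_(d <- mu | (c < d)%N) (d%:Z - c%:Z) - (sumn mu)%:Z)
     + (- c%:Z))) => [|c c_mu].
  rewrite big_split /= sumrN.
  have -> : \sum_(c <- mu) c%:Z = (sumn mu)%:Z.
    by elim: (mu) => [|x s IH]; rewrite ?big_nil // big_cons IH /= PoszD.
  by rewrite PoszD; ring.
rewrite big_cons; have := le_r c c_mu; rewrite leq_eqVlt /= PoszD => /orP[/eqP ->|->].
  by rewrite ltnn; ring.
by ring.
Qed.

End EigenvalueThree.

Lemma nrm_perm s t :
  perm_eq [seq x <- s | 0 < x]%N [seq x <- t | 0 < x]%N -> nrm s = nrm t.
Proof.
move=> st; apply: sorted_geq_eq; try by case/andP: (nrm_part s).
  by case/andP: (nrm_part t).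
by apply: perm_trans (perm_nrm s) (perm_trans st _); rewrite perm_sym perm_nrm.
Qed.

(** * The coefficient of 1^n and the value of Ko_(k) *)

Section Normalization.

Variables (K : fieldType) (al : K).
Hypothesis al_lin : forall a b : int, a%:~R + b%:~R * al = 0 -> a = 0 /\ b = 0.
Local Notation eigval := (eigval K al).
Local Notation lax := (lax K al).
Local Notation rowJ := (rowJ K al).
Local Notation nats la := [seq n%:R : K | n <- la].

Variables (u : seq nat -> seq nat -> K) (H : seq nat -> K).
Hypothesis u_inv : forall la s t, is_part la ->
  perm_eq [seq x <- s | 0 < x]%N [seq x <- t | 0 < x]%N -> u la s = u la t.
Hypothesis u_eigen : forall la m s, is_part la ->
  iter m lax (fun b t => u la (b :: t)) 0%N s = eigval la m 0 * u la s.
Hypothesis H_neq0 : forall la, is_part la -> H la != 0.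
Hypothesis u_nrm : forall la s, is_part la -> nrm s = la -> u la s = H la.
Hypothesis u_qsum : forall la s, is_part la -> u la s != 0 ->
  nrm s = la \/ (qsum s < qsum la)%N.
Hypothesis u_head : forall la s, is_part la -> u la s != 0 ->
  {in s, forall x, x <= head 0 la}%N.
Hypothesis H_nil : H [::] = 1.
Hypothesis H_cons : forall r mu, is_part (r :: mu) ->
  H (r :: mu) = rowJ r (nats (r :: mu)) * H mu.
Local Notation Ko := (Ko K u).

Lemma u_perm la s t : is_part la -> perm_eq s t -> u la s = u la t.
Proof. by move=> p_la st; apply: u_inv => //; apply: perm_filter. Qed.

Lemma part_cons r mu : is_part (r :: mu) ->
  [/\ (0 < r)%N, all (fun x => x <= r)%N mu & is_part mu].
Proof.
rewrite /is_part /= (path_sortedE (rev_trans leq_trans)).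
by case/andP => /andP[le s_mu] /andP[r0 pos]; split=> //; rewrite s_mu.
Qed.

(** Three uses of [lax_extract] express the left side through the eigenvalue equations of la = (r,
    mu) with m <= 3; by [zsum_cons] the resulting combination of eigenvalues is the third eigenvalue
    of mu. *)
Lemma u_remove_row_eigen r mu s : is_part (r :: mu) ->
  iter 3 lax (fun b t => u (r :: mu) (r :: b :: t)) 0%N s
  = eigval mu 3 0 * u (r :: mu) (r :: s).
Proof.
move=> p_la; have [r0 le_r p_mu] := part_cons _ _ p_la.
set la := r :: mu; pose h b t := u la (b :: t).
have hr : hbound K r h.
  move=> b t; apply: contraNeq => /(u_head _ _ p_la) le.
  by apply/allP => x /le.
have h_sym b t : h r (b :: t) = h b (r :: t).
  by apply: u_perm => //; apply/seq.permP => p /=; rewrite addnCA.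
pose z m b t := iter m lax h b (r :: t).
have lax_z m b t : lax (z m) b t = z m.+1 b t + z m b t - (al * r%:R) ^+ m * z 0%N b t.
  exact: lax_extract.
have z1 b t : lax (z 0%N) b t = z 1%N b t by rewrite lax_z expr0; ring.
have z2 b t : lax (lax (z 0%N)) b t = z 2%N b t + z 1%N b t - al * r%:R * z 0%N b t.
  by rewrite (eq_lax K al _ _ z1) lax_z expr1.
have -> : iter 3 lax (fun b t => u la (r :: b :: t)) 0%N s
   = z 3%N 0%N s + z 2%N 0%N s - (al * r%:R) ^+ 2 * z 0%N 0%N s
     + (z 2%N 0%N s + z 1%N 0%N s - al * r%:R * z 0%N 0%N s) - al * r%:R * z 1%N 0%N s.
  transitivity (lax (lax (lax (z 0%N))) 0%N s).
    apply: (eq_iter_lax K al 3) => b t; rewrite /z /= /h.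
    by apply: u_perm => //; apply/seq.permP => p /=; rewrite addnCA.
  rewrite (eq_lax K al _ (fun b t => 1 * z 2%N b t + (1 * z 1%N b t + ((- (al * r%:R)) * z 0%N b t + 0)))); last first.
    by move=> b t; rewrite z2; ring.
  by rewrite !lax_linear lax_zero !lax_z; ring.
have zE m : z m 0%N s = eigval la m 0 * u la (r :: s) by apply: u_eigen.
have pos (t : seq nat) : is_part t -> all (fun x => 0 < x)%N t by case/andP.
have zsumE : (zsum la)%:~R = (zsum mu)%:~R - r%:R - (sumn mu)%:R * 2 :> K.
  by rewrite zsum_cons // mulr2n !mulrzBr mulrzDr -!pmulrn; ring.
have v0 : eigval la 0 0 = 1 by [].
rewrite !zE eigval1 eigval2_0 v0 !eigval3_0 ?pos // zsumE /qsum /= -/(qsum mu) !natrD natrX.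
by ring.
Qed.

Lemma qsum_cons r s : qsum (r :: s) = (r ^ 2 + qsum s)%N. Proof. by []. Qed.

(** The constant matches leading terms, so the difference D lives strictly below mu while satisfying
    the eigenvalue equation of mu. At a topmost x in its support, [top_value] yields the eigenvalue
    of x instead; equality of the two would force equal sums of squares, because 1 and [al] are
    independent. *)
Lemma u_remove_row r mu s : is_part (r :: mu) ->
  u (r :: mu) (r :: s) = H (r :: mu) / H mu * u mu s.
Proof.
move=> p_la; have [r0 le_r p_mu] := part_cons _ _ p_la.
set c := _ / _; pose D s := u (r :: mu) (r :: s) - c * u mu s.
have D_inv x y : perm_eq [seq z <- x | 0 < z]%N [seq z <- y | 0 < z]%N -> D x = D y.
  move=> xy; rewrite /D (u_inv mu x y) //; congr (_ - _); apply: u_inv => //.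
  by rewrite /= r0 perm_cons.
have D_supp x : D x != 0 -> (qsum x < qsum mu)%N.
  have nrmE : nrm x = mu -> D x = 0.
    move=> xE; rewrite /D u_nrm //; last first.
      rewrite -(nrm_id _ p_la); apply: nrm_perm.
      by rewrite /= r0 perm_cons -xE perm_sym filter_nrm.
    by rewrite u_nrm // /c divfK ?H_neq0 // subrr.
  move=> Dx; have [E|/eqP ne] := eqVneq (nrm x) mu; first by rewrite nrmE ?eqxx in Dx.
  have [A0|/(u_qsum _ _ p_la)[E|]] := eqVneq (u (r :: mu) (r :: x)) 0.
  - have : u mu x != 0 by apply: contraNneq Dx => E; rewrite /D A0 E mulr0 subrr.
    by case/(u_qsum _ _ p_mu).
  - case: ne; rewrite -(nrm_id _ p_mu); apply: nrm_perm.
    by have := filter_nrm (r :: x); rewrite E /= r0 perm_cons perm_sym.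
  by rewrite !qsum_cons ltn_add2l.
have D_eigen x : iter 3 lax (fun b t => D (b :: t)) 0%N x = eigval mu 3 0 * D x.
  have E m (f1 f2 : nat -> seq nat -> K) b t :
      iter m lax (fun x y => - c * f1 x y + f2 x y) b t
      = - c * iter m lax f1 b t + iter m lax f2 b t.
    elim: m b t => //= m IH b t; rewrite -lax_linear; exact: eq_lax.
  rewrite (eq_iter_lax K al 3 _ (fun b t => - c * u mu (b :: t) + u (r :: mu) (r :: b :: t))).
    by rewrite E u_remove_row_eigen // u_eigen // /D; ring.
  by move=> b t; rewrite /D; ring.
suff D0 x : D x = 0 by apply/eqP; rewrite -subr_eq0 -/(D s) D0.
have [q] := ubnP (qsum mu - qsum x); elim: q x => // q IH x lt_q.
have [//|Dx] := eqVneq (D x) 0.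
have lt_x := D_supp x Dx.
pose t := nrm x; have p_t : is_part t := nrm_part x.
have tE : D t = D x by apply: D_inv; apply: filter_nrm.
have qt : qsum t = qsum x := qsum_nrm x.
have := D_eigen t; rewrite top_value //; last first.
- by case/andP: p_t.
- move=> y lt_y; apply: IH; rewrite qt in lt_y; move: lt_q; rewrite ltnS.
  apply: leq_trans; rewrite ltn_sub2l // ; exact: lt_x.
move=> /eqP; rewrite mulrC -subr_eq0 -mulrBl mulf_eq0 tE (negPf Dx) orbF.
have [[_ pos_t] [_ pos_mu]] := (andP p_t, andP p_mu).
rewrite !eigval3_0 // qt => E; exfalso.
have E0 : al * (((zsum t - zsum mu)%:~R : K) + ((qsum x)%:Z - (qsum mu)%:Z)%:~R * al) = 0.
  by rewrite !mulrzBr -!pmulrn -[RHS](eqP E); ring.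
move/eqP: E0; rewrite mulf_eq0 (negPf (al_neq0 K al al_lin)) /= => /eqP /al_lin [_].
by move: lt_x; lia.
Qed.

Lemma Ko_remove_row r mu : is_part (r :: mu) ->
  Ko (r :: mu) [:: r] = H (r :: mu) / H mu * Ko mu [::].
Proof.
move=> p_la; rewrite /Ko /= addn0 leq_addr addKn subn0.
by rewrite u_remove_row // mulrA.
Qed.

Lemma rowJ_one k n : rowJ k [:: n%:R] = rise K al 1 k / k`!%:R * (n ^_ k)%:R.
Proof. by rewrite (rowJ1 K al al_lin) (fall_nat K). Qed.

Lemma rowJ_diag n : rowJ n [:: n%:R] = rise K al 1 n.
Proof. by rewrite rowJ_one ffactnn divfK // (al_fact_neq0 K al). Qed.

Lemma H_row n : (0 < n)%N -> H [:: n] = rise K al 1 n.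
Proof.
by move=> n0; rewrite H_cons ?H_nil ?mulr1 ?rowJ_diag // /is_part /= n0.
Qed.

(** The third eigenvalue equation of J_(k+1) read at (k, 1) involves only the coefficients at (k, 1)
    and at (k + 1), and the latter is H. *)
Lemma u_row_pred k : (0 < k)%N ->
  (1 + k%:R * al) * u [:: k.+1] [:: k; 1] = k.+1%:R * H [:: k.+1].
Proof.
move=> k0; pose n := k.+1; set la := [:: n].
have p_la : is_part la by [].
set w := u la [:: k; 1].
have hperm s t : perm_eq [seq x <- s | 0 < x]%N [seq x <- t | 0 < x]%N -> u la s = u la t.
  exact: u_inv.
pose h1 b s := al * b%:R * u la (b :: s).
have h1E b s : lax (fun b t => u la (b :: t)) b s = h1 b s.
  by rewrite /lax hop_sym ?addr0 // => x y; apply: u_perm.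
have top s : perm_eq [seq x <- s | 0 < x]%N [:: n] -> u la s = H la.
  move=> sn; apply: u_nrm => //; rewrite -(nrm_id _ p_la).
  by apply: nrm_perm; apply: perm_trans sn _.
pose g := lax h1.
have E : lax g 0%N [:: k; 1%N] = eigval la 3 0 * w.
  rewrite -u_eigen //; apply: eq_lax; apply: eq_lax => b s.
  by rewrite h1E.
have g0 : g 0%N [:: k; 1%N] = al * n%:R * w.
  have := u_eigen la 2 [:: k; 1%N] p_la; rewrite eigval2_0 /= addn0 => <-.
  by apply: eq_lax => b s; rewrite h1E.
have gk : g k [:: 0; 1]%N = al * k%:R * (al * k%:R * w) + al * n%:R * H la.
  rewrite /g /lax /= hop2_0r /hop2 big_ord1 !addr0 add0r /h1 mulr0 mul0r subr0.
  congr (_ * (_ * _) + _); first by apply: hperm; rewrite /= k0.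
  by rewrite subn0 addn1 top //= .
have g1 : g 1%N [:: k; 0]%N = al * (al * w) + al * n%:R * H la + al * k%:R * w - al * w.
  rewrite /g /lax /= hop2_0r !addr0 hop2_top.
  have -> : minn 1 k = 1%N by apply/minn_idPl.
  rewrite big_ord1 subn0 /h1 mulr0 mul0r subr0 !mulr1 -!addrA.
  have w1 : u la [:: 1; k; 0]%N = w.
    apply: hperm; rewrite /= k0 /=; apply/seq.permP => p /=.
    by rewrite addnCA.
  have w2 : u la [:: k; 1; 0]%N = w by apply: hperm; rewrite /= k0.
  rewrite w1 add1n top //; congr (_ + (_ + _)).
  case: ltnP => [_|le]; first by rewrite w2.
  have -> : k = 1%N by lia.
  by rewrite mulr1 subrr.
have := E; rewrite /lax mulr0 mul0r add0r [hop _ _ _ _]/= !hop2_0l addr0.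
rewrite gk g1 g0 eigval3_0 // /zsum /qsum /= !big_seq1 big_cons big_nil ltnn.
have al2 : 2 * al != 0 by rewrite mulf_neq0 ?(al_neq0 K al) // (al_natr_eq0 K al).
move=> /eqP; rewrite -subr_eq0 => /eqP E3.
apply: (mulfI al2); apply/eqP; rewrite -subr_eq0; apply/eqP.
rewrite -oppr0 -E3 addn0 addn0 sub0r mulrNz -pmulrn natrX /n /la -natr1; ring.
Qed.

(** Induction through [rowJ_interp] for Ko_(n-1) at the row (n): both Ko_(n-1) and [rowJ] of order n
    - 1 equal n H_(n-1) there, which leaves Ko_0((n)) = 1. *)
Lemma Ko_single_row_nil n : (0 < n)%N -> Ko [:: n] [::] = 1.
Proof.
case: n => // n _; elim: n => [|k IH].
  rewrite /Ko /= u_nrm ?H_row ?(al_fact_neq0 K al) //.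
  by rewrite /rise big_ord1 mul0r addr0 divr1.
pose n := k.+2; have p_n : is_part [:: n] by [].
have H0 : H [:: k.+1] != 0 by exact: H_neq0.
have c0 : 1 + k.+1%:R * al != 0 by exact: (al_nat_neq0 K al al_lin 1).
have HE : H [:: n] = H [:: k.+1] * (1 + k.+1%:R * al).
  by rewrite !H_row // (riseSr K al 1 k.+1).
have uE : u [:: n] [:: k.+1; 1%N] = n%:R * H [:: k.+1].
  by apply: (mulfI c0); rewrite u_row_pred // HE mulrA mulrC.
have KoE : Ko [:: n] [:: k.+1] = n%:R * H [:: k.+1].
  by rewrite /Ko /= !addn0 leqnSn subSnn /= divr1.
have := rowJ_interp K al al_lin u H u_inv u_eigen H_neq0 u_nrm u_qsum k.+1 [:: n] isT p_n.
rewrite IH KoE rowJ_diag -H_row // mulr1 => /(mulfI H0).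
have n0 : n%:R != 0 :> K by rewrite (al_natr_eq0 K al al_lin).
have -> : rowJ k.+1 (nats [:: n]) = n%:R * H [:: k.+1].
  rewrite rowJ_one -H_row // -[RHS]mulrC -mulrA; congr (_ * _).
  apply: (mulfI (al_fact_neq0 K al al_lin k.+1)).
  rewrite mulrA divff ?mul1r ?(al_fact_neq0 K al al_lin) // -natrM; congr _%:R.
  have := ffact_fact (leqnSn k.+1); rewrite subSnn muln1 => ->.
  by rewrite [(k.+2)`!]factS mulnC.
by rewrite -[LHS]mulr1 => /(mulfI (mulf_neq0 n0 H0)).
Qed.

Lemma Ko_row_interp k la : (0 < k)%N -> is_part la ->
  Ko la [:: k] = rowJ k (nats la) * Ko la [::].
Proof.
move=> k0 p_la.
have p_k : is_part [:: k] by rewrite /is_part /= k0.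
have := rowJ_interp K al al_lin u H u_inv u_eigen H_neq0 u_nrm u_qsum k la k0 p_la.
by rewrite Ko_single_row_nil // rowJ_diag -H_row // mulr1 => /(mulfI (H_neq0 _ p_k)).
Qed.

(** By [H_cons], the factor H la / H mu from removing the row is the nonzero value of [rowJ r] at
    la, and it cancels. *)
Lemma Ko_nil la : is_part la -> Ko la [::] = 1.
Proof.
elim: la => [|r mu IH] p_la; first by rewrite /Ko /= u_nrm ?H_nil // divr1.
have [r0 _ p_mu] := part_cons _ _ p_la.
have := Ko_row_interp r (r :: mu) r0 p_la.
have Hmu := H_neq0 _ p_mu; have := H_neq0 _ p_la.
rewrite Ko_remove_row // IH // mulr1 H_cons // mulfK // mulf_eq0 (negPf Hmu) orbF => J0.
by rewrite -[LHS]mulr1 => /(mulfI J0).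
Qed.

Lemma Ko_rowJ k la : (0 < k)%N -> is_part la -> Ko la [:: k] = rowJ k (nats la).
Proof. by move=> k0 p_la; rewrite Ko_row_interp // Ko_nil // mulr1. Qed.

Lemma shifted_row_unique k (F : seq K -> K) la : (0 < k)%N ->
  (forall N, polyfn K N k (fun v => F (unshift K al 0 [seq v i | i <- enum 'I_N]))) ->
  (forall y1 y2, perm_eq y1 y2 -> F (unshift K al 0 y1) = F (unshift K al 0 y2)) ->
  (forall x, F (rcons x 0) = F x) ->
  (forall la, is_part la -> (sumn la <= k)%N -> la != [:: k] -> F (nats la) = 0) ->
  is_part la -> F [:: k%:R] * rowJ k (nats la) = H [:: k] * F (nats la).
Proof.
move=> k0 F_poly F_sym F_stable F_vanish p_la.
have p_k : is_part [:: k] by rewrite /is_part /= k0.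
have := interp K al al_lin u H u_inv u_eigen H_neq0 u_nrm u_qsum k F F_poly F_sym F_stable k0 F_vanish la p_la.
by rewrite !Ko_nil // Ko_rowJ // !mulr1.
Qed.

End Normalization.

(** * Positivity in the falling factorial basis *)

Section Positivity.

Variables (K : fieldType) (al : K).
Hypothesis al_lin : forall a b : int, a%:~R + b%:~R * al = 0 -> a = 0 /\ b = 0.
Local Notation rowJ := (rowJ K al).
Local Notation nats la := [seq n%:R : K | n <- la].
Variable d : nat.
Implicit Types (p r a b : 'I_d -> nat).

(* No coefficient is needed: multiplicities are expressed by repeating monomials. *)
Definition ff_mon := (nat * ('I_d -> nat) * ('I_d -> nat))%type.

Definition ff_mon_eval (t : ff_mon) p r : K :=
  al ^+ t.1.1 * \prod_i (((p i) ^_ (t.1.2 i))%:R * ((r i) ^_ (t.2 i))%:R).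

(* The grading by the total degree [n] in the [r_t], [t >= s], is what makes the factors
   [R_s - n] with [R_s = \sum_(t >= s) r_t] positive: on such a monomial,
   [R_s - n = \sum_(t >= s) (r_t - b_t)] and [(r_t - b_t) (r_t)_(b_t) = (r_t)_(b_t + 1)]. *)
Definition ff_graded (s n : nat) (G : ('I_d -> nat) -> ('I_d -> nat) -> K) :=
  exists P : seq ff_mon,
    all (fun t : ff_mon => [forall i : 'I_d, (i < s)%N ==> (t.2 i == 0%N)]
           && (\sum_i t.2 i == n)%N) P
    /\ forall p r, G p r = \sum_(t <- P) ff_mon_eval t p r.

Lemma ff_graded_eq s n G G' : (forall p r, G' p r = G p r) ->
  ff_graded s n G -> ff_graded s n G'.
Proof. by move=> E [P [P_ok PE]]; exists P; split=> // p r; rewrite E. Qed.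

Lemma ff_graded0 s n : ff_graded s n (fun _ _ => 0).
Proof. by exists [::]; split=> // p r; rewrite big_nil. Qed.

Lemma ff_gradedD s n G1 G2 : ff_graded s n G1 -> ff_graded s n G2 ->
  ff_graded s n (fun p r => G1 p r + G2 p r).
Proof.
move=> [P1 [P1_ok P1E]] [P2 [P2_ok P2E]]; exists (P1 ++ P2).
by rewrite all_cat P1_ok; split=> // p r; rewrite big_cat P1E P2E.
Qed.

Lemma ff_graded_sum s n (T : Type) (l : seq T) (Q : pred T) G :
  (forall i, Q i -> ff_graded s n (G i)) ->
  ff_graded s n (fun p r => \sum_(i <- l | Q i) G i p r).
Proof.
move=> G_ok; elim: l => [|i l IH].
  by apply: ff_graded_eq (ff_graded0 s n) => p r; rewrite big_nil.
have [Qi|Qi] := boolP (Q i); last by apply: ff_graded_eq IH => p r; rewrite big_cons (negPf Qi).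
by apply: ff_graded_eq (ff_gradedD _ _ _ _ (G_ok i Qi) IH) => p r; rewrite big_cons Qi.
Qed.

Lemma ff_gradedMn s n m G : ff_graded s n G -> ff_graded s n (fun p r => m%:R * G p r).
Proof.
move=> G_ok; elim: m => [|m IH].
  by apply: ff_graded_eq (ff_graded0 s n) => p r; rewrite mul0r.
apply: ff_graded_eq (ff_gradedD _ _ _ _ G_ok IH) => p r.
by rewrite -natr1 mulrDl mul1r addrC.
Qed.

Lemma ff_graded_mon s n (t : ff_mon) :
  (forall i : 'I_d, (i < s)%N -> t.2 i = 0%N) -> (\sum_i t.2 i)%N = n ->
  ff_graded s n (ff_mon_eval t).
Proof.
move=> ts tn; exists [:: t]; split=> [|p r]; last by rewrite big_seq1.
by rewrite /= tn eqxx !andbT; apply/forallP => i; apply/implyP => /ts ->.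
Qed.

Lemma ff_graded_lin s n s' n' (f : ('I_d -> nat) -> ('I_d -> nat) -> K) G :
  (forall t : ff_mon, (forall i : 'I_d, (i < s)%N -> t.2 i = 0%N) -> (\sum_i t.2 i)%N = n ->
     ff_graded s' n' (fun p r => f p r * ff_mon_eval t p r)) ->
  ff_graded s n G -> ff_graded s' n' (fun p r => f p r * G p r).
Proof.
move=> f_ok [P [P_ok PE]].
apply: (ff_graded_eq _ _ (fun p r => \sum_(t <- P) f p r * ff_mon_eval t p r)) => [p r|].
  by rewrite PE mulr_sumr.
elim: P P_ok {PE} => [_|t P IH /= /andP[/andP[/forallP ts /eqP tn] /IH{IH} IH]].
  by apply: ff_graded_eq (ff_graded0 _ _) => p r; rewrite big_nil.
have t_ok := f_ok t (fun i lt => eqP (implyP (ts i) lt)) tn.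
by apply: ff_graded_eq (ff_gradedD _ _ _ _ t_ok IH) => p r; rewrite big_cons.
Qed.

Lemma ff_graded_le s s' n G : (s' <= s)%N -> ff_graded s n G -> ff_graded s' n G.
Proof.
move=> le [P [P_ok PE]]; exists P; split=> //; apply: sub_all P_ok => t /andP[/forallP ts ->].
rewrite andbT; apply/forallP => i; apply/implyP => lt.
by apply: (implyP (ts i)); apply: leq_trans le.
Qed.

Definition bump1 (i : 'I_d) (b : 'I_d -> nat) : 'I_d -> nat :=
  fun j => (b j + (j == i))%N.

Lemma bump1_prod (i : 'I_d) (b x : 'I_d -> nat) (c : 'I_d -> K) :
  \prod_j (c j * ((x j) ^_ (bump1 i b j))%:R)
  = ((x i)%:R - (b i)%:R) * \prod_j (c j * ((x j) ^_ (b j))%:R).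
Proof.
rewrite [LHS](bigD1 i) //= [in RHS](bigD1 i) //= mulrA; congr (_ * _); last first.
  by apply: eq_bigr => j /negPf ne; rewrite /bump1 ne addn0.
rewrite /bump1 eqxx addn1 ffactnSr.
have [le|lt] := leqP (b i) (x i); first by rewrite natrM natrB //; ring.
by rewrite ffact_small // mul0n !mulr0.
Qed.

(** (p_i + m al) (p_i)_a = (p_i)_(a+1) + a (p_i)_a + m al (p_i)_a. *)
Lemma ff_graded_mulp (i : 'I_d) m s n G : ff_graded s n G ->
  ff_graded s n (fun p r => ((p i)%:R + m%:R * al) * G p r).
Proof.
apply: ff_graded_lin => -[[e a] b] ts tn.
pose t1 : ff_mon := (e, bump1 i a, b); pose t2 : ff_mon := (e, a, b).
pose t3 : ff_mon := (e.+1, a, b).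
have t1_ok : ff_graded s n (ff_mon_eval t1) by apply: ff_graded_mon.
have t2_ok : ff_graded s n (ff_mon_eval t2) by apply: ff_graded_mon.
have t3_ok : ff_graded s n (ff_mon_eval t3) by apply: ff_graded_mon.
apply: ff_graded_eq (ff_gradedD _ _ _ _ t1_ok (ff_gradedD _ _ _ _
  (ff_gradedMn _ _ (a i) _ t2_ok) (ff_gradedMn _ _ m _ t3_ok))) => p r.
rewrite /ff_mon_eval /=.
have -> : \prod_j ((p j ^_ (bump1 i a j))%:R * (r j ^_ (b j))%:R)
   = ((p i)%:R - (a i)%:R) * \prod_j ((p j ^_ (a j))%:R * (r j ^_ (b j))%:R) :> K.
  under eq_bigr do rewrite mulrC.
  by rewrite bump1_prod; congr (_ * _); apply: eq_bigr => j _; rewrite mulrC.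
by rewrite exprS; ring.
Qed.

Definition tailsum r (s : nat) := (\sum_(t : 'I_d | s <= t) r t)%N.

Lemma ff_graded_mulr s n G : ff_graded s n G ->
  ff_graded s n.+1 (fun p r => ((tailsum r s)%:R - n%:R) * G p r).
Proof.
apply: ff_graded_lin => -[[e a] b] /= ts tn.
apply: (ff_graded_eq _ _ (fun p r => \sum_(i : 'I_d | (s <= i)%N) ff_mon_eval (e, a, bump1 i b) p r)).
  move=> p r; rewrite /ff_mon_eval /=.
  under [RHS]eq_bigr do rewrite bump1_prod mulrCA.
  rewrite -mulr_suml; congr (_ * _); rewrite sumrB -!natr_sum; congr (_ - _%:R).
  rewrite -tn (bigID (fun i : 'I_d => s <= i)%N) /= [X in (_ + X)%N]big1 ?addn0 // => i.
  by rewrite -ltnNge => /ts.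
apply: ff_graded_sum => i le; apply: ff_graded_mon => [j lt|] /=.
  by rewrite /bump1 ts //; case: eqP lt => // ->; rewrite ltnNge le.
by rewrite /bump1 big_split /= tn (bigD1 i) //= eqxx big1 ?addn1 // => j /negPf ->.
Qed.

Lemma ff_graded_rise (i : 'I_d) m s n G : ff_graded s n G ->
  ff_graded s n (fun p r => rise K al (p i)%:R m * G p r).
Proof.
move=> G_ok; elim: m => [|m IH].
  by apply: ff_graded_eq G_ok => p r; rewrite rise0 mul1r.
apply: ff_graded_eq (ff_graded_mulp i m _ _ _ IH) => p r.
by rewrite riseSr; ring.
Qed.

Lemma ff_graded_fall m s n G : ff_graded s n G ->
  ff_graded s (n + m)%N (fun p r => rise K (-1) ((tailsum r s)%:R - n%:R) m * G p r).
Proof.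
move=> G_ok; elim: m => [|m IH].
  by rewrite addn0; apply: ff_graded_eq G_ok => p r; rewrite rise0 mul1r.
rewrite addnS; apply: ff_graded_eq (ff_graded_mulr _ _ _ IH) => p r.
by rewrite riseSr natrD; ring.
Qed.

Definition rect_rows p r (s : nat) : seq nat :=
  flatten [seq nseq (p i) (tailsum r i) | i <- drop s (enum 'I_d)].

(** Splitting off the top block with c boxes below it, [rowJ_cat] shortens its rows by c, and c is
    also the degree in the r_t of the lower factor: exactly the shift that [ff_graded_fall] accepts.
    The factor k! = C(k, c) (k - c)! c! clears the denominators. *)
Lemma ff_graded_rowJ k s : (s <= d)%N ->
  ff_graded s k (fun p r => k`!%:R * rowJ k (nats (rect_rows p r s))).
Proof.
have [m] := ubnP (d - s); elim: m s k => // m IH s k lt_m.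
rewrite leq_eqVlt => /predU1P[->|lt_sd].
  have E p r : rect_rows p r d = [::] by rewrite /rect_rows drop_oversize // size_enum_ord.
  case: k => [|k]; last by apply: ff_graded_eq (ff_graded0 _ _) => p r; rewrite E /= mulr0.
  pose t0 : ff_mon := (0, fun=> 0, fun=> 0)%N.
  apply: (ff_graded_eq _ _ (ff_mon_eval t0)) => [p r|].
    by rewrite E rowJ0 mulr1 /ff_mon_eval expr0 mul1r big1 // => i _; rewrite !ffactn0 mul1r.
  by apply: ff_graded_mon => //; rewrite big1.
pose i := Ordinal lt_sd.
have rowsE p r : rect_rows p r s = nseq (p i) (tailsum r s) ++ rect_rows p r s.+1.
  rewrite /rect_rows (drop_nth i) ?size_enum_ord //=.
  by have -> : nth i (enum 'I_d) s = i by apply: val_inj; exact: nth_enum_ord.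
have fact0 n : n`!%:R != 0 :> K by apply: (al_fact_neq0 K al al_lin).
pose G (c : 'I_k.+1) p r : K := 'C(k, c)%:R * (rise K al (p i)%:R (k - c)
  * (rise K (-1) ((tailsum r s)%:R - c%:R) (k - c)
  * (c`!%:R * rowJ c (nats (rect_rows p r s.+1))))).
apply: (ff_graded_eq _ _ (fun p r => \sum_(c < k.+1) G c p r)) => [p r|].
  rewrite rowsE map_cat (rowJ_cat K al) mulr_sumr; apply: eq_bigr => c _.
  rewrite map_nseq map_nseq (rowJ_nseq K al al_lin) /G -(bin_fact (leq_ord c)) !natrM.
  by field; apply: fact0.
apply: ff_graded_sum => c _; apply: ff_gradedMn; apply: ff_graded_rise.
have := ff_graded_fall (k - c) s c; rewrite subnKC ?leq_ord //; apply.
by apply: (ff_graded_le s.+1) => //; apply: IH; lia.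
Qed.

End Positivity.

(** * Hook products and the change to the coordinates al x_i - i *)

Section Hooks.

Variables (K : fieldType) (al : K).
Hypothesis al_lin : forall a b : int, a%:~R + b%:~R * al = 0 -> a = 0 /\ b = 0.
Local Notation rowJ := (rowJ K al).
Local Notation unshift := (unshift K al).
Local Notation nats la := [seq n%:R : K | n <- la].

Definition hook_prod (la : seq nat) : K :=
  \prod_(i < size la) \prod_(j < nth 0%N la i)
    (al * (arm la i j)%:R + (leg la i j)%:R + 1).

Definition hook_prod' (la : seq nat) : K :=
  \prod_(i < size la) \prod_(j < nth 0%N la i)
    (al * (arm la i j)%:R + (leg la i j)%:R + al).

(** Deleting the first row changes neither arms nor legs of the remaining boxes, and [rowJ_top]
    supplies the hooks of the deleted row. *)
Lemma hook_prod_cons r mu : is_part (r :: mu) ->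
  hook_prod (r :: mu) = rowJ r (nats (r :: mu)) * hook_prod mu.
Proof.
move=> p_la; have [r0 le_r p_mu] := part_cons _ _ p_la.
rewrite (rowJ_top K al al_lin); last by case/andP: p_la.
rewrite /hook_prod /= big_ord_recl /=; congr (_ * _).
  apply: eq_bigr => j _; congr (al * _%:R + _%:R + 1).
  by rewrite /leg /= ltn_ord subn0 addnC addnK.
apply: eq_bigr => i _; apply: eq_bigr => j _; congr (al * _%:R + _%:R + 1).
have lt_jr : (j < r)%N.
  apply: leq_trans (ltn_ord j) _.
  have /(allP le_r) : nth 0%N mu i \in mu by apply: mem_nth.
  by [].
by rewrite /leg /= lt_jr /bump /= add1n add1n subSS.
Qed.

Lemma hook_prod_neq0 la : hook_prod la != 0.
Proof.
apply/prodf_neq0 => i _; apply/prodf_neq0 => j _.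
have -> : al * (arm la i j)%:R + (leg la i j)%:R + 1
  = (leg la i j).+1%:R + (arm la i j)%:R * al by rewrite -natr1; ring.
exact: al_nat_neq0.
Qed.

Lemma hook_prod'_row k : hook_prod' [:: k] = al ^+ k * k`!%:R.
Proof.
rewrite /hook_prod' /= big_ord1 /= -ffactnn ffact_prod natr_prod.
rewrite -[in al ^+ _](card_ord k) -prodr_const -big_split /=.
apply: eq_bigr => j _; rewrite /leg /arm /= ltn_ord addr0.
have -> : (k - j = (k - j - 1).+1)%N by have := ltn_ord j; lia.
by rewrite -natr1 subn1 /=; ring.
Qed.

Lemma poly_fun_polyfn N D (F : seq K -> K) (s : seq (K * seq nat)) :
  all (fun m => (size m.2 == N) && (sumn m.2 <= D)%N) s ->
  (forall x : seq K, size x = N ->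
      F x = \sum_(m <- s) m.1 * \prod_(i < N) (nth 0 x i) ^+ (nth 0%N m.2 i)) ->
  polyfn K N D (fun v => F (unshift 0 [seq v i | i <- enum 'I_N])).
Proof.
move=> /allP s_ok FE.
apply: (eq_polyfn _ _ _ _ (fun v => \sum_(m <- s) m.1 *
    \prod_(i <- index_enum 'I_N) ((v i + i%:R) / al) ^+ (nth 0%N m.2 i))) => [v|].
  rewrite FE; last by rewrite size_unshift size_map size_enum_ord.
  apply: eq_bigr => m _; congr (_ * _); apply: eq_bigr => i _; congr (_ ^+ _).
  have lt : (i < size [seq v j | j <- enum 'I_N])%N by rewrite size_map size_enum_ord.
  have E : [seq v j | j <- enum 'I_N]`_i = v i by rewrite (nth_map i) -?(size_map v) // nth_ord_enum.
  by rewrite (nth_unshift K al) // add0n E.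
apply: (polyfn_sum K N D _ s (fun m v => m.1 * \prod_(i <- index_enum 'I_N)
  ((v i + i%:R) / al) ^+ (nth 0%N m.2 i))) => m /s_ok /andP[/eqP m_N le]; apply: polyfn_scale.
apply: (polyfn_le _ _ (\sum_(i < N) nth 0%N m.2 i)).
  by move: le; rewrite sumnE (big_nth 0%N) big_mkord m_N.
apply: (polyfn_prod K N 'I_N _ (fun i : 'I_N => nth 0%N m.2 i)
  (fun i v => ((v i + i%:R) / al) ^+ nth 0%N m.2 i)) => i.
have := polyfn_exp K N 1 (nth 0%N m.2 i) (fun v => (v i + i%:R) / al).
rewrite muln1; apply; apply: (polyfn_mul K N 1 0); last exact: polyfn_const.
by apply: polyfn_add; [apply: polyfn_var | apply: polyfn_const].
Qed.

(** Numbering rows from 1 or from 0 moves all shifted coordinates by the same constant, which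
    cancels. *)
Lemma shifted_perm (F : seq K -> K) :
  (forall (x : seq K) (s : 'S_(size x)),
    F [seq nth 0 x (s i) - (s i).+1%:R / al + (i.+1)%:R / al
       | i <- enum 'I_(size x)] = F x) ->
  forall y1 y2, perm_eq y1 y2 -> F (unshift 0 y1) = F (unshift 0 y2).
Proof.
move=> F_sym y1 y2 y12; set x := unshift 0 y2.
have xE : size y2 == size x by rewrite size_unshift.
have := y12; rewrite -[y2]/(tval (Tuple xE)) => /tuple_permP[s ->].
rewrite -[RHS](F_sym x s); congr F.
apply: (@eq_from_nth _ 0) => [|i]; rewrite size_unshift size_tuple.
  by rewrite size_map size_enum_ord.
move=> lt_i; rewrite (nth_unshift K al) ?size_tuple //.
rewrite -[i]/(nat_of_ord (Ordinal lt_i)) -tnth_nth tnth_mktuple.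
rewrite (nth_map (Ordinal lt_i)) ?size_enum_ord // nth_ord_enum.
rewrite (tnth_nth 0) /= [in RHS]/x (nth_unshift K al) ?(eqP xE) ?ltn_ord //.
have al0 := al_neq0 K al al_lin.
by rewrite !add0n -!natr1; field.
Qed.

End Hooks.

(** * Both sides of the identity compared with the row function *)

Section RowJack.

Variables (K : fieldType) (al : K).
Hypothesis al_lin : forall a b : int, a%:~R + b%:~R * al = 0 -> a = 0 /\ b = 0.
Local Notation rowJ := (rowJ K al).
Local Notation nats la := [seq n%:R : K | n <- la].

Variable J : seq nat -> seq (K * seq nat).
Hypothesis J_homog : forall la, is_part la -> homogeneous K (sumn la) (J la).
Hypothesis J_tri : forall la tau, is_part la -> is_part tau ->
  mono_coef K (J la) tau != 0 -> dominated tau la.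
Hypothesis J_lead : forall la, is_part la -> mono_coef K (J la) la = hook_prod K al la.
Hypothesis J_orth : forall la mu, is_part la -> is_part mu -> mu != la ->
  jack_form K al (J la) (J mu) = 0.

Lemma jack_row_coef k la : (0 < k)%N -> is_part la ->
  Ko K (fun la => mono_coef K (J la)) la [:: k] = rowJ k (nats la).
Proof.
have H0 la' : is_part la' -> hook_prod K al la' != 0 by move=> _; apply: hook_prod_neq0.
apply: (Ko_rowJ K al al_lin _ (hook_prod K al)) => //.
- by move=> la' s t /J_homog; apply: mono_coef_inv.
- exact: (jack_eigen K al al_lin J (hook_prod K al)).
- exact: (u_nrm K J (hook_prod K al)).
- exact: (u_qsum K J).
- exact: (u_head K J).
- by rewrite /hook_prod big_ord0.
- exact: hook_prod_cons.
Qed.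

Lemma shifted_jack_row k (F : seq K -> K) la : (0 < k)%N ->
  (forall N, polyfn K N k (fun v => F (unshift K al 0 [seq v i | i <- enum 'I_N]))) ->
  (forall y1 y2, perm_eq y1 y2 -> F (unshift K al 0 y1) = F (unshift K al 0 y2)) ->
  (forall x, F (rcons x 0) = F x) ->
  (forall la, is_part la -> (sumn la <= k)%N -> F (nats la) =
     if la == [:: k] then hook_prod K al la * hook_prod' K al la / al ^+ k else 0) ->
  is_part la -> F (nats la) = k`!%:R * rowJ k (nats la).
Proof.
move=> k0 F_poly F_sym F_stable F_val p_la.
have H0 la' : is_part la' -> hook_prod K al la' != 0 by move=> _; apply: hook_prod_neq0.
have p_k : is_part [:: k] by rewrite /is_part /= k0.
have al0 : al ^+ k != 0 by rewrite expf_neq0 // (al_neq0 K al al_lin).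
have Fk : F [:: k%:R] = hook_prod K al [:: k] * k`!%:R.
  have := F_val [:: k] p_k; rewrite /= addn0 eqxx => ->//.
  by rewrite hook_prod'_row mulrA mulrAC mulfK // mulrC.
apply: (mulfI (H0 _ p_k)); rewrite mulrA -Fk; symmetry.
apply: (shifted_row_unique K al al_lin (fun la => mono_coef K (J la)) (hook_prod K al)) => //.
- by move=> la' s t /J_homog; apply: mono_coef_inv.
- exact: (jack_eigen K al al_lin J (hook_prod K al)).
- exact: (u_nrm K J (hook_prod K al)).
- exact: (u_qsum K J).
- exact: (u_head K J).
- by rewrite /hook_prod big_ord0.
- exact: hook_prod_cons.
by move=> la' p_la' le ne; rewrite F_val // (negPf ne).
Qed.

End RowJack.

Lemma multirect_sorted d (p r : 'I_d -> nat) : 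
  sorted geq (rect_rows d p r 0).
Proof.
rewrite /rect_rows drop0.
have : sorted (fun i j : 'I_d => i <= j)%N (enum 'I_d).
  by have := iota_sorted 0 d; rewrite -val_enum_ord sorted_map.
elim: (enum 'I_d) => //= i s IH s_i.
have le_trans : transitive (fun i j : 'I_d => i <= j)%N by move=> x y z; apply: leq_trans.
have := s_i; rewrite /= (path_sortedE le_trans) => /andP[/allP le_i s_s].
elim: (p i) => [|n IHn] /=; first exact: IH.
rewrite (path_sortedE (rev_trans leq_trans)) IHn andbT all_cat all_nseq leqnn orbT /=.
apply/allP => x /flattenP[t /mapP[j /le_i le_ij ->]]; rewrite mem_nseq => /andP[_ /eqP ->].
rewrite /= /tailsum [X in (_ <= X)%N](bigID (fun t : 'I_d => j <= t)%N) /=.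
apply: leq_trans (leq_addr _ _); rewrite leq_eqVlt; apply/orP; left; apply/eqP.
apply: eq_bigl => y; case: (leqP j y) => [le|]; last by rewrite andbF.
by rewrite (leq_trans le_ij le).
Qed.

Theorem theorem1p5 (k d : nat) (hk : (0 < k)%N) (hd : (0 < d)%N)
    (J : seq nat -> psum_expr) (hJ : is_Jack_J_family J)
    (Jstar : seq Qa -> Qa) (hJs : is_shifted_Jack [:: k] Jstar) :
  exists P : seq (ff_term d),
    ff_nonneg P /\
    forall p r : 'I_d -> nat,
      evalF Jstar (multirect p r) = (k`!)%:R * Ko_row J k (multirect p r) /\
      evalF Jstar (multirect p r) = ff_eval P p r.
Proof.
have J_homog la : is_part la -> homogeneous Qa (sumn la) (J la) by case/hJ.
have J_tri la tau : is_part la -> is_part tau ->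
  mono_coef Qa (J la) tau != 0 -> dominated tau la by case/hJ => _ + _ _; apply.
have J_lead la : is_part la -> mono_coef Qa (J la) la = hook_prod Qa alpha la by case/hJ.
have J_orth la mu : is_part la -> is_part mu -> mu != la ->
  jack_form Qa alpha (J la) (J mu) = 0 by case/hJ => _ _ _; apply.
have [F_poly F_sym F_stable F_val] := hJs.
have JE la : is_part la -> evalF Jstar la = k`!%:R * rowJ Qa alpha k [seq n%:R | n <- la].
  apply: (shifted_jack_row Qa alpha alpha_lin_eq0 J) => //.
  - move=> N; have [s [s_ok sE]] := F_poly N; rewrite /= addn0 in s_ok.
    exact: (poly_fun_polyfn _ _ _ _ _ s).
  - exact: (shifted_perm Qa alpha alpha_lin_eq0).
  - by move=> la' p_la'; have := F_val la' p_la'; rewrite /= addn0; apply.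
have [P [_ PE]] := ff_graded_rowJ Qa alpha alpha_lin_eq0 d k 0 (leq0n d).
exists [seq (1%:Q, t.1.1, t.1.2, t.2) | t <- P]; split.
  by rewrite /ff_nonneg all_map; elim: P {PE}.
move=> p r.
have p_la : is_part (multirect p r).
  rewrite /is_part filter_all andbT; apply: sorted_filter; first exact: rev_trans leq_trans.
  by have := multirect_sorted d p r; rewrite /rect_rows drop0.
split.
  rewrite JE // -(jack_row_coef Qa alpha alpha_lin_eq0 J) // /Ko_row /Ko /= addn0.
  by [].
have ratr1 : ratr 1 = 1 :> Qa by rewrite /ratr divr1.
(* [multirect] drops empty rows while the positive expansion is stated with them; they do not affect
   [rowJ]. *)
rewrite JE // /multirect (rowJ_filter Qa alpha alpha_lin_eq0); last first.
  by have := multirect_sorted d p r; rewrite /rect_rows drop0.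
have := PE p r; rewrite /rect_rows drop0 => ->.
by rewrite /ff_eval big_map; apply: eq_bigr => t _; rewrite ratr1 mul1r.
Qed.
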